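(* Let $(\mathfrak{g},\rho,V,\mathcal{V},B_0)$ and $(\mathfrak{g},\pi,U,\mathcal{U},B_0)$ be standard pentads over a field $\mathfrak{k}$ (with the same $\mathfrak{g}$ and $B_0$). Assume that $B_0$ is symmetric. Then the pentad $(L(\mathfrak{g},\rho,V,\mathcal{V},B_0),\tilde\pi^+,\tilde U^+,\tilde{\mathcal{U}}^-,B_L)$ is also a standard pentad, and the Lie algebra associated with it is isomorphic to $L(\mathfrak{g},\rho\oplus\pi,V\oplus U,\mathcal{V}\oplus\mathcal{U},B_0)$, i.e. $$L(L(\mathfrak{g},\rho,V,\mathcal{V},B_0),\tilde\pi^+,\tilde U^+,\tilde{\mathcal{U}}^-,B_L)\simeq L(\mathfrak{g},\rho\oplus\pi,V\oplus U,\mathcal{V}\oplus\mathcal{U},B_0)$$ as Lie algebras.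
   Context: All objects are over a field $\mathfrak{k}$ and may be infinite-dimensional. A representation of a Lie algebra $\mathfrak{l}$ on $W$ is written as a linear map $\mathfrak{l}\otimes W\to W$. Standard pentad $(\mathfrak{g},\rho,V,\mathcal{V},B_0)$: $\mathfrak{g}$ is a non-zero Lie algebra with a non-degenerate invariant bilinear form $B_0$ ($B_0([a,b],c)=B_0(a,[b,c])$), $\rho:\mathfrak{g}\otimes V\to V$ is a representation, $\mathcal{V}$ is a $\mathfrak{g}$-submodule of $\mathrm{Hom}(V,\mathfrak{k})$ with canonical representation $\varrho$ (so $\langle\rho(a\otimes v),\phi\rangle=-\langle v,\varrho(a\otimes\phi)\rangle$ for the canonical pairing $\langle\cdot,\cdot\rangle$), such that (i) $\langle\cdot,\cdot\rangle$ restricted to $V\times\mathcal{V}$ is non-degenerate, (ii) there is a (necessarily unique) linear map $\Phi_\rho:V\otimes\mathcal{V}\to\mathfrak{g}$, the $\Phi$-map, with $B_0(a,\Phi_\rho(v\otimes\phi))=\langle\rho(a\otimes v),\phi\rangle$ for all $a,v,\phi$. Put $\Psi_\rho(\phi\otimes v):=-\Phi_\rho(v\otimes\phi)$. A module $\mathcal{V}$ with a non-degenerate invariant pairing $V\times\mathcal{V}\to\mathfrak{k}$ is regarded as a submodule of $\mathrm{Hom}(V,\mathfrak{k})$. The pentad $(\mathfrak{g},\rho\oplus\pi,V\oplus U,\mathcal{V}\oplus\mathcal{U},B_0)$ (direct sum representation and pairing) is standard, with $\Phi$-map $(v,u)\otimes(\phi,\psi)\mapsto\Phi_\rho(v\otimes\phi)+\Phi_\pi(u\otimes\psi)$.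 Associated graded Lie algebra $L=L(\mathfrak{g},\rho,V,\mathcal{V},B_0)=\bigoplus_{n}V_n$ of any standard pentad: $V_0:=\mathfrak{g}$, $V_1:=V$, $V_{-1}:=\mathcal{V}$, with canonical representations $\rho_0$ (adjoint), $\rho_1=\rho$, $\rho_{-1}=\varrho$. For $x\in V_1$, $y\in V_{-1}$ write $x(y):=\Phi_\rho(x\otimes y)$, $y(x):=\Psi_\rho(y\otimes x)$. Let $p_0(x\otimes a):=-\rho_1(a\otimes x)$, $q_0(y\otimes a):=-\rho_{-1}(a\otimes y)$ for $a\in V_0$. Define $p_1:V_1\otimes V_1\to\mathrm{Hom}(V_{-1},V_1)$ by $p_1(v\otimes u)(\eta)=\rho_1(v(\eta)\otimes u)-\rho_1(u(\eta)\otimes v)$ and $q_{-1}:V_{-1}\otimes V_{-1}\to\mathrm{Hom}(V_1,V_{-1})$ by $q_{-1}(\phi\otimes\psi)(\xi)=\rho_{-1}(\phi(\xi)\otimes\psi)-\rho_{-1}(\psi(\xi)\otimes\phi)$. For $i\ge2$, inductively, $V_i:=\mathrm{Im}\,p_{i-1}\subset\mathrm{Hom}(V_{-1},V_{i-1})$, $V_{-i}:=\mathrm{Im}\,q_{-i+1}\subset\mathrm{Hom}(V_1,V_{-i+1})$ with the canonical $\mathfrak{g}$-module structures $\rho_{i},\rho_{-i}$, and $p_i:V_1\otimes V_i\to\mathrm{Hom}(V_{-1},V_i)$, $p_i(v\otimes u)(\eta)=\rho_i(v(\eta)\otimes u)+p_{i-1}(v\otimes u(\eta))$; $q_{-i}:V_{-1}\otimes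 V_{-i}\to\mathrm{Hom}(V_1,V_{-i})$, $q_{-i}(\phi\otimes\psi)(\xi)=\rho_{-i}(\phi(\xi)\otimes\psi)+q_{-i+1}(\phi\otimes\psi(\xi))$. The Lie bracket satisfies, for $a\in V_0$, $x\in V_1$, $y\in V_{-1}$, $z_n\in V_n$: $[a,z_n]=\rho_n(a\otimes z_n)$; $[x,z_n]=p_n(x\otimes z_n)$ if $n\ge0$, $=-z_n(x)$ if $n\le-1$; $[y,z_n]=-z_n(y)$ if $n\ge1$, $=q_n(y\otimes z_n)$ if $n\le0$; and it is extended inductively ($i\ge1$) by $[p_i(x\otimes z_i),w]=[x,[z_i,w]]-[z_i,[x,w]]$, $[q_{-i}(y\otimes\omega_{-i}),w]=[y,[\omega_{-i},w]]-[\omega_{-i},[y,w]]$. It is a theorem that this is a well-defined Lie algebra with $[V_n,V_m]\subset V_{n+m}$, generated by $V_{-1}\oplus V_0\oplus V_1$. Form $B_L$ (for symmetric $B_0$): the non-degenerate symmetric invariant bilinear form on $L$ determined by $B_L|_{V_0\times V_0}=B_0$, $B_L(v,\phi)=\langle v,\phi\rangle$ for $v\in V_1,\phi\in V_{-1}$, $B_L(p_i(v\otimes u),q_{-i}(\phi\otimes\psi))=B_L(u,[q_{-i}(\phi\otimes\psi),v])$ for $i\ge1$, and $B_L(V_n,V_m)=0$ for $n+m\ne0$. Positive extension $(\tilde\pi^+,\tilde U^+)$ of the $\mathfrak{g}$-module $(\pi,U)$ with respect to $(\mathfrak{g},\rho,V,\mathcal{V},B_0)$: $U_0^+:=U$,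 $\pi_0^+:=\pi$, $r_0^+:V_1\otimes U_0^+\to\mathrm{Hom}(V_{-1},U_0^+)$, $r_0^+(x\otimes u)(\eta)=\pi([\eta,x]\otimes u)$; for $j\ge1$, $U_j^+:=\mathrm{Im}\,r_{j-1}^+\subset\mathrm{Hom}(V_{-1},U_{j-1}^+)$ with canonical representation $\pi_j^+$ of $\mathfrak{g}$, and $r_j^+(x\otimes u)(\eta)=\pi_j^+([\eta,x]\otimes u)+r_{j-1}^+(x\otimes u(\eta))$. $\tilde U^+=\bigoplus_{m\ge0}U_m^+$; $\tilde\pi^+$ is the (unique, well-defined) $L$-module structure with $\tilde\pi^+(V_n\otimes U_m^+)\subset U_{n+m}^+$ and, for $u\in U_m^+$: $V_0$ acting by $\pi_m^+$; $x\in V_1$ acting by $u\mapsto r_m^+(x\otimes u)$; $y\in V_{-1}$ acting by $u\mapsto u(y)$ for $m\ge1$ and by $0$ for $m=0$. Negative extension $(\tilde\varpi^-,\tilde{\mathcal{U}}^-)$ of the $\mathfrak{g}$-module $(\varpi,\mathcal{U})$ ($\varpi$ the canonical representation on $\mathcal{U}\subset\mathrm{Hom}(U,\mathfrak{k})$): $\mathcal{U}_0^-:=\mathcal{U}$, $r_0^-:V_{-1}\otimes\mathcal{U}_0^-\to\mathrm{Hom}(V_1,\mathcal{U}_0^-)$, $r_0^-(y\otimes w)(\xi)=\varpi([\xi,y]\otimes w)$; for $j\ge1$, $\mathcal{U}_{-j}^-:=\mathrm{Im}\,r_{-j+1}^-\subset\mathrm{Hom}(V_1,\mathcal{U}_{-j+1}^-)$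 with canonical representation $\varpi_{-j}^-$, and $r_{-j}^-(y\otimes w)(\xi)=\varpi_{-j}^-([\xi,y]\otimes w)+r_{-j+1}^-(y\otimes w(\xi))$. $\tilde{\mathcal{U}}^-=\bigoplus_{m\le0}\mathcal{U}_m^-$; $\tilde\varpi^-$ is the (unique, well-defined) graded $L$-module structure with, for $w\in\mathcal{U}_m^-$: $V_0$ acting by $\varpi_m^-$; $y\in V_{-1}$ acting by $w\mapsto r_m^-(y\otimes w)$; $x\in V_1$ acting by $w\mapsto w(x)$ for $m\le-1$ and by $0$ for $m=0$. Pairing: $\tilde{\mathcal{U}}^-$ is regarded as an $L$-submodule of $\mathrm{Hom}(\tilde U^+,\mathfrak{k})$ via the (well-defined) bilinear map $\langle\cdot,\cdot\rangle:\tilde U^+\times\tilde{\mathcal{U}}^-\to\mathfrak{k}$ which is zero on $U_n^+\times\mathcal{U}_{-m}^-$ for $n\ne m$, is the canonical pairing on $U_0^+\times\mathcal{U}_0^-=U\times\mathcal{U}$, and for $i\ge1$ satisfies $\langle r_{i-1}^+(x\otimes u),r_{-i+1}^-(y\otimes w)\rangle=-\langle\tilde\pi^+(y\otimes r_{i-1}^+(x\otimes u)),w\rangle$. *)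

(* Defs.v *)
From HB Require Import structures.
From mathcomp Require Import all_boot all_order all_algebra.
From mathcomp Require Import boolp classical_sets functions.

Set Implicit Arguments.
Unset Strict Implicit.
Unset Printing Implicit Defensive.

Import GRing.Theory.
Local Open Scope classical_set_scope.
Local Open Scope ring_scope.

(* Vector spaces over the field k are arbitrary (possibly infinite-dimensional)
   objects of [lmodType k].  The data of Lie algebras and pentads are kept
   separate from their axioms ([is_lie], [standard], ...). *)

Section LinearAlgebra.
Variable k : fieldType.
Implicit Types U V W A B : lmodType k.

Definition is_bilinear U V W (f : U -> V -> W) : Prop :=
  (forall u, linear (f u)) /\ (forall v, linear (f^~ v)).

Definition is_bilinear_form U V (f : U -> V -> k) : Prop :=
  (forall u, scalar (f u)) /\ (forall v, scalar (f^~ v)).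

Definition is_nondegenerate U V (f : U -> V -> k) : Prop :=
  (forall u, (forall v, f u v = 0) -> u = 0) /\
  (forall v, (forall u, f u v = 0) -> v = 0).

Record submod A := Submod {
  submod_set :> A -> Prop;
  submod0 : submod_set 0;
  submodP : forall c u v, submod_set u -> submod_set v -> submod_set (c *: u + v)
}.

Definition is_submod A (S : set A) : Prop :=
  S 0 /\ forall c u v, S u -> S v -> S (c *: u + v).

Definition fullmod A : submod A :=
  @Submod A setT I (fun _ _ _ _ _ => I).

Section Span.
Variables (A : lmodType k) (X : set A).

Fact span0 : smallest (@is_submod A) X 0.
Proof. by move=> S [[S0 _] _]. Qed.

Fact spanP c u v : smallest (@is_submod A) X u -> smallest (@is_submod A) X v ->
  smallest (@is_submod A) X (c *: u + v).
Proof.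
by move=> Xu Xv S SX; have [[_ SP] _] := SX; apply: SP; [apply: Xu|apply: Xv].
Qed.

Definition span : submod A := Submod span0 spanP.
End Span.

(* The image of the restriction to V ⊗ S of the linear map V ⊗ A -> B induced
   by f. *)
Definition tensor_im V A B (f : V -> A -> B) (S : submod A) : submod B :=
  span [set f v u | v in setT & u in submod_set S].

End LinearAlgebra.

Section DirectSum.
Variables (k : fieldType) (I : eqType) (A : I -> lmodType k).
Variable S : forall i, submod (A i).

Record dsum := DSum {
  dsum_comp :> forall i, A i;
  dsum_in : forall i, S i (dsum_comp i);
  dsum_fin : exists s : seq I, forall i, i \notin s -> dsum_comp i = 0
}.

HB.instance Definition _ := gen_eqMixin dsum.
HB.instance Definition _ := gen_choiceMixin dsum.

Fact dsum_ext (x y : dsum) : (forall i, x i = y i) -> x = y.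
Proof.
case: x y => [x xS xf] [y yS yf] /= exy.
have E : x = y by apply: functional_extensionality_dep.
by case: y / E yS yf {exy} => yS yf; congr DSum; apply: Prop_irrelevance.
Qed.

Fact dsum0_fin : exists s : seq I, forall i, i \notin s -> (0 : A i) = 0.
Proof. by exists [::]. Qed.

Definition dsum0 : dsum := DSum (fun i => submod0 (S i)) dsum0_fin.

Fact dsum_lin_fin (c : k) (x y : dsum) :
  exists s : seq I, forall i, i \notin s -> c *: x i + y i = 0.
Proof.
have [s xs] := dsum_fin x; have [t yt] := dsum_fin y; exists (s ++ t) => i.
by rewrite mem_cat => /norP[/xs-> /yt->]; rewrite scaler0 addr0.
Qed.

Definition dsum_lin (c : k) (x y : dsum) : dsum :=
  DSum (fun i => submodP c (dsum_in x i) (dsum_in y i)) (dsum_lin_fin c x y).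

Definition dsum_add := dsum_lin 1.
Definition dsum_scale c x := dsum_lin c x dsum0.
Definition dsum_opp := dsum_scale (-1).

Fact dsum_addA : associative dsum_add.
Proof. by move=> x y z; apply: dsum_ext => i /=; rewrite !scale1r addrA. Qed.
Fact dsum_addC : commutative dsum_add.
Proof. by move=> x y; apply: dsum_ext => i /=; rewrite !scale1r addrC. Qed.
Fact dsum_add0 : left_id dsum0 dsum_add.
Proof. by move=> x; apply: dsum_ext => i /=; rewrite scale1r add0r. Qed.
Fact dsum_addN : left_inverse dsum0 dsum_opp dsum_add.
Proof.
by move=> x; apply: dsum_ext => i /=; rewrite scale1r addr0 scaleN1r addNr.
Qed.

HB.instance Definition _ :=
  GRing.isZmodule.Build dsum dsum_addA dsum_addC dsum_add0 dsum_addN.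

Fact dsum_scaleA a b v : dsum_scale a (dsum_scale b v) = dsum_scale (a * b) v.
Proof. by apply: dsum_ext => i /=; rewrite !addr0 scalerA. Qed.
Fact dsum_scale1 : left_id 1 dsum_scale.
Proof. by move=> x; apply: dsum_ext => i /=; rewrite scale1r addr0. Qed.
Fact dsum_scaleDr : right_distributive dsum_scale +%R.
Proof.
by move=> c x y; apply: dsum_ext => i /=; rewrite !scale1r !addr0 scalerDr.
Qed.
Fact dsum_scaleDl v : {morph dsum_scale^~ v : a b / a + b}.
Proof.
by move=> a b; apply: dsum_ext => i /=; rewrite scale1r !addr0 scalerDl.
Qed.

HB.instance Definition _ := GRing.Zmodule_isLmodule.Build k dsum
  dsum_scaleA dsum_scale1 dsum_scaleDr dsum_scaleDl.

Fact dsumDE (x y : dsum) i : (x + y) i = x i + y i.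
Proof. by rewrite /= scale1r. Qed.
Fact dsumZE c (x : dsum) i : (c *: x) i = c *: x i.
Proof. by rewrite /= addr0. Qed.

Definition homog (x : dsum) (n : I) : Prop := forall m, m != n -> x m = 0.

End DirectSum.

Record lieData (k : fieldType) := LieData {
  lie_car :> lmodType k;
  lie_br : lie_car -> lie_car -> lie_car
}.

Notation "⁅ a , b ⁆" := (lie_br a b) (at level 0, format "⁅ a ,  b ⁆").

Section Lie.
Variable k : fieldType.

Definition is_lie_bracket (A : lmodType k) (br : A -> A -> A) : Prop :=
  [/\ is_bilinear br,
      forall a, br a a = 0 &
      forall a b c, br a (br b c) = br (br a b) c + br b (br a c)].

Definition is_lie (g : lieData k) : Prop := is_lie_bracket (@lie_br k g).

Definition is_rep (g : lieData k) (W : lmodType k) (act : g -> W -> W) : Prop :=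
  is_bilinear act /\
  forall a b w, act ⁅a, b⁆ w = act a (act b w) - act b (act a w).

Definition is_invariant_form (g : lieData k) (B : g -> g -> k) : Prop :=
  forall a b c, B ⁅a, b⁆ c = B a ⁅b, c⁆.

Definition lie_isomorphic (g h : lieData k) : Prop :=
  is_lie g /\ is_lie h /\ exists f : {linear g -> h},
    bijective f /\ forall a b, f ⁅a, b⁆ = ⁅f a, f b⁆.

End Lie.

(* The module 𝒱 is given as an abstract g-module with a pairing V × 𝒱 -> k,
   which embeds it in Hom(V,k) as soon as the pairing is non-degenerate and
   invariant.  [rho] and [crho] are the representations on V and on 𝒱. *)
Record pentad (k : fieldType) (g : lieData k) (B0 : g -> g -> k) := Pentad {
  pV : lmodType k;
  pW : lmodType k;
  rho : g -> pV -> pV;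
  crho : g -> pW -> pW;
  pairing : pV -> pW -> k
}.

Arguments rho {k g B0} p : rename.
Arguments crho {k g B0} p : rename.
Arguments pairing {k g B0} p : rename.

Section Standard.
Variables (k : fieldType) (g : lieData k) (B0 : g -> g -> k) (P : pentad B0).

Definition is_Phi (F : pV P -> pW P -> g) : Prop :=
  is_bilinear F /\
  forall a v phi, B0 a (F v phi) = pairing P (rho P a v) phi.

Record standard : Prop := Standard {
  std_neq0 : exists a : g, a <> 0;
  std_lie : is_lie g;
  std_form : is_bilinear_form B0;
  std_form_nondeg : is_nondegenerate B0;
  std_form_inv : is_invariant_form B0;
  std_rho : is_rep (rho P);
  std_crho : is_rep (crho P);
  std_pairing : is_bilinear_form (pairing P);
  std_pairing_inv : forall a v phi,
    pairing P (rho P a v) phi = - pairing P v (crho P a phi);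
  std_pairing_nondeg : is_nondegenerate (pairing P);
  std_Phi : exists F, is_Phi F
}.

(* The Φ-map is unique when [standard] holds. *)
Definition Phi : pV P -> pW P -> g := xget (fun _ _ => 0) [set F | is_Phi F].

Definition Psi (phi : pW P) (v : pV P) : g := - Phi v phi.

End Standard.

Arguments Phi {k g B0} P.
Arguments Psi {k g B0} P.

Section PentadSum.
Variables (k : fieldType) (g : lieData k) (B0 : g -> g -> k).

Definition pentad_sum (P Q : pentad B0) : pentad B0 :=
  @Pentad k g B0 (pV P * pV Q)%type (pW P * pW Q)%type
    (fun a v => (rho P a v.1, rho Q a v.2))
    (fun a phi => (crho P a phi.1, crho Q a phi.2))
    (fun v phi => pairing P v.1 phi.1 + pairing Q v.2 phi.2).

End PentadSum.

(* Everything in this section is used twice: with (V, 𝒱, Φ) for the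
   non-negative degrees, and with (𝒱, V, Ψ) for the non-positive ones.
   The subspaces Im p_i of Hom(W, V_i) are realized inside the iterated
   function spaces W -> ... -> W -> V; their elements are automatically linear
   for a standard pentad. *)
Section Pieces.
Variables (k : fieldType) (g : lieData k) (V W : lmodType k).
Variables (rhoV : g -> V -> V) (rhoW : g -> W -> W) (F : V -> W -> g).

Fixpoint iterhom (U : lmodType k) (n : nat) : lmodType k :=
  if n is m.+1 then (W -> iterhom U m : lmodType k) else U.

(* canonical representation of g on Hom(W, ... Hom(W, U)) *)
Fixpoint iterrep (U : lmodType k) (pi : g -> U -> U) (n : nat) :
    g -> iterhom U n -> iterhom U n :=
  match n return g -> iterhom U n -> iterhom U n with
  | 0 => pi
  | m.+1 => fun a f => fun eta => iterrep pi a (f eta) - f (rhoW a eta)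
  end.

Definition lie_amb (n : nat) : lmodType k :=
  if n is m.+1 then iterhom V m else g.

Definition lie_rep (n : nat) : g -> lie_amb n -> lie_amb n :=
  match n return g -> lie_amb n -> lie_amb n with
  | 0 => fun a b => ⁅a, b⁆
  | m.+1 => @iterrep V rhoV m
  end.

(* u, eta |-> u(eta) *)
Definition lie_ev (n : nat) : lie_amb n.+1 -> W -> lie_amb n :=
  match n return lie_amb n.+1 -> W -> lie_amb n with
  | 0 => F
  | m.+1 => fun u eta => u eta
  end.

(* For n = 1 this is the stated formula for p_1, because
   p_0(v ⊗ u(eta)) = - rho(u(eta) ⊗ v). *)
Fixpoint lie_p (n : nat) : V -> lie_amb n -> lie_amb n.+1 :=
  match n return V -> lie_amb n -> lie_amb n.+1 with
  | 0 => fun v a => - rhoV a v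
  | m.+1 => fun v u => fun eta : W =>
      @lie_rep m.+1 (F v eta) u + @lie_p m v (@lie_ev m u eta)
  end.

Fixpoint lie_piece (n : nat) : submod (lie_amb n) :=
  match n return submod (lie_amb n) with
  | 0 => fullmod g
  | m.+1 =>
    match m return submod (lie_amb m) -> submod (lie_amb m.+1) with
    | 0 => fun _ => fullmod V
    | l.+1 => fun S => tensor_im (@lie_p l.+1) S
    end (lie_piece m)
  end.

(* Extension of a g-module (pi, U); here [eta, x] = - x(eta) = - F x eta. *)
Section Extension.
Variables (U : lmodType k) (pi : g -> U -> U).

Fixpoint ext_r (n : nat) : V -> iterhom U n -> iterhom U n.+1 :=
  match n return V -> iterhom U n -> iterhom U n.+1 with
  | 0 => fun x u => fun eta : W => pi (- F x eta) u
  | m.+1 => fun x u => fun eta : W =>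
      @iterrep U pi m.+1 (- F x eta) u + @ext_r m x (u eta)
  end.

Fixpoint ext_piece (n : nat) : submod (iterhom U n) :=
  match n return submod (iterhom U n) with
  | 0 => fullmod U
  | m.+1 => tensor_im (@ext_r m) (ext_piece m)
  end.

Definition extension : lmodType k := dsum ext_piece.

End Extension.
End Pieces.

Section GradedLie.
Variables (k : fieldType) (g : lieData k) (B0 : g -> g -> k) (P : pentad B0).
Let V := pV P.
Let W := pW P.
Let r : g -> V -> V := rho P.
Let s : g -> W -> W := crho P.

(* [Negz n] is the integer - (n + 1). *)
Definition L_amb (n : int) : lmodType k :=
  match n with
  | Posz n => lie_amb g V W n
  | Negz n => lie_amb g W V n.+1
  end.

Definition L_piece (n : int) : submod (L_amb n) :=
  match n return submod (L_amb n) with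
  | Posz n => lie_piece r s (Phi P) n
  | Negz n => lie_piece s r (Psi P) n.+1
  end.

Definition L_rep (n : int) : g -> L_amb n -> L_amb n :=
  match n return g -> L_amb n -> L_amb n with
  | Posz n => @lie_rep k g V W r s n
  | Negz n => @lie_rep k g W V s r n.+1
  end.

Definition L_car : lmodType k := dsum L_piece.

Implicit Types z : dsum L_piece.

Definition L0 z : g := z 0.
Definition L1 z : V := z 1.
Definition Lm1 z : W := z (-1).

Let p n := @lie_p k g V W r s (Phi P) n.
Let q n := @lie_p k g W V s r (Psi P) n.
Let evp n := @lie_ev k g V W (Phi P) n.
Let evm n := @lie_ev k g W V (Psi P) n.

(* The formulas for [a, z], [x, z] and [y, z] with a in V_0, x in V_1, y in
   V_{-1} are given componentwise for arbitrary z in L.  As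
   p_i(x ⊗ z_i) = [x, z_i] and q_{-i}(y ⊗ z_{-i}) = [y, z_{-i}], the recursive
   rules which extend them to a bracket on L × L are instances of the Jacobi
   identity. *)
Record is_L_bracket (br : L_car -> L_car -> L_car) : Prop := IsLBracket {
  Lbr_lie : is_lie_bracket br;
  Lbr_0 : forall a z, homog a 0 ->
    forall n : int, br a z n = L_rep (L0 a) (z n);
  Lbr_1_pos : forall x z, homog x 1 ->
    forall n : nat, br x z (Posz n.+1) = p (L1 x) (z (Posz n));
  Lbr_1_0 : forall x z, homog x 1 ->
    br x z (Posz 0) = - @evm 0 (z (Negz 0)) (L1 x);
  Lbr_1_neg : forall x z, homog x 1 ->
    forall n : nat, br x z (Negz n) = - @evm n.+1 (z (Negz n.+1)) (L1 x);
  Lbr_m1_pos : forall y z, homog y (-1) ->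
    forall n : nat, br y z (Posz n) = - @evp n (z (Posz n.+1)) (Lm1 y);
  Lbr_m1_0 : forall y z, homog y (-1) ->
    br y z (Negz 0) = @q 0 (Lm1 y) (z (Posz 0));
  Lbr_m1_neg : forall y z, homog y (-1) ->
    forall n : nat, br y z (Negz n.+1) = @q n.+1 (Lm1 y) (z (Negz n))
}.

(* For a standard pentad there is exactly one such bracket. *)
Definition L_br : L_car -> L_car -> L_car :=
  xget (fun _ _ => 0) [set br | is_L_bracket br].

Definition L : lieData k := LieData L_br.

(* In [BL_rec], [v, u] = p_i(v ⊗ u) and [phi, psi] = q_{-i}(phi ⊗ psi). *)
Record is_BL (B : L -> L -> k) : Prop := IsBL {
  BL_bilin : is_bilinear_form B;
  BL_sym : forall z w, B z w = B w z;
  BL_nondeg : is_nondegenerate B;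
  BL_inv : is_invariant_form B;
  BL_0 : forall a b : L, homog a 0 -> homog b 0 -> B a b = B0 (L0 a) (L0 b);
  BL_1 : forall v phi : L, homog v 1 -> homog phi (-1) ->
    B v phi = pairing P (L1 v) (Lm1 phi);
  BL_rec : forall (i : nat) (v u phi psi : L), (1 <= i)%N ->
    homog v 1 -> homog u (Posz i) ->
    homog phi (-1) -> homog psi (- Posz i) ->
    B ⁅v, u⁆ ⁅phi, psi⁆ = B u ⁅⁅phi, psi⁆, v⁆;
  BL_orth : forall (n m : int) (z w : L),
    homog z n -> homog w m -> n + m != 0 -> B z w = 0
}.

(* For a standard pentad with B0 symmetric there is exactly one such form. *)
Definition BL : L -> L -> k := xget (fun _ _ => 0) [set B | is_BL B].

End GradedLie.

Section Extensions.
Variables (k : fieldType) (g : lieData k) (B0 : g -> g -> k).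
Variables P Q : pentad B0.

(* Ũ⁺ is the extension of U = [pV Q] and Ũ⁻ that of 𝒰 = [pW Q], both with
   respect to P; the component m of an element of Ũ⁻ has degree -m. *)
Definition Upos : lmodType k :=
  extension (crho P) (Phi P) (rho Q).
Definition Uneg : lmodType k :=
  extension (rho P) (Psi P) (crho Q).

Let Upiece := ext_piece (crho P) (Phi P) (rho Q).
Let Npiece := ext_piece (rho P) (Psi P) (crho Q).

Record is_pos_ext (act : L P -> Upos -> Upos) : Prop := IsPosExt {
  pext_rep : is_rep act;
  pext_graded : forall (n : int) (m : nat) (z : L P) (u : dsum Upiece),
    homog z n -> homog u m ->
    forall j : nat, Posz j != n + Posz m -> act z u j = 0;
  pext_0 : forall (a : L P) (u : dsum Upiece), homog a 0 ->
    forall m, act a u m = iterrep (crho P) (rho Q) (L0 a) (u m);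
  pext_1_0 : forall (x : L P) (u : dsum Upiece), homog x 1 -> act x u 0 = 0;
  pext_1 : forall (x : L P) (u : dsum Upiece), homog x 1 ->
    forall m, act x u m.+1
      = ext_r (crho P) (Phi P) (rho Q) (L1 x) (u m);
  pext_m1 : forall (y : L P) (u : dsum Upiece), homog y (-1) ->
    forall m, act y u m = (u m.+1 : pW P -> _) (Lm1 y)
}.

Record is_neg_ext (act : L P -> Uneg -> Uneg) : Prop := IsNegExt {
  next_rep : is_rep act;
  next_graded : forall (n : int) (m : nat) (z : L P) (w : dsum Npiece),
    homog z n -> homog w m ->
    forall j : nat, - Posz j != n - Posz m -> act z w j = 0;
  next_0 : forall (a : L P) (w : dsum Npiece), homog a 0 ->
    forall m, act a w m = iterrep (rho P) (crho Q) (L0 a) (w m);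
  next_m1_0 : forall (y : L P) (w : dsum Npiece), homog y (-1) -> act y w 0 = 0;
  next_m1 : forall (y : L P) (w : dsum Npiece), homog y (-1) ->
    forall m, act y w m.+1
      = ext_r (rho P) (Psi P) (crho Q) (Lm1 y) (w m);
  next_1 : forall (x : L P) (w : dsum Npiece), homog x 1 ->
    forall m, act x w m = (w m.+1 : pV P -> _) (L1 x)
}.

(* For standard pentads there is exactly one such action of L on each side. *)
Definition pos_act : L P -> Upos -> Upos :=
  xget (fun _ _ => 0) [set act | is_pos_ext act].
Definition neg_act : L P -> Uneg -> Uneg :=
  xget (fun _ _ => 0) [set act | is_neg_ext act].

(* In [epair_rec], x·u = r⁺_i(x ⊗ u) and y·w = r⁻_{-i}(y ⊗ w). *)
Record is_ext_pairing (f : Upos -> Uneg -> k) : Prop := IsExtPairing {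
  epair_bilin : is_bilinear_form f;
  epair_orth : forall (n m : nat) (u : dsum Upiece) (w : dsum Npiece),
    homog u n -> homog w m -> n != m -> f u w = 0;
  epair_0 : forall (u : dsum Upiece) (w : dsum Npiece),
    homog u 0%N -> homog w 0%N -> f u w = pairing Q (u 0%N) (w 0%N);
  epair_rec : forall (i : nat) (x y : L P) (u : dsum Upiece) (w : dsum Npiece),
    homog x 1 -> homog y (-1) -> homog u i -> homog w i ->
    f (pos_act x u) (neg_act y w) = - f (pos_act y (pos_act x u)) w
}.

Definition ext_pairing : Upos -> Uneg -> k :=
  xget (fun _ _ => 0) [set f | is_ext_pairing f].

Definition pentad_ext : pentad (@BL k g B0 P) :=
  @Pentad k (L P) (@BL k g B0 P) Upos Uneg pos_act neg_act ext_pairing.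

End Extensions.

(* Main.v *)
(* A graded Lie algebra with local part (V_-1, V_0, V_1) which is generated by
   its local part and transitive in degrees of absolute value at least 2 is
   governed by the three families of operators [a, -], [x, -], [y, -] with a in
   V_0, x in V_1, y in V_-1.  If H is another space on which local operators act
   with the same commutation relations, let S_n be the span of the pairs
   ([x_1,[...,x_n]], x_1...x_{n-1} h(x_n)).  The operators of V_-1 map S_{n+1} to
   S_n, so (0, h) in S_n forces h = 0 by induction as soon as H is transitive
   along the S_n, and then S_n is the graph of an equivariant map.  Taking for H
   a space of linear maps, this one extension principle yields the bracket of L
   (H = End L), its invariant form (H = L^* ), the actions of L on the positive
   and negative extensions (H = End U), and the pairing between these.
   Transitivity in H comes down to that of L or of U, or to generation.

   The same principle sends L(g, V + U, ...) to L(L(g, V, ...), U^+, ...): give V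
   and U total degree 1.  The resulting homomorphism is onto because its target
   is generated by the images of the local parts, and injective because it
   preserves the invariant forms, the one on its source being non-degenerate. *)

(* The obstacle behind every construction is well-definedness: an element of degree n is a
   combination of words in V_1 in many ways. A map out of degree n is therefore first a relation,
   and it becomes a function only once transitivity has been checked. Bracket, form, actions and
   pairing are chosen in the definitions among all objects with given properties, so existence has
   to be established before anything can be computed with them.

   The overview is silent on the [Phi]-map of the extended pentad: the functional a |-> <a u, w> on
   a possibly infinite-dimensional L must be represented by an element of L through the form. For u
   and w in the lowest pieces, the element is the [Phi]-value of the second pentad, placed in V_0.
   Both extensions are generated from there, and invariance moves each generator from u or w over to
   the representing element.

   Symmetry of [B0] enters through the form: the element [x, y] of V_0 must define the same
   functional from both sides. The form obtained on L is again symmetric, so the construction can be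
   repeated with L in the place of g. *)
From HB Require Import structures.
Require Import Defs.
From mathcomp Require Import all_boot all_order all_algebra.
From mathcomp Require Import boolp classical_sets functions.

Set Implicit Arguments.
Unset Strict Implicit.
Unset Printing Implicit Defensive.

Import GRing.Theory.
Local Open Scope ring_scope.

(** * A decision procedure for identities in abelian groups *)

Inductive zexpr := ZZero | ZVar of nat | ZAdd of zexpr & zexpr | ZOpp of zexpr.

Fixpoint zcoef (e : zexpr) (i : nat) : int :=
  match e with
  | ZZero => 0
  | ZVar n => (n == i)%:Z
  | ZAdd a b => zcoef a i + zcoef b i
  | ZOpp a => - zcoef a i
  end.

Fixpoint zeval (V : zmodType) (s : seq V) (e : zexpr) : V :=
  match e with
  | ZZero => 0
  | ZVar n => s`_n
  | ZAdd a b => zeval s a + zeval s b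
  | ZOpp a => - zeval s a
  end.

Lemma zevalE (V : zmodType) (s : seq V) e :
  zeval s e = \sum_(0 <= i < size s) s`_i *~ zcoef e i.
Proof.
elim: e => /= [|n|a -> b ->|a ->].
- by rewrite big1.
- have [ns|sn] := ltnP n (size s).
    rewrite (bigD1_seq n) ?mem_index_iota ?iota_uniq //= eqxx mulr1z big1 ?addr0 //.
    by move=> i; rewrite eq_sym => /negbTE->; rewrite mulr0z.
  rewrite nth_default // big_nat big1 // => i /andP[_ si].
  by rewrite gtn_eqF ?mulr0z // (leq_trans si sn).
- by rewrite -big_split; apply: eq_bigr => i _; rewrite mulrzDr.
- by rewrite -sumrN; apply: eq_bigr => i _; rewrite mulrNz.
Qed.

(** The integer coefficients of the atoms decide the identity in every abelian group at once, so the
    hypothesis is settled by computation. *)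
Lemma zmod_correct (V : zmodType) (s : seq V) e1 e2 :
  all (fun i => zcoef e1 i == zcoef e2 i) (iota 0 (size s)) ->
  zeval s e1 = zeval s e2.
Proof.
move=> /allP H; rewrite !zevalE !big_nat; apply: eq_bigr => i si.
by rewrite (eqP (H i _)) // mem_iota.
Qed.

(* Atoms are compared up to conversion: the same vector may carry different
   but convertible module structures. *)
Ltac zsame a t := first [constr_eq_strict a t | unify a t].

Ltac zindex t s :=
  lazymatch s with
  | ?a :: ?r =>
    match constr:(tt) with
    | _ => let _ := match constr:(tt) with _ => zsame a t end in constr:(0%N)
    | _ => let n := zindex t r in constr:(S n)
    end
  end.

Ltac zinsert t s :=
  lazymatch s with
  | [::] => constr:([:: t])
  | ?a :: ?r =>
    match constr:(tt) with
    | _ => let _ := match constr:(tt) with _ => zsame a t end in constr:(s)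
    | _ => let r' := zinsert t r in constr:(a :: r')
    end
  end.

Ltac zatoms t s :=
  lazymatch t with
  | 0 => s
  | ?a + ?b => let s1 := zatoms a s in zatoms b s1
  | - ?a => zatoms a s
  | _ => zinsert t s
  end.

Ltac zreify t s :=
  lazymatch t with
  | 0 => constr:(ZZero)
  | ?a + ?b => let x := zreify a s in let y := zreify b s in constr:(ZAdd x y)
  | - ?a => let x := zreify a s in constr:(ZOpp x)
  | _ => let n := zindex t s in constr:(ZVar n)
  end.

(** Only 0, sums and opposites are interpreted. Scaled vectors and values of maps are atoms, hence
    linearity has to be used up before the call. *)
Ltac zmod :=
  lazymatch goal with
  | |- @eq ?V ?x ?y =>
    let s0 := zatoms x (@nil V) in
    let s := zatoms y s0 in
    let e1 := zreify x s in
    let e2 := zreify y s in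
    refine (@zmod_correct _ s e1 e2 _); vm_compute; reflexivity
  end.

(** * Linear maps and submodules *)

Section Linear.
Variables (k : fieldType) (U V : lmodType k) (f : U -> V) (hf : linear f).
Lemma linP0 : f 0 = 0.
Proof.
by have := hf (-1) 0 0; rewrite scaleN1r oppr0 addr0 scaleN1r addNr.
Qed.
Lemma linPD u v : f (u + v) = f u + f v.
Proof. by have := hf 1 u v; rewrite !scale1r. Qed.
Lemma linPZ c u : f (c *: u) = c *: f u.
Proof. by have := hf c u 0; rewrite linP0 !addr0. Qed.
Lemma linPN u : f (- u) = - f u.
Proof. by rewrite -scaleN1r linPZ scaleN1r. Qed.
Lemma linPB u v : f (u - v) = f u - f v.
Proof. by rewrite linPD linPN. Qed.
End Linear.

Section Bilinear.
Variables (k : fieldType) (U V W : lmodType k) (f : U -> V -> W) (hf : is_bilinear f).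
Lemma bl0l v : f 0 v = 0. Proof. exact: (linP0 (hf.2 v)). Qed.
Lemma bl0r u : f u 0 = 0. Proof. exact: (linP0 (hf.1 u)). Qed.
Lemma blDl u u' v : f (u + u') v = f u v + f u' v.
Proof. exact: (linPD (hf.2 v)). Qed.
Lemma blDr u v v' : f u (v + v') = f u v + f u v'.
Proof. exact: (linPD (hf.1 u)). Qed.
Lemma blNl u v : f (- u) v = - f u v. Proof. exact: (linPN (hf.2 v)). Qed.
Lemma blNr u v : f u (- v) = - f u v. Proof. exact: (linPN (hf.1 u)). Qed.
Lemma blBl u u' v : f (u - u') v = f u v - f u' v.
Proof. exact: (linPB (hf.2 v)). Qed.
Lemma blBr u v v' : f u (v - v') = f u v - f u v'.
Proof. exact: (linPB (hf.1 u)). Qed.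
Lemma blPl c u u' v : f (c *: u + u') v = c *: f u v + f u' v.
Proof. exact: (hf.2 v). Qed.
Lemma blPr c u v v' : f u (c *: v + v') = c *: f u v + f u v'.
Proof. exact: (hf.1 u). Qed.
End Bilinear.

Section Submod.
Variables (k : fieldType) (U : lmodType k).
Lemma submodD (S : submod U) u v : S u -> S v -> S (u + v).
Proof. by move=> Su Sv; rewrite -[u]scale1r; apply: submodP. Qed.
Lemma submodZ (S : submod U) c u : S u -> S (c *: u).
Proof. by move=> Su; rewrite -[_ *: _]addr0; apply: submodP => //; apply: submod0. Qed.
Lemma submodN (S : submod U) u : S u -> S (- u).
Proof. by rewrite -scaleN1r; apply: submodZ. Qed.
Lemma submodB (S : submod U) u v : S u -> S v -> S (u - v).
Proof. by move=> Su Sv; apply: submodD => //; apply: submodN. Qed.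

End Submod.

Section Hom.
Variables (k : fieldType) (U V : lmodType k).

(** A boolean predicate, so that [hom] inherits a module structure as a submodule of the function
    space; linear maps must themselves be vectors to serve as targets of the extension principle. *)
Definition is_linear_fun : {pred U -> V} := fun f => `[< linear f >].

Fact is_linear_fun_closed : submod_closed is_linear_fun.
Proof.
split=> [|c f h]; first by apply/asboolP => a u v; rewrite scaler0 addr0.
move=> /asboolP lf /asboolP lh; apply/asboolP => a u v.
change (c *: f (a *: u + v) + h (a *: u + v) =
  a *: (c *: f u + h u) + (c *: f v + h v)).
rewrite lf lh !scalerDr !scalerA mulrC -!addrA; congr (_ + _).
by rewrite addrCA.
Qed.

HB.instance Definition _ :=
  GRing.isSubmodClosed.Build k (U -> V : lmodType k) is_linear_fun is_linear_fun_closed.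

Record hom := Hom { hom_fun :> U -> V; hom_in : hom_fun \in is_linear_fun }.

HB.instance Definition _ := [isSub for hom_fun].
HB.instance Definition _ := [Choice of hom by <:].
HB.instance Definition _ := [SubChoice_isSubLmodule of hom by <:].

Lemma hom_lin (f : hom) : linear f.
Proof. exact/asboolP/(hom_in f). Qed.

Definition homL (f : U -> V) (lf : linear f) : hom := Hom (introT (asboolP _) lf).

Lemma homE (f h : hom) : (forall u, f u = h u) -> f = h.
Proof. by move=> fh; apply: val_inj; apply: funext. Qed.
Lemma hom0E u : (0 : hom) u = 0. Proof. by []. Qed.
Lemma homDE (f h : hom) u : (f + h) u = f u + h u. Proof. by []. Qed.
Lemma homNE (f : hom) u : (- f) u = - f u. Proof. by []. Qed.
Lemma homZE c (f : hom) u : (c *: f) u = c *: f u. Proof. by []. Qed.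
End Hom.

(** * Local Lie algebras and their modules *)

(* The local part V_-1 + V_0 + V_1 = lW + lg + lV, where [lF v w] is [v, w]. *)
Record locLie (k : fieldType) := LocLie {
  lg : lieData k;
  lV : lmodType k;
  lW : lmodType k;
  lr : lg -> lV -> lV;
  ls : lg -> lW -> lW;
  lF : lV -> lW -> lg;
  lg_lie : is_lie lg;
  lr_rep : is_rep lr;
  ls_rep : is_rep ls;
  lF_bil : is_bilinear lF;
  lF_eqv : forall a v w, ⁅a, lF v w⁆ = lF (lr a v) w + lF v (ls a w)
}.

(* [o0], [op] and [om] are the operators of V_0, V_1 and V_-1; nothing is asked
   of two operators of V_1, or of two operators of V_-1. *)
Record locmod (k : fieldType) (l : locLie k) := LocMod {
  lm_car :> lmodType k;
  o0 : lg l -> lm_car -> lm_car;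
  op : lV l -> lm_car -> lm_car;
  om : lW l -> lm_car -> lm_car;
  o0_bil : is_bilinear o0;
  op_bil : is_bilinear op;
  om_bil : is_bilinear om;
  o0_br : forall a b z, o0 ⁅a, b⁆ z = o0 a (o0 b z) - o0 b (o0 a z);
  o0_op : forall a x z, o0 a (op x z) = op (lr a x) z + op x (o0 a z);
  o0_om : forall a y z, o0 a (om y z) = om (ls a y) z + om y (o0 a z);
  om_op : forall x y z, om y (op x z) = op x (om y z) - o0 (lF x y) z
}.
Arguments o0 {k l} l0 : rename.
Arguments op {k l} l0 : rename.
Arguments om {k l} l0 : rename.
Arguments o0 {k l l0} a z : rename.
Arguments op {k l l0} x z : rename.
Arguments om {k l l0} y z : rename.

Section LieBracket.
Variables (k : fieldType) (g : lieData k) (hg : is_lie g).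
Lemma br_bil : is_bilinear (@lie_br k g). Proof. by case: hg. Qed.
Lemma brxx (a : g) : ⁅a, a⁆ = 0. Proof. by case: hg. Qed.
Lemma br_jac (a b c : g) : ⁅a, ⁅b, c⁆⁆ = ⁅⁅a, b⁆, c⁆ + ⁅b, ⁅a, c⁆⁆.
Proof. by case: hg. Qed.
Lemma brC (a b : g) : ⁅a, b⁆ = - ⁅b, a⁆.
Proof.
apply/eqP; rewrite -addr_eq0; apply/eqP.
have := brxx (a + b); rewrite (blDl br_bil) !(blDr br_bil) !brxx.
by rewrite add0r addr0.
Qed.
Lemma br_adj (a b c : g) : ⁅⁅a, b⁆, c⁆ = ⁅a, ⁅b, c⁆⁆ - ⁅b, ⁅a, c⁆⁆.
Proof. by rewrite br_jac addrK. Qed.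
End LieBracket.

Section OpLin.
Variables (k : fieldType) (l : locLie k) (M : locmod l).
Definition o0_lin a : linear (@o0 k l M a) := (o0_bil M).1 a.
Definition op_lin x : linear (@op k l M x) := (op_bil M).1 x.
Definition om_lin y : linear (@om k l M y) := (om_bil M).1 y.
Lemma op_om (x : lV l) (y : lW l) (z : M) :
  op x (om y z) = om y (op x z) + o0 (lF x y) z.
Proof. by rewrite om_op subrK. Qed.
Lemma op_o0 a x (z : M) : op x (o0 a z) = o0 a (op x z) - op (lr a x) z.
Proof. by rewrite o0_op addrC addKr. Qed.
Lemma om_o0 a x (z : M) : om x (o0 a z) = o0 a (om x z) - om (ls a x) z.
Proof. by rewrite o0_om addrC addKr. Qed.
End OpLin.

(* Exchanging V_1 and V_-1 transports statements on positive degrees to negative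
   degrees. *)
Section Flip.
Variables (k : fieldType) (l : locLie k).

(** The sign is that of [w, v] = - [v, w]. *)
Fact flip_bil : is_bilinear (fun (w : lW l) (v : lV l) => - lF v w).
Proof.
split=> [w c v v'|v c w w'].
  by rewrite (blPl (lF_bil l)) opprD scalerN.
by rewrite (blPr (lF_bil l)) opprD scalerN.
Qed.

Fact flip_eqv (a : lg l) (w : lW l) (v : lV l) :
  ⁅a, - lF v w⁆ = - lF v (ls a w) + - lF (lr a v) w.
Proof. by rewrite (blNr (br_bil (lg_lie l))) lF_eqv opprD addrC. Qed.

Definition flip : locLie k :=
  @LocLie k (lg l) (lW l) (lV l) (@ls k l) (@lr k l) _
    (lg_lie l) (ls_rep l) (lr_rep l) flip_bil flip_eqv.

Variable M : locmod l.

Fact flip_om_op (y : lW l) (x : lV l) (z : M) :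
  op x (om y z) = om y (op x z) - o0 (- lF x y) z.
Proof. by rewrite (blNl (o0_bil M)) opprK op_om. Qed.

Definition flip_mod : locmod flip :=
  @LocMod k flip M (@o0 k l M) (@om k l M) (@op k l M)
    (o0_bil M) (om_bil M) (op_bil M) (@o0_br k l M) (@o0_om k l M) (@o0_op k l M)
    flip_om_op.
End Flip.

(* The local operators act on linear maps by T |-> s T - T s. *)
Section HomMod.
Variables (k : fieldType) (l : locLie k) (M N : locmod l).
Implicit Types T : hom M N.

Fact comm_lin (f : M -> M) (h : N -> N) T : linear f -> linear h ->
  linear (fun z => h (T z) - T (f z)).
Proof.
move=> lf lh a u v.
by rewrite lf !(hom_lin T) lh scalerBr opprD !addrA; congr (_ + _); rewrite addrAC.
Qed.

Definition hom_o0 (a : lg l) T : hom M N := homL (comm_lin T (o0_lin (M:=M) a) (o0_lin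
  a)).
Definition hom_op (x : lV l) T : hom M N := homL (comm_lin T (op_lin (M:=M) x) (op_lin
  x)).
Definition hom_om (y : lW l) T : hom M N := homL (comm_lin T (om_lin (M:=M) y) (om_lin
  y)).

Fact comm_bil (A : lmodType k) (f : A -> M -> M) (h : A -> N -> N)
    (F : A -> hom M N -> hom M N) : is_bilinear f -> is_bilinear h ->
  (forall a T z, F a T z = h a (T z) - T (f a z)) -> is_bilinear F.
Proof.
move=> bf bh FE; split=> [a c T T'|T c a a']; apply: homE => z.
  rewrite FE !homDE !homZE !FE (blPr bh) scalerBr opprD !addrA.
  by congr (_ + _); rewrite addrAC.
rewrite homDE !homZE !FE (blPl bh) (blPl bf) (hom_lin T).
by rewrite scalerBr opprD !addrA; congr (_ + _); rewrite addrAC.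
Qed.

(** The mixed terms [h1 (T (f2 z))] and [h2 (T (f1 z))] occur on both sides and cancel. Thus a
    relation valid for operators on both modules passes to their commutators with [T]. *)
Fact comm_rel (f1 f2 f3 : M -> M) (h1 h2 h3 : N -> N) T z :
  (forall u, f1 (f2 u) = f3 u + f2 (f1 u)) ->
  (forall u, h1 (h2 u) = h3 u + h2 (h1 u)) -> linear h1 -> linear h2 ->
  (h1 (h2 (T z) - T (f2 z)) - (h2 (T (f1 z)) - T (f2 (f1 z)))) =
  (h3 (T z) - T (f3 z)) + (h2 (h1 (T z) - T (f1 z)) - (h1 (T (f2 z)) - T (f1 (f2 z)))).
Proof.
move=> ef eh l1 l2; rewrite (linPB l1) (linPB l2) ef eh (linPD (hom_lin T)).
by zmod.
Qed.

Fact hom_o0_br a b T :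
  hom_o0 ⁅a, b⁆ T = hom_o0 a (hom_o0 b T) - hom_o0 b (hom_o0 a T).
Proof.
apply: homE => z; rewrite homDE homNE /=.
by rewrite !o0_br !(linPB (hom_lin T)) !(linPB (@o0_lin _ _ _ _)); zmod.
Qed.
Fact hom_o0_op a x T :
  hom_o0 a (hom_op x T) = hom_op (lr a x) T + hom_op x (hom_o0 a T).
Proof.
apply: homE => z; rewrite homDE /=.
by apply: comm_rel; [apply: o0_op|apply: o0_op|apply: o0_lin|apply: op_lin].
Qed.
Fact hom_o0_om a y T :
  hom_o0 a (hom_om y T) = hom_om (ls a y) T + hom_om y (hom_o0 a T).
Proof.
apply: homE => z; rewrite homDE /=.
by apply: comm_rel; [apply: o0_om|apply: o0_om|apply: o0_lin|apply: om_lin].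
Qed.
Fact hom_om_op x y T :
  hom_om y (hom_op x T) = hom_op x (hom_om y T) - hom_o0 (lF x y) T.
Proof.
apply: homE => z; rewrite homDE homNE /=.
rewrite !om_op !(linPB (om_lin _)) !(linPB (op_lin _)) !om_op (linPB (hom_lin T)).
by zmod.
Qed.

Definition hom_mod : locmod l :=
  @LocMod k l (hom M N) hom_o0 hom_op hom_om
    (comm_bil (F := hom_o0) (o0_bil M) (o0_bil N) (fun _ _ _ => erefl))
    (comm_bil (F := hom_op) (op_bil M) (op_bil N) (fun _ _ _ => erefl))
    (comm_bil (F := hom_om) (om_bil M) (om_bil N) (fun _ _ _ => erefl))
    hom_o0_br hom_o0_op hom_o0_om hom_om_op.
End HomMod.

Section TrivialMod.
Variables (k : fieldType) (l : locLie k).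
Fact zero_bil (A B C : lmodType k) : is_bilinear (fun (_ : A) (_ : B) => 0 : C).
Proof. by split=> ? ? ? ?; rewrite scaler0 addr0. Qed.
(** With this target, [hom_mod] becomes the dual module with its contragredient operators. *)
Definition triv_mod : locmod l.
Proof.
by refine (@LocMod k l k^o (fun _ _ => 0) (fun _ _ => 0) (fun _ _ => 0)
  (zero_bil _ _ _) (zero_bil _ _ _) (zero_bil _ _ _) _ _ _ _) => *;
  rewrite ?subr0 ?addr0.
Defined.
End TrivialMod.

(** * Extension of local maps *)

(* [gen n] is spanned by the pairs (x_1 ... x_n iX(u), x_1 ... x_n iH(u)). *)
Section Generated.
Variables (k : fieldType) (l : locLie k) (X H : locmod l) (U : lmodType k).
Variables (pi : lg l -> U -> U) (iX : U -> X) (iH : U -> H).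

Inductive gen : nat -> X -> H -> Prop :=
| gen_base u : gen 0 (iX u) (iH u)
| gen_step n x z h : gen n z h -> gen n.+1 (op x z) (op x h)
| gen_lin n c z h z' h' :
    gen n z h -> gen n z' h' -> gen n (c *: z + z') (c *: h + h').

Hypotheses (iX_lin : linear iX) (iH_lin : linear iH).
Hypotheses (iX0 : forall u, iX u = 0 -> u = 0).
Hypotheses (iX_eqv : forall a u, o0 a (iX u) = iX (pi a u))
           (iH_eqv : forall a u, o0 a (iH u) = iH (pi a u)).
(* Both sides vanish when [U] is the lowest piece of a module; when [U] is V_1
   in a Lie algebra, [om y] sends it to V_0 and [op x] sends it back. *)
Hypothesis omU : forall x y u, exists u',
  op x (om y (iX u)) = iX u' /\ op x (om y (iH u)) = iH u'.

Lemma gen0 n : gen n 0 0.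
Proof.
elim: n => [|n IH]; last first.
  by have := gen_step 0 IH; rewrite !(linP0 (op_lin _)).
by have := gen_base 0; rewrite !linP0.
Qed.

Lemma genD n z h z' h' : gen n z h -> gen n z' h' -> gen n (z + z') (h + h').
Proof. by move=> G /(gen_lin 1 G); rewrite !scale1r. Qed.

Lemma genB n z h z' h' : gen n z h -> gen n z' h' -> gen n (z - z') (h - h').
Proof. by move=> G /gen_lin/(_ G) => /(_ (-1)); rewrite !scaleN1r ![- _ + _]addrC. Qed.

(** Because of [gen_lin], inverting a pair does not expose its last letter. For a property closed
    under combinations it is enough to look at pairs that do end in a base element or a step. *)
Lemma genP n (K : X -> H -> Prop) :
  (forall c z h z' h', K z h -> K z' h' -> K (c *: z + z') (c *: h + h')) ->
  (n = 0%N -> forall u, K (iX u) (iH u)) ->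
  (forall m, n = m.+1 -> forall x z h, gen m z h -> K (op x z) (op x h)) ->
  forall z h, gen n z h -> K z h.
Proof.
move=> KP K0 KS z h G; elim: G K0 KS => {n z h}.
- by move=> u K0 _; apply: K0.
- by move=> n x z h G _ _ KS; apply: KS.
- by move=> n c z h z' h' _ IH _ IH' K0 KS; apply: KP; auto.
Qed.

Lemma gen_o0 n a z h : gen n z h -> gen n (o0 a z) (o0 a h).
Proof.
move=> G; elim: G a => {n z h}.
- by move=> u a; rewrite iX_eqv iH_eqv; apply: gen_base.
- move=> n x z h G IH a; rewrite !o0_op; apply: genD; apply: gen_step => //.
- by move=> n c z h z' h' _ IH _ IH' a; rewrite !(o0_lin a); apply: gen_lin.
Qed.

Lemma gen0_ex z h : gen 0 z h -> exists u, z = iX u /\ h = iH u.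
Proof.
apply: (@genP 0 (fun z h => exists u, z = iX u /\ h = iH u)) => //.
  move=> c {}z {}h z' h' [u [-> ->]] [u' [-> ->]]; exists (c *: u + u').
  by rewrite iX_lin iH_lin.
by move=> _ u; exists u.
Qed.

(** An operator of V_-1 is commuted past the outermost letter [x]; the correction is an operator of
    V_0, under which the graph is stable. *)
Lemma gen_om n y z h : gen n.+1 z h -> gen n (om y z) (om y h).
Proof.
elim: n y z h => [|n IH] y z h;
  apply: (@genP _ (fun z h => gen _ (om y z) (om y h))) => //.
- by move=> c {}z {}h z' h' G G'; rewrite !(om_lin y); apply: gen_lin.
- move=> _ [<-] x {}z {}h G; rewrite !om_op.
  apply: genB; last exact: gen_o0.
  (* At index 0 the operator [om y] leaves the graph, and [omU] is what brings it back after
     [op x]. *)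
  have [u [-> ->]] := gen0_ex G; have [u' [-> ->]] := omU x y u.
  exact: gen_base.
- by move=> c {}z {}h z' h' G G'; rewrite !(om_lin y); apply: gen_lin.
- move=> _ [<-] x {}z {}h G; rewrite !om_op.
  by apply: genB; [apply/gen_step/IH|apply: gen_o0].
Qed.

Hypothesis gen_trans : forall n h, gen n.+1 0 h -> (forall y, om y h = 0) -> h = 0.

Lemma gen_fun0 n h : gen n 0 h -> h = 0.
Proof.
elim: n h => [|n IH] h G; last first.
  apply: gen_trans (G) _ => y; apply: IH.
  by rewrite -(linP0 (om_lin y)); apply: gen_om.
by have [u [/esym/iX0-> ->]] := gen0_ex G; rewrite linP0.
Qed.

Lemma gen_fun n z h h' : gen n z h -> gen n z h' -> h = h'.
Proof.
move=> G /(genB G); rewrite subrr => /gen_fun0 /eqP.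
by rewrite subr_eq0 => /eqP.
Qed.

End Generated.

(** * Graded modules and graded Lie algebras *)

(** The universal property of a direct sum. Each [phi n] is a total function but linear on [D n]
    only, as is the case for functions obtained by choice from a graph. *)
Definition gluable (k : fieldType) (X : lmodType k) (I : Type) (D : I -> submod X) :=
  forall (H : lmodType k) (phi : I -> X -> H),
    (forall n c z z', D n z -> D n z' -> phi n (c *: z + z') = c *: phi n z + phi n z') ->
  exists f : X -> H, linear f /\ forall n z, D n z -> f z = phi n z.

Definition spans (k : fieldType) (X : lmodType k) (I : Type) (D : I -> submod X) :=
  forall K : X -> Prop, is_submod K -> (forall n z, D n z -> K z) -> forall z, K z.

Record graded (k : fieldType) (X : lmodType k) (I : eqType) (D : I -> submod X) :=
  Graded {
  gr_glue : gluable D;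
  gr_ind : spans D;
  gr_proj : I -> X -> X;
  gr_lin : forall n, linear (gr_proj n);
  gr_in : forall n z, D n (gr_proj n z);
  gr_id : forall n z, D n z -> gr_proj n z = z;
  gr_0 : forall n m z, D m z -> m != n -> gr_proj n z = 0;
  gr_ext : forall z, (forall n, gr_proj n z = 0) -> z = 0
}.

(** An extension without its iterated function spaces: [g_tr] is what remains of being inside
    Hom(V_-1, -), and [g_gen] of being the image of r. The lowest piece is a copy of [gU]. *)
Record gradedMod (k : fieldType) (l : locLie k) := GradedMod {
  gm :> locmod l;
  gU : lmodType k;
  gpi : lg l -> gU -> gU;
  gi : gU -> gm;
  gD : nat -> submod gm;
  gi_lin : linear gi;
  gi_inj : forall u, gi u = 0 -> u = 0;
  gi_eqv : forall a u, o0 a (gi u) = gi (gpi a u);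
  gi_om : forall y u, om y (gi u) = 0;
  gD_gi : forall u, gD 0 (gi u);
  gD0 : forall z, gD 0 z -> exists u, z = gi u;
  gD_o0 : forall n a z, gD n z -> gD n (o0 a z);
  gD_op : forall n x z, gD n z -> gD n.+1 (op x z);
  gD_om : forall n y z, gD n.+1 z -> gD n (om y z);
  g_tr : forall n z, gD n.+1 z -> (forall y, om y z = 0) -> z = 0;
  g_gen : forall n (K : gm -> Prop), is_submod K ->
    (forall x z, gD n z -> K (op x z)) -> forall z, gD n.+1 z -> K z;
  g_gr : graded gD
}.

Definition g_glue (k : fieldType) (l : locLie k) (E : gradedMod l) := gr_glue (g_gr E).
Definition g_ind (k : fieldType) (l : locLie k) (g : gradedMod l) := gr_ind (g_gr g).
Definition g_proj (k : fieldType) (l : locLie k) (g : gradedMod l) := gr_proj (g_gr g).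

Arguments gi_lin {k l} g : rename.
Arguments gD_gi {k l} g u : rename.
Arguments gD {k l g} n : rename.

Arguments g_proj {k l} g n z : rename.

(** * Extending an equivariant map from the lowest piece of a graded module *)

Section ModRec.
Variables (k : fieldType) (l : locLie k) (E : gradedMod l) (H : locmod l).
Variables (j : gU E -> H).
Hypothesis j_lin : linear j.
Hypothesis j_eqv : forall a u, o0 a (j u) = j (gpi a u).
Hypothesis j_om : forall y u, om y (j u) = 0.
Let G := gen (@gi k l E) j.
Hypothesis j_tr : forall n h, G n.+1 0 h -> (forall y, om y h = 0) -> h = 0.

Let hook x y u : exists u',
  op x (om y (gi u)) = gi u' :> E /\ op x (om y (j u)) = j u'.
Proof.
by exists 0; rewrite gi_om j_om !(linP0 (op_lin _)) (linP0 j_lin) (linP0 (gi_lin E)).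
Qed.

Lemma mod_gen_fun n z h h' : G n z h -> G n z h' -> h = h'.
Proof.
by apply: (gen_fun (gi_lin E) j_lin (@gi_inj _ _ E) (@gi_eqv _ _ E) j_eqv hook j_tr).
Qed.

Lemma mod_gen_ex n z : gD n z -> exists h, G n z h.
Proof.
elim: n z => [|n IH] z; first by move=> /gD0[u ->]; exists (j u); apply: gen_base.
apply: (g_gen (K := fun z => exists h, G n.+1 z h)) => [|x {}z /IH[h Gh]].
  split=> [|c u v [h Gh] [h' Gh']]; last by exists (c *: h + h'); apply: gen_lin.
  by exists 0; apply: gen0 => //; apply: gi_lin.
by exists (op x h); apply: gen_step.
Qed.

Lemma mod_rec : exists f : hom E H,
  [/\ forall u, f (gi u) = j u, forall a z, f (o0 a z) = o0 a (f z),
      forall x z, f (op x z) = op x (f z), forall y z, f (om y z) = om y (f z) &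
      forall n z, gD n z -> G n z (f z)].
Proof.
(* The default 0 is never met on [gD n]. Single-valuedness of the graph makes the choice linear in
   each degree, and the pieces are then glued. *)
pose phi n z := xget 0 [set h | G n z h]%classic.
have phiP n z : gD n z -> G n z (phi n z).
  by move=> /mod_gen_ex[h Gh]; apply: (xgetI (P := [set h | G n z h]%classic) 0 Gh).
have [|f [lf ff]] := @g_glue _ _ E _ phi.
  move=> n c z z' Dz Dz'; apply: (@mod_gen_fun n (c *: z + z')).
    by apply/phiP/submodP.
  by apply: gen_lin; apply: phiP.
have fP n z : gD n z -> G n z (f z) by move=> Dz; rewrite (ff n) //; apply: phiP.
exists (homL lf); split=> //=.
- by move=> u; apply: mod_gen_fun (fP _ _ (gD_gi E u)) _; apply: gen_base.
- move=> a; apply: (g_ind (g := E) (K := fun z => f (o0 a z) = o0 a (f z))).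
    split=> [|c u v Ku Kv]; first by rewrite !(linP0 (o0_lin _), linP0 lf).
    by rewrite !(o0_lin _, lf) Ku Kv.
  move=> n z Dz; apply: mod_gen_fun (fP _ _ (gD_o0 a Dz)) _.
  apply: (gen_o0 (@gi_eqv _ _ E) j_eqv); exact: fP.
- move=> x; apply: (g_ind (g := E) (K := fun z => f (op x z) = op x (f z))).
    split=> [|c u v Ku Kv]; first by rewrite !(linP0 (op_lin _), linP0 lf).
    by rewrite !(op_lin _, lf) Ku Kv.
  move=> n z Dz; apply: mod_gen_fun (fP _ _ (gD_op x Dz)) _.
  apply: gen_step; exact: fP.
- move=> y; apply: (g_ind (g := E) (K := fun z => f (om y z) = om y (f z))).
    split=> [|c u v Ku Kv]; first by rewrite !(linP0 (om_lin _), linP0 lf).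
    by rewrite !(om_lin _, lf) Ku Kv.
  (* [gen_om] starts at index 1; on the lowest piece both sides vanish. *)
  case=> [|n] z Dz.
    have [u ->] := gD0 Dz; rewrite gi_om (linP0 lf).
    suff -> : f (gi u) = j u by rewrite j_om.
    by apply: mod_gen_fun (fP _ _ (gD_gi E u)) _; apply: gen_base.
  apply: mod_gen_fun (fP _ _ (gD_om y Dz)) _.
  apply: (gen_om (gi_lin E) j_lin (@gi_eqv _ _ E) j_eqv hook); exact: fP.
Qed.

End ModRec.

(* Transitivity is only required from degree 2 on: an element of V_1 may well
   commute with V_-1. *)
Record gradedLie (k : fieldType) (l : locLie k) := GradedLie {
  gl :> locmod l;
  e0 : lg l -> gl;
  ep : lV l -> gl;
  em : lW l -> gl;
  lD : int -> submod gl;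
  e0_lin : linear e0;
  ep_lin : linear ep;
  em_lin : linear em;
  e0_inj : forall a, e0 a = 0 -> a = 0;
  ep_inj : forall x, ep x = 0 -> x = 0;
  em_inj : forall y, em y = 0 -> y = 0;
  lD_e0 : forall a, lD 0 (e0 a);
  lD_ep : forall x, lD 1 (ep x);
  lD_em : forall y, lD (-1) (em y);
  lD0 : forall z, lD 0 z -> exists a, z = e0 a;
  lD1 : forall z, lD 1 z -> exists x, z = ep x;
  lDm1 : forall z, lD (-1) z -> exists y, z = em y;
  lD_o0 : forall n a z, lD n z -> lD n (o0 a z);
  lD_op : forall n x z, lD n z -> lD (n + 1) (op x z);
  lD_om : forall n y z, lD n z -> lD (n - 1) (om y z);
  o0_e0 : forall a b, o0 a (e0 b) = e0 ⁅a, b⁆;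
  o0_ep : forall a x, o0 a (ep x) = ep (lr a x);
  o0_em : forall a y, o0 a (em y) = em (ls a y);
  op_e0 : forall x a, op x (e0 a) = - ep (lr a x);
  om_e0 : forall y a, om y (e0 a) = - em (ls a y);
  op_em : forall x y, op x (em y) = e0 (lF x y);
  om_ep : forall y x, om y (ep x) = - e0 (lF x y);
  l_trp : forall (n : nat) z, lD n.+2 z -> (forall y, om y z = 0) -> z = 0;
  l_trm : forall (n : nat) z, lD (- n.+2%:Z) z -> (forall x, op x z = 0) -> z = 0;
  l_genp : forall (n : nat) (K : gl -> Prop), is_submod K ->
    (forall x z, lD n.+1 z -> K (op x z)) -> forall z, lD n.+2 z -> K z;
  l_genm : forall (n : nat) (K : gl -> Prop), is_submod K ->
    (forall y z, lD (- n.+1%:Z) z -> K (om y z)) ->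
    forall z, lD (- n.+2%:Z) z -> K z;
  l_gr : graded lD
}.

Definition l_glue (k : fieldType) (l : locLie k) (g : gradedLie l) := gr_glue (l_gr g).
Definition l_ind (k : fieldType) (l : locLie k) (g : gradedLie l) := gr_ind (l_gr g).
Definition l_proj (k : fieldType) (l : locLie k) (g : gradedLie l) := gr_proj (l_gr g).

Arguments e0_lin {k l} g : rename.
Arguments ep_lin {k l} g : rename.
Arguments em_lin {k l} g : rename.
Arguments lD {k l g} n : rename.
Arguments lD_e0 {k l} g a : rename.
Arguments lD_ep {k l} g x : rename.
Arguments lD_em {k l} g y : rename.
Arguments e0 {k l g} a : rename.
Arguments ep {k l g} x : rename.
Arguments em {k l g} y : rename.

Arguments l_proj {k l} g n z : rename.
Arguments gr_ext {k X I D} g z : rename.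

Section FlipLie.
Variables (k : fieldType) (l : locLie k) (X : gradedLie l).

Definition flipD (n : int) : submod X := lD (g := X) (- n).

Definition flip_graded : graded flipD.
Proof.
refine (@Graded _ _ _ flipD _ _ (fun n => l_proj X (- n)) _ _ _ _ _).
- move=> H phi phiP; have [|f [lf ff]] := @l_glue _ _ X H (fun n => phi (- n)).
    by move=> n c z z' Dz Dz'; apply: phiP; rewrite /flipD opprK.
  by exists f; split=> // n z Dz; rewrite (ff (- n)) // opprK.
- move=> K Ks KD; apply: (l_ind (g := X) Ks) => n z Dz.
  by apply: (KD (- n)); rewrite /flipD opprK.
- by move=> n; apply: gr_lin.
- by move=> n z; apply: (gr_in (l_gr X)).
- by move=> n z Dz; apply: (gr_id (l_gr X) Dz).
- by move=> n m z Dz nm; apply: (gr_0 (l_gr X) Dz); rewrite eqr_opp.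
- by move=> z H; apply: (gr_ext (l_gr X)) => n; rewrite -[n]opprK; apply: H.
Defined.

(** Transparent, since results about it are read back on [X] by conversion, with degree n turned
    into -n. *)
Definition flip_Lie : gradedLie (flip l).
Proof.
refine (@GradedLie k (flip l) (flip_mod X) (@e0 _ _ X) (@em _ _ X) (@ep _ _ X) flipD
  (e0_lin X) (em_lin X) (ep_lin X) (@e0_inj _ _ X) (@em_inj _ _ X) (@ep_inj _ _ X)
  (@lD_e0 _ _ X) (@lD_em _ _ X) _ (@lD0 _ _ X) (@lDm1 _ _ X) _ _ _ _
  (@o0_e0 _ _ X) (@o0_em _ _ X) (@o0_ep _ _ X) (@om_e0 _ _ X) (@op_e0 _ _ X)
  _ _ (@l_trm _ _ X) _ (@l_genm _ _ X) _ flip_graded).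
- by move=> x; rewrite /flipD opprK; apply: lD_ep.
- by move=> z; rewrite /flipD opprK; apply: lD1.
- by move=> n a z; apply: lD_o0.
- by move=> n y z; rewrite /flipD opprD; apply: lD_om.
- by move=> n x z; rewrite /flipD opprD opprK; apply: lD_op.
- by move=> y x /=; rewrite om_ep (linPN (e0_lin X)).
- by move=> x y /=; rewrite op_em (linPN (e0_lin X)) opprK.
- by move=> n z; rewrite /flipD opprK; apply: l_trp.
- by move=> n K Ks; rewrite /flipD !opprK; apply: l_genp.
Defined.
End FlipLie.

(** * Extending a map from the local part of a graded Lie algebra *)

Section LieRec.
Variables (k : fieldType) (l : locLie k) (X : gradedLie l) (H : locmod l).
Variables (j0 : lg l -> H) (jp : lV l -> H) (jm : lW l -> H).
Hypotheses (j0_lin : linear j0) (jp_lin : linear jp) (jm_lin : linear jm).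
Hypotheses
  (o0_j0 : forall a b, o0 a (j0 b) = j0 ⁅a, b⁆)
  (o0_jp : forall a x, o0 a (jp x) = jp (lr a x))
  (o0_jm : forall a y, o0 a (jm y) = jm (ls a y))
  (op_j0 : forall x a, op x (j0 a) = - jp (lr a x))
  (om_j0 : forall y a, om y (j0 a) = - jm (ls a y))
  (op_jm : forall x y, op x (jm y) = j0 (lF x y))
  (om_jp : forall y x, om y (jp x) = - j0 (lF x y)).

(** Words start in V_1, so index [n] corresponds to degree n + 1; likewise [genm n] belongs to
    degree -(n + 1). *)
Definition genp : nat -> X -> H -> Prop := gen (@ep _ _ X) jp.
Definition genm : nat -> X -> H -> Prop :=
  @gen k (flip l) (flip_mod X) (flip_mod H) _ (@em _ _ X) jm.

Hypothesis jp_tr : forall n h, genp n.+1 0 h -> (forall y, om y h = 0) -> h = 0.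
Hypothesis jm_tr : forall n h, genm n.+1 0 h -> (forall x, op x h = 0) -> h = 0.

Let hookp x y u : exists u',
  op x (om y (ep u)) = ep u' :> X /\ op x (om y (jp u)) = jp u'.
Proof.
(* As [y, u] = - [u, y] lies in V_0, the element [x, [y, u]] equals [[u, y], x]. *)
exists (lr (lF u y) x).
by rewrite om_ep om_jp !(linPN (op_lin _)) op_e0 op_j0 !opprK.
Qed.

Let hookm (y : lV (flip l)) (x : lW (flip l)) u : exists u',
  op y (om x (em u : flip_mod X)) = em u' :> X /\
  op y (om x (jm u : flip_mod H)) = jm u' :> H.
Proof.
exists (- ls (lF x u) y) => /=.
rewrite op_em op_jm om_e0 om_j0.
by rewrite (linPN (em_lin X)) (linPN jm_lin).
Qed.

Lemma genp_fun n z h h' : genp n z h -> genp n z h' -> h = h'.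
Proof.
by apply: (gen_fun (ep_lin X) jp_lin (@ep_inj _ _ X) (@o0_ep _ _ X) o0_jp hookp jp_tr).
Qed.

Lemma genm_fun n z h h' : genm n z h -> genm n z h' -> h = h'.
Proof.
by apply: (@gen_fun k (flip l) (flip_mod X) (flip_mod H) _ _ _ _ (em_lin X) jm_lin
  (@em_inj _ _ X) (@o0_em _ _ X) o0_jm hookm jm_tr).
Qed.

(* The graph of the extension in degree [n]. *)
Definition genz (n : int) (z : X) (h : H) : Prop :=
  match n with
  | Posz 0 => exists a, z = e0 a /\ h = j0 a
  | Posz n.+1 => genp n z h
  | Negz n => genm n z h
  end.

Lemma genz_fun n z h h' : genz n z h -> genz n z h' -> h = h'.
Proof.
case: n => [[|n]|n] /=; [|exact: genp_fun|exact: genm_fun].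
case=> a [-> ->] [a' [/eqP e ->]]; congr j0; apply/eqP; rewrite -subr_eq0.
by apply/eqP/(@e0_inj _ _ X); rewrite (linPB (e0_lin X)); apply/eqP; rewrite subr_eq0.
Qed.

Lemma genz_lin n c z h z' h' :
  genz n z h -> genz n z' h' -> genz n (c *: z + z') (c *: h + h').
Proof.
case: n => [[|n]|n] /=; [|exact: gen_lin|exact: gen_lin].
case=> a [-> ->] [a' [-> ->]]; exists (c *: a + a').
by rewrite (e0_lin X) j0_lin.
Qed.

Lemma genz_ex n z : lD n z -> exists h, genz n z h.
Proof.
case: n => [[|n]|n] /=.
- by move=> /lD0[a ->]; exists (j0 a), a.
- elim: n z => [|n IH] z; first by move=> /lD1[x ->]; exists (jp x); apply: gen_base.
  apply: (l_genp (K := fun z => exists h, genp n.+1 z h)) => [|x {}z /IH[h Gh]].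
    split=> [|c u v [h Gh] [h' Gh']]; last by exists (c *: h + h'); apply: gen_lin.
    by exists 0; apply: gen0 => //; apply: ep_lin.
  by exists (op x h); apply: gen_step.
- rewrite NegzE; elim: n z => [|n IH] z.
    by move=> /lDm1[x ->]; exists (jm x); apply: gen_base.
  apply: (l_genm (K := fun z => exists h, genm n.+1 z h)) => [|x {}z /IH[h Gh]].
    split=> [|c u v [h Gh] [h' Gh']]; last by exists (c *: h + h'); apply: gen_lin.
    by exists 0; apply: (@gen0 _ (flip l)) => //; apply: em_lin.
  by exists (om x h); apply: (@gen_step _ (flip l) (flip_mod X) (flip_mod H)).
Qed.

Lemma genz_o0 n a z h : genz n z h -> genz n (o0 a z) (o0 a h).
Proof.
case: n => [[|n]|n] /=.
- by case=> b [-> ->]; exists ⁅a, b⁆; rewrite o0_e0 o0_j0.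
- exact: (gen_o0 (@o0_ep _ _ X) o0_jp).
- exact: (@gen_o0 _ (flip l) (flip_mod X) (flip_mod H) _ _ _ _ (@o0_em _ _ X) o0_jm).
Qed.

Lemma genz_op n x z h : genz n z h -> genz (n + 1) (op x z) (op x h).
Proof.
case: n => [[|n]|[|n]].
- case=> b [-> ->]; rewrite op_e0 op_j0 -(linPN (ep_lin X)) -(linPN jp_lin).
  exact: gen_base.
- by rewrite -PoszD addn1 => G; apply: gen_step.
- move=> G; have [y [-> ->]] :=
    @gen0_ex _ (flip l) (flip_mod X) (flip_mod H) _ _ _ (em_lin X) jm_lin _ _ G.
  exists (lF x y).
  by rewrite op_em op_jm.
- move=> G; have -> : Negz n.+1 + 1 = Negz n.
    by rewrite !NegzE -[n.+2]addn1 PoszD opprD subrK.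
  exact: (@gen_om _ (flip l) (flip_mod X) (flip_mod H) _ _ _ _ (em_lin X) jm_lin (@o0_em
    _ _ X) o0_jm hookm).
Qed.

Lemma genz_om n x z h : genz n z h -> genz (n - 1) (om x z) (om x h).
Proof.
case: n => [[|[|n]]|n].
- case=> b [-> ->]; rewrite om_e0 om_j0 -(linPN (em_lin X)) -(linPN jm_lin).
  exact: gen_base.
- move=> G; have [y [-> ->]] := gen0_ex (ep_lin X) jp_lin G; exists (- lF y x).
  by rewrite om_ep om_jp (linPN (e0_lin X)) (linPN j0_lin).
- move=> G; have -> : Posz n.+2 - 1 = Posz n.+1 by rewrite -[n.+2]addn1 PoszD addrK.
  exact: (gen_om (ep_lin X) jp_lin (@o0_ep _ _ X) o0_jp hookp).
- move=> G; have -> : Negz n - 1 = Negz n.+1.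
    by rewrite !NegzE -opprD -PoszD addn1.
  by apply: (@gen_step _ (flip l) (flip_mod X) (flip_mod H)).
Qed.

(** Single-valuedness of [genz] in every degree yields the map, and its stability under the local
    operators yields equivariance. The clause on [genz] is kept in the conclusion because later
    degree estimates on [f z] are inductions over words. *)
Lemma lie_rec : exists f : hom X H,
  [/\ forall a, f (e0 a) = j0 a, forall x, f (ep x) = jp x &
      forall y, f (em y) = jm y] /\
  [/\ forall a z, f (o0 a z) = o0 a (f z),
      forall x z, f (op x z) = op x (f z), forall y z, f (om y z) = om y (f z) &
      forall n z, lD n z -> genz n z (f z)].
Proof.
pose phi n z := xget 0 [set h | genz n z h]%classic.
have phiP n z : lD n z -> genz n z (phi n z).
  by move=> /genz_ex[h Gh]; apply: (xgetI (P := [set h | genz n z h]%classic) 0 Gh).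
have [|f [lf ff]] := @l_glue _ _ X _ phi.
  move=> n c z z' Dz Dz'; apply: (@genz_fun n (c *: z + z')).
    by apply/phiP/submodP.
  by apply: genz_lin; apply: phiP.
have fP n z : lD n z -> genz n z (f z) by move=> Dz; rewrite (ff n) //; apply: phiP.
exists (homL lf); split; split=> //=.
- by move=> a; apply: (genz_fun (n := 0) (fP _ _ (lD_e0 X a))); exists a.
- by move=> x; apply: (genz_fun (n := 1) (fP 1 _ (lD_ep X x))); apply: gen_base.
- by move=> y; apply: (genz_fun (n := -1) (fP (-1) _ (lD_em X y))); apply: (@gen_base _
    (flip l)).
- move=> a; apply: (l_ind (g := X) (K := fun z => f (o0 a z) = o0 a (f z))).
    split=> [|c u v Ku Kv]; first by rewrite !(linP0 (o0_lin _), linP0 lf).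
    by rewrite !(o0_lin _, lf) Ku Kv.
  by move=> n z Dz; apply: genz_fun (fP _ _ (lD_o0 a Dz)) _; apply/genz_o0/fP.
- move=> x; apply: (l_ind (g := X) (K := fun z => f (op x z) = op x (f z))).
    split=> [|c u v Ku Kv]; first by rewrite !(linP0 (op_lin _), linP0 lf).
    by rewrite !(op_lin _, lf) Ku Kv.
  by move=> n z Dz; apply: genz_fun (fP _ _ (lD_op x Dz)) _; apply/genz_op/fP.
- move=> y; apply: (l_ind (g := X) (K := fun z => f (om y z) = om y (f z))).
    split=> [|c u v Ku Kv]; first by rewrite !(linP0 (om_lin _), linP0 lf).
    by rewrite !(om_lin _, lf) Ku Kv.
  by move=> n z Dz; apply: genz_fun (fP _ _ (lD_om y Dz)) _; apply/genz_om/fP.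
Qed.

End LieRec.

Section Induction.
Variables (k : fieldType) (l : locLie k).

Lemma loc_ind (X : gradedLie l) (K : X -> Prop) : is_submod K ->
  (forall a, K (e0 a)) -> (forall x, K (ep x)) -> (forall y, K (em y)) ->
  (forall x z, K z -> K (op x z)) -> (forall y z, K z -> K (om y z)) ->
  forall z, K z.
Proof.
move=> Ks Ke0 Kep Kem Kop Kom; apply: (l_ind (g := X) Ks) => -[[|n]|n] z.
- by move=> /lD0[a ->].
- elim: n z => [|n IH] z; first by move=> /lD1[x ->].
  by apply: (l_genp Ks) => x {}z /IH; apply: Kop.
- rewrite NegzE; elim: n z => [|n IH] z; first by move=> /lDm1[x ->].
  by apply: (l_genm Ks) => x {}z /IH; apply: Kom.
Qed.

Lemma mod_ind (E : gradedMod l) (K : E -> Prop) : is_submod K ->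
  (forall u, K (gi u)) -> (forall x z, K z -> K (op x z)) -> forall z, K z.
Proof.
move=> Ks Ki Kop; apply: (g_ind (g := E) Ks); elim=> [|n IH] z.
  by move=> /gD0[u ->].
by apply: (g_gen Ks) => x {}z /IH; apply: Kop.
Qed.
End Induction.

(** * The Lie bracket *)

Section AdPos.
Variables (k : fieldType) (l : locLie k) (X : gradedLie l).

Definition ad0 (a : lg l) : hom_mod X X := homL (o0_lin (M := X) a).
Definition adp (x : lV l) : hom_mod X X := homL (op_lin (M := X) x).
Definition adm (y : lW l) : hom_mod X X := homL (om_lin (M := X) y).

Lemma adp_lin : linear adp.
Proof. by move=> c x x'; apply: homE => z; rewrite homDE homZE /= (blPl (op_bil X)). Qed.
Lemma adp_eqv a x : o0 a (adp x) = adp (lr a x).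
Proof. by apply: homE => z /=; rewrite o0_op addrK. Qed.
Lemma om_adp y x : om y (adp x) = - ad0 (lF x y).
Proof. by apply: homE => z; rewrite homNE /= om_op addrC addKr. Qed.
Lemma op_ad0 x a : op x (ad0 a) = - adp (lr a x).
Proof. by apply: homE => z; rewrite homNE /= op_o0 addrC addKr. Qed.

Lemma adp_hook x y u : exists u',
  op x (om y (ep u)) = ep u' :> X /\ op x (om y (adp u)) = adp u'.
Proof.
exists (lr (lF u y) x).
by rewrite om_ep om_adp !(linPN (op_lin _)) op_e0 op_ad0 !opprK.
Qed.

Local Notation G := (@genp k l X (hom_mod X X) adp).

Lemma adp_om n y z T : G n.+1 z T -> G n (om y z) (om y T).
Proof.
exact: (gen_om (ep_lin X) adp_lin (@o0_ep _ _ X) adp_eqv adp_hook).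
Qed.

Lemma adp_deg n z T m w : G n z T -> lD m w -> lD (m + n.+1%:Z) (T w).
Proof.
move=> GT; elim: GT m w => {n z T}.
- by move=> x m w; apply: lD_op.
- move=> n x z T _ IH m w Dw.
  rewrite -addn1 PoszD addrA; apply: submodB; first by apply/lD_op/IH.
  by rewrite addrAC; apply: IH; apply: lD_op.
- by move=> n c z T z' T' _ IH _ IH' m w Dw; rewrite homDE homZE; apply: submodP; auto.
Qed.

Lemma adp_degz n z T : G n z T -> lD n.+1 z.
Proof.
elim=> {n z T}.
- by move=> x; apply: lD_ep.
- by move=> n x z T _ IH; rewrite -addn1 PoszD; apply: lD_op.
- by move=> n c z T z' T' _ IH _ IH'; apply: submodP.
Qed.

(* [T] must act on V_-1 and V_0 as the bracket with [z] does, so that it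
   vanishes there when [z = 0]; this starts the induction in [adp_tr]. *)
Lemma adp_loc n z T : G n z T ->
  (forall y, T (em y) = - om y z) /\ (forall a, T (e0 a) = - o0 a z).
Proof.
elim: n z T => [|n IH] z T;
  apply: (@genP _ _ _ _ _ _ _ _ (fun z (T : hom_mod X X) =>
    (forall y, T (em y) = - om y z) /\ (forall a, T (e0 a) = - o0 a z))) => //.
- move=> c {}z {}T z' T' [K1 K2] [K1' K2']; split=> u; rewrite homDE homZE.
    by rewrite K1 K1' (om_lin u) opprD scalerN.
  by rewrite K2 K2' (o0_lin u) opprD scalerN.
- by move=> _ x; split=> u /=; rewrite ?op_em ?om_ep ?opprK // op_e0 o0_ep.
- move=> c {}z {}T z' T' [K1 K2] [K1' K2']; split=> u; rewrite homDE homZE.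
    by rewrite K1 K1' (om_lin u) opprD scalerN.
  by rewrite K2 K2' (o0_lin u) opprD scalerN.
- move=> _ [<-] x {}z {}T GT; have [K1 K0] := IH _ _ GT.
  have C1 y : (op x T : hom_mod X X) (em y) = - om y (op x z).
    by rewrite /= op_em K1 K0 (linPN (op_lin x)) om_op opprB opprK addrC.
  have GT' := gen_step x GT.
  (* Expanding [op x T] at [e0 a] would require [T] on V_1, which is unknown. Instead, the
     difference has degree at least 2, and V_-1 kills it by the induction hypothesis for
     [om y (op x T)]. *)
  split=> // a; apply/eqP; rewrite -addr_eq0; apply/eqP.
  have Dz : lD n.+2 (op x z) by apply: adp_degz GT'.
  have DT : lD n.+2 ((op x T : hom_mod X X) (e0 a)).
    by rewrite -[n.+2%:Z]add0r; apply: adp_deg GT' _; apply: lD_e0.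
  apply: l_trp (submodD DT (lD_o0 a Dz)) _ => y.
  have [_ /(_ a) e] := IH _ _ (adp_om y GT').
  have {}e : om y ((op x T : hom_mod X X) (e0 a)) =
      - o0 a (om y (op x z)) + (op x T : hom_mod X X) (om y (e0 a)).
    by rewrite -e subrK.
  rewrite (linPD (om_lin y)) e om_e0 (linPN (hom_lin _)) C1 (om_o0 a); zmod.
Qed.

(** [T] commutes with V_-1, vanishes on it, and raises degrees by n + 2. On non-negative degrees its
    values lie in degree at least 2, so transitivity propagates the vanishing upwards. On negative
    degrees generation by V_-1 propagates it downwards. *)
Lemma adp_tr n T : G n.+1 0 T -> (forall y, om y T = 0) -> T = 0.
Proof.
move=> GT omT; have [T1 _] := adp_loc GT.
have comT y w : om y (T w) = T (om y w).
  apply/eqP; rewrite -subr_eq0; apply/eqP.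
  exact: (congr1 (fun h : hom_mod X X => h w) (omT y)).
have Tm y : T (em y) = 0 by rewrite T1 (linP0 (om_lin _)) oppr0.
have is_submod_T : is_submod (fun w => T w = 0).
  split=> [|c u v eu ev]; first exact: (linP0 (hom_lin T)).
  by rewrite (hom_lin T) eu ev scaler0 addr0.
have Tpos m w : lD (Posz m) w -> T w = 0.
  elim: m w => [|m IH] w Dw.
    have DT : lD n.+2 (T w) by rewrite -[n.+2%:Z]add0r; apply: adp_deg GT _.
    apply: l_trp DT _ => y; rewrite comT.
    by have [a ->] := lD0 Dw; rewrite om_e0 (linPN (hom_lin T)) Tm oppr0.
  have DT : lD (m.+1 + n).+2 (T w).
    by rewrite -!addnS PoszD; apply: adp_deg GT _.
  apply: l_trp DT _ => y; rewrite comT; apply: IH.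
  by have := lD_om y Dw; rewrite -addn1 PoszD addrK.
apply: homE => w; rewrite hom0E; apply: (l_ind (g := X) is_submod_T) w.
case=> m; first exact: Tpos.
rewrite NegzE; elim: m => [|m IH] w; first by move=> /lDm1[y ->].
apply: (l_genm is_submod_T) w => y w /IH Tw.
by rewrite -comT Tw (linP0 (om_lin _)).
Qed.
End AdPos.

(** Applied with identity maps: exchanging V_1 and V_-1 before or after forming a space of linear
    maps gives the same pairs, but over different module structures. *)
Lemma gen_map (k : fieldType) (l l' : locLie k) (X H : locmod l) (X' H' : locmod l')
    (U : lmodType k) (iX : U -> X) (iH : U -> H) (iX' : U -> X') (iH' : U -> H')
    (t : lV l -> lV l') (fX : X -> X') (fH : H -> H') :
  linear fX -> linear fH ->
  (forall u, fX (iX u) = iX' u) -> (forall u, fH (iH u) = iH' u) ->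
  (forall x z, fX (op x z) = op (t x) (fX z)) ->
  (forall x z, fH (op x z) = op (t x) (fH z)) ->
  forall n z h, gen iX iH n z h -> gen iX' iH' n (fX z) (fH h).
Proof.
move=> lX lH EX EH OX OH n z h; elim=> {n z h}.
- by move=> u; rewrite EX EH; apply: gen_base.
- by move=> n x z h _ IH; rewrite OX OH; apply: gen_step.
- by move=> n c z h z' h' _ IH _ IH'; rewrite lX lH; apply: gen_lin.
Qed.

Section SkewPos.
Variables (k : fieldType) (l : locLie k) (X : gradedLie l) (ad : X -> X -> X).
Hypothesis bil : is_bilinear ad.
Hypotheses
  (ad_e0 : forall a z, ad (e0 a) z = o0 a z)
  (Dp : forall x z w, op x (ad z w) = ad (op x z) w + ad z (op x w))
  (Dm : forall y z w, om y (ad z w) = ad (om y z) w + ad z (om y w))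
  (adD : forall n m z w, lD n z -> lD m w -> lD (n + m) (ad z w)).
Hypotheses (adp : forall x z, ad (ep x) z = op x z).

(** [ad] is built by recursion on its left argument, so its values on a local right argument have to
    be recovered. For V_0 and V_-1 the derivation rule and generation by V_1 suffice; V_1 goes
    through transitivity. *)
Lemma skew_pos n w : lD n.+1 w ->
  [/\ forall a, ad w (e0 a) = - o0 a w, forall x, ad w (ep x) = - op x w &
      forall y, ad w (em y) = - om y w].
Proof.
(* The derivation rule would lead to arguments in V_2. The sum [ad z (ep x) + op x z] has degree at
   least 2, hence can be tested against V_-1 alone. *)
have via_tr m z : lD m.+1 z -> (forall a, ad z (e0 a) = - o0 a z) ->
    (forall y x, ad (om y z) (ep x) = - op x (om y z)) ->
    forall x, ad z (ep x) = - op x z.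
  move=> Dz E0 IH x; apply/eqP; rewrite -addr_eq0; apply/eqP.
  have D1 : lD m.+2 (ad z (ep x)).
    by rewrite -addn1 PoszD; apply: adD => //; apply: lD_ep.
  have D2 : lD m.+2 (op x z) by rewrite -addn1 PoszD; apply: lD_op.
  apply: l_trp (submodD D1 D2) _ => y.
  rewrite (linPD (om_lin y)) Dm om_ep (blNr bil) E0 IH om_op; zmod.
elim: n w => [|n IH] w Dw.
  have [x' ->] := lD1 Dw.
  have E0 a : ad (ep x') (e0 a) = - o0 a (ep x') by rewrite adp op_e0 o0_ep.
  split=> //; last by move=> y; rewrite adp op_em om_ep opprK.
  apply: via_tr (lD_ep X x') E0 _ => // y x.
  by rewrite om_ep (blNl bil) ad_e0 o0_ep (linPN (op_lin x)) opprK op_e0.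
have E0 : forall a, ad w (e0 a) = - o0 a w.
  apply: (l_genp (K := fun w => forall a, ad w (e0 a) = - o0 a w) _ _ Dw).
    split=> [a|c u v Hu Hv a]; first by rewrite (bl0l bil) (linP0 (o0_lin _)) oppr0.
    by rewrite (blPl bil) Hu Hv (o0_lin a) scalerN opprD.
  move=> x z Dz a; have [Ea Ex _] := IH _ Dz.
  have := Dp x z (e0 a); rewrite Ea op_e0 (blNr bil) Ex (linPN (op_lin x)) o0_op => /eqP.
  by rewrite opprK -subr_eq => /eqP <-; rewrite op_o0; zmod.
split=> //.
  apply: (via_tr n.+1 _ Dw) => // y x.
  by have := lD_om y Dw; rewrite -addn1 PoszD addrK => /IH[].
apply: (l_genp (K := fun w => forall y, ad w (em y) = - om y w) _ _ Dw).
  split=> [a|c u v Hu Hv a]; first by rewrite (bl0l bil) (linP0 (om_lin _)) oppr0.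
  by rewrite (blPl bil) Hu Hv (om_lin a) scalerN opprD.
move=> x z Dz y; have [Ea _ Ey] := IH _ Dz.
have := Dp x z (em y); rewrite Ey op_em Ea (linPN (op_lin x)) om_op => /eqP.
by rewrite -subr_eq opprK => /eqP <-; zmod.
Qed.
End SkewPos.

Section Ad.
Variables (k : fieldType) (l : locLie k) (X : gradedLie l).

Lemma adm_flip n z (T : hom_mod X X) : @genm k l X _ (@adm _ _ X) n z T ->
  @genp k (flip l) (flip_Lie X) (hom_mod (flip_Lie X) (flip_Lie X)) (@adp _ _ (flip_Lie
    X)) n z T.
Proof.
apply: (@gen_map k (flip l) (flip l) (flip_mod X) (flip_mod (hom_mod X X)) (flip_mod X)
  (hom_mod (flip_Lie X) (flip_Lie X)) _ _ _ _ _ id id id) => //.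
by move=> x h; apply: (@homE k X X).
Qed.

Lemma ad_ex : exists ad : hom X (hom X X),
  [/\ forall a z, ad (e0 a) z = o0 a z, forall x z, ad (ep x) z = op x z &
      forall y z, ad (em y) z = om y z] /\
  [/\ forall a z w, ad (o0 a z) w = o0 a (ad z w) - ad z (o0 a w),
      forall x z w, ad (op x z) w = op x (ad z w) - ad z (op x w),
      forall y z w, ad (om y z) w = om y (ad z w) - ad z (om y w) &
      forall n m z w, lD n z -> lD m w -> lD (n + m) (ad z w)].
Proof.
have H0 (a b : lg l) : o0 a (ad0 X b) = ad0 X ⁅a, b⁆.
  by apply: homE => z /=; rewrite o0_br.
have L0 : linear (@ad0 _ _ X).
  by move=> c a b; apply: homE => z; rewrite homDE homZE /= (blPl (o0_bil X)).
have Hm1 (a : lg l) y : o0 a (adm X y) = adm X (ls a y).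
  by apply: homE => z /=; rewrite o0_om addrK.
have Hm2 y a : om y (ad0 X a) = - adm X (ls a y).
  by apply: homE => z; rewrite homNE /= om_o0 addrC addKr.
have Hm3 x y : op x (adm X y) = ad0 X (lF x y).
  by apply: homE => z /=; rewrite op_om addrC addKr.
have Lm : linear (@adm _ _ X).
  by move=> c a b; apply: homE => z; rewrite homDE homZE /= (blPl (om_bil X)).
have Tm n h : @genm k l X _ (@adm _ _ X) n.+1 0 h -> (forall x, op x h = 0) -> h = 0 :>
  hom_mod X X.
  move=> G0 oph; have G := adm_flip G0; apply: (adp_tr G) => x.
  by apply: homE => w; have := congr1 (fun h : hom_mod X X => h w) (oph x).
have [f [[f0 fp fm] [F0 Fp Fm FD]]] := lie_rec L0 (@adp_lin _ _ X) Lm H0 (@adp_eqv _ _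
  X) Hm1
  (@op_ad0 _ _ X) Hm2 Hm3 (@om_adp _ _ X) (@adp_tr _ _ X) Tm.
exists f; split; first by split=> s z; rewrite ?f0 ?fp ?fm.
split; first by move=> *; rewrite F0.
- by move=> *; rewrite Fp.
- by move=> *; rewrite Fm.
move=> n m z w /FD; case: n => [[|n]|n].
- by case=> a [_ ->] Dw; rewrite add0r; apply: lD_o0.
- by move=> G Dw; rewrite addrC; apply: adp_deg G Dw.
- move=> G0 Dw; have G := adm_flip G0; rewrite NegzE addrC.
  rewrite -[X in lD (X + _)]opprK -opprD.
  by apply: (adp_deg (X := flip_Lie X) (m := - m) G); rewrite /= /flipD opprK.
Qed.

Lemma bracket_ex : exists br : X -> X -> X,
  [/\ is_lie_bracket br, forall a z, br (e0 a) z = o0 a z,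
      forall x z, br (ep x) z = op x z, forall y z, br (em y) z = om y z &
      forall n m z w, lD n z -> lD m w -> lD (n + m) (br z w)].
Proof.
have [ad [[ad0 adp adm] [adA0 adAp adAm adD]]] := ad_ex.
exists (fun z w => ad z w); split=> //.
have bil : is_bilinear (fun z w => ad z w).
  split=> [z|w]; first exact: hom_lin.
  by move=> c z z'; rewrite (hom_lin ad).
(* For local [z] this says that the local operators are derivations of [ad]; commutators of
   derivations being derivations, it passes to the words in them. *)
have jac z : forall w u, ad z (ad w u) = ad (ad z w) u + ad w (ad z u).
  apply: (loc_ind (X := X) (K := fun z => forall w u, ad z (ad w u) = ad (ad z w) u + ad
    w (ad z u))).
  - split=> [w u|c z' z'' H H' w u]; first by rewrite !(bl0l bil) (bl0r bil) addr0.
    rewrite !(blPl bil) H H' !(hom_lin (ad w)) !scalerDr.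
    by zmod.
  - by move=> a w u; rewrite !ad0 adA0 subrK.
  - by move=> a w u; rewrite !adp adAp subrK.
  - by move=> a w u; rewrite !adm adAm subrK.
  - move=> x {}z H w u; have Dx w' u' : op x (ad w' u') = ad (op x w') u' + ad w' (op x
      u').
      by rewrite adAp subrK.
    rewrite !(adAp x z) H (Dx w u) (linPD (hom_lin (ad z))) !H (linPD (op_lin x)).
    rewrite (Dx (ad z w) u) (Dx w (ad z u)) (linPB (hom_lin ad)) homDE homNE.
    by rewrite (linPB (hom_lin (ad w))); zmod.
  - move=> x {}z H w u; have Dx w' u' : om x (ad w' u') = ad (om x w') u' + ad w' (om x
      u').
      by rewrite adAm subrK.
    rewrite !(adAm x z) H (Dx w u) (linPD (hom_lin (ad z))) !H (linPD (om_lin x)).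
    rewrite (Dx (ad z w) u) (Dx w (ad z u)) (linPB (hom_lin ad)) homDE homNE.
    by rewrite (linPB (hom_lin (ad w))); zmod.
have D0 a z w : o0 a (ad z w) = ad (o0 a z) w + ad z (o0 a w) by rewrite adA0 subrK.
have Dp x z w : op x (ad z w) = ad (op x z) w + ad z (op x w) by rewrite adAp subrK.
have Dm x z w : om x (ad z w) = ad (om x z) w + ad z (om x w) by rewrite adAm subrK.
have bil' : is_bilinear (fun z w : flip_Lie X => ad z w) by [].
have Sp := skew_pos bil ad0 Dp Dm adD adp.
have Sm n w : lD (- n.+1%:Z) w -> [/\ forall a, ad w (e0 a) = - o0 a w,
    forall y, ad w (em y) = - om y w & forall x, ad w (ep x) = - op x w].
  apply: (skew_pos (X := flip_Lie X) bil' ad0 Dm Dp _ adm) => {w}n m z w.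
  by rewrite /= /flipD opprD; apply: adD.
have loc w : [/\ forall a, ad w (e0 a) = - o0 a w,
    forall x, ad w (ep x) = - op x w & forall y, ad w (em y) = - om y w].
  apply: (l_ind (g := X) (K := fun w => [/\ forall a, ad w (e0 a) = - o0 a w,
    forall x, ad w (ep x) = - op x w & forall y, ad w (em y) = - om y w])).
  split=> [|c u v [H1 H2 H3] [H1' H2' H3']]; split=> s.
  - by rewrite (bl0l bil) (linP0 (o0_lin _)) oppr0.
  - by rewrite (bl0l bil) (linP0 (op_lin _)) oppr0.
  - by rewrite (bl0l bil) (linP0 (om_lin _)) oppr0.
  - by rewrite (blPl bil) H1 H1' (o0_lin s) scalerN opprD.
  - by rewrite (blPl bil) H2 H2' (op_lin s) scalerN opprD.
  - by rewrite (blPl bil) H3 H3' (om_lin s) scalerN opprD.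
  case=> [[|n]|n] {}w; last by rewrite NegzE => /Sm[].
    move=> /lD0[a ->]; split=> s; rewrite ad0.
    - by rewrite !o0_e0 (brC (lg_lie l)) (linPN (e0_lin X)).
    - by rewrite op_e0 o0_ep opprK.
    - by rewrite om_e0 o0_em opprK.
  by move/Sp.
have skew z : forall w, ad z w = - ad w z.
  apply: (loc_ind (X := X) (K := fun z => forall w, ad z w = - ad w z)).
  - split=> [w|c u v Hu Hv w]; first by rewrite (bl0l bil) (bl0r bil) oppr0.
    by rewrite (blPl bil) Hu Hv (blPr bil) scalerN opprD.
  - by move=> a w; have [-> _ _] := loc w; rewrite ad0 opprK.
  - by move=> a w; have [_ -> _] := loc w; rewrite adp opprK.
  - by move=> a w; have [_ _ ->] := loc w; rewrite adm opprK.
  - by move=> x {}z H w; rewrite adAp !H (linPN (op_lin x)) Dp; zmod.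
  - by move=> x {}z H w; rewrite adAm !H (linPN (om_lin x)) Dm; zmod.
split=> //.
(* In characteristic 2 antisymmetry does not give [ad z z = 0]. For homogeneous [z] of nonzero
   degree, [ad z z] has degree at least 2 in absolute value, and the local operators towards degree
   0 kill it by the derivation rule and antisymmetry. *)
move=> z; apply: (l_ind (g := X) (K := fun z => ad z z = 0)).
  split=> [|c u v Hu Hv]; first by rewrite (bl0l bil).
  rewrite (blPl bil) !(hom_lin (ad _)) Hu Hv scaler0 add0r addr0 (skew v u).
  by rewrite scalerN subrr.
case=> [[|n]|n] {}z Dz.
- by have [a ->] := lD0 Dz; rewrite ad0 o0_e0 (brxx (lg_lie l)) (linP0 (e0_lin X)).
- have DD : lD (n + n).+2 (ad z z).
    by have := adD _ _ _ _ Dz Dz; rewrite -PoszD addSn addnS.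
  by apply: l_trp DD _ => y; rewrite Dm (skew _ z) addNr.
- have DD : lD (- (n + n).+2%:Z) (ad z z).
    by have := adD _ _ _ _ Dz Dz; rewrite !NegzE -opprD -PoszD addSn addnS.
  by apply: l_trm DD _ => y; rewrite Dp (skew _ z) addNr.
Qed.
End Ad.

(** * Action on an extension *)

Section Action.
Variables (k : fieldType) (l : locLie k) (X : gradedLie l) (E : gradedMod l).

Definition zero_submod : submod E.
Proof.
by refine (@Submod k E (fun u => u = 0) erefl _) => c u v -> ->; rewrite scaler0 addr0.
Defined.

(* The grading of [E] continued by 0 in negative degrees. *)
Definition gDz (n : int) : submod E :=
  match n with Posz n => gD n | Negz _ => zero_submod end.

Lemma gDz_op n x u : gDz n u -> gDz (n + 1) (op x u).
Proof.
case: n => n; first by rewrite -PoszD addn1; apply: gD_op.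
by move=> ->; rewrite (linP0 (op_lin _)); apply: submod0.
Qed.
Lemma gDz_om n y u : gDz n u -> gDz (n - 1) (om y u).
Proof.
case: n => [[|n]|n].
- by move=> /gD0[v ->]; rewrite gi_om; apply: submod0.
- by move=> Du; rewrite -[n.+1]addn1 PoszD addrK; apply: gD_om.
by move=> ->; rewrite (linP0 (om_lin _)); apply: submod0.
Qed.

Definition act0 (a : lg l) : hom_mod E E := homL (o0_lin (M := E) a).
Definition actp (x : lV l) : hom_mod E E := homL (op_lin (M := E) x).
Definition actm (y : lW l) : hom_mod E E := homL (om_lin (M := E) y).

Lemma actp_deg n z T m u : @genp k l X (hom_mod E E) actp n z T -> gDz m u ->
  gDz (m + n.+1%:Z) (T u).
Proof.
move=> GT; elim: GT m u => {n z T}.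
- by move=> x m u; apply: gDz_op.
- move=> n x z T _ IH m u Du.
  rewrite -addn1 PoszD addrA; apply: submodB; first by apply/gDz_op/IH.
  by rewrite addrAC; apply: IH; apply: gDz_op.
- by move=> n c z T z' T' _ IH _ IH' m u Du; rewrite homDE homZE; apply: submodP; auto.
Qed.

Lemma actm_deg n z T m u : @genm k l X (hom_mod E E) actm n z T -> gDz m u ->
  gDz (m - n.+1%:Z) (T u).
Proof.
move=> GT; elim: GT m u => {n z T}.
- by move=> x m u; apply: gDz_om.
- move=> n x z T _ IH m u Du.
  rewrite -addn1 PoszD opprD addrA; apply: submodB; first by apply/gDz_om/IH.
  by rewrite addrAC; apply: IH; apply: gDz_om.
- by move=> n c z T z' T' _ IH _ IH' m u Du; rewrite homDE homZE; apply: submodP; auto.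
Qed.

Lemma hom_comm (M N : locmod l) (T : hom_mod M N) (f : M -> M) (h : N -> N) z :
  h (T z) - T (f z) = 0 -> h (T z) = T (f z).
Proof. by move/eqP; rewrite subr_eq0 => /eqP. Qed.

Lemma ker_submod (U V : lmodType k) (T : hom U V) : is_submod (fun u => T u = 0).
Proof.
split=> [|c u v eu ev]; first exact: (linP0 (hom_lin T)).
by rewrite (hom_lin T) eu ev scaler0 addr0.
Qed.

(** The induction on degree can start at the lowest piece, which V_-1 kills: [T] commutes with V_-1,
    and its values lie in positive degree, where [E] is transitive. *)
Lemma actp_tr n T : @genp k l X (hom_mod E E) actp n.+1 0 T ->
  (forall y, om y T = 0) -> T = 0.
Proof.
move=> GT omT.
have comT y u : om y (T u) = T (om y u).
  by apply: (hom_comm (T := T)); exact: (congr1 (fun h : hom_mod E E => h u) (omT y)).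
apply: homE => u; rewrite hom0E; apply: (g_ind (g := E) (ker_submod T)) u.
elim=> [|m IH] u Du; have DT := actp_deg (m := Posz _) GT Du.
  apply: g_tr DT _ => y; rewrite comT.
  by have [v ->] := gD0 Du; rewrite gi_om (linP0 (hom_lin T)).
by apply: g_tr (DT : gD (m + n.+2).+1 _) _ => y; rewrite comT; apply: IH; apply: gD_om.
Qed.

(** [T] lowers degrees, so it kills the lowest piece; it commutes with V_1, which generates [E] from
    there. *)
Lemma actm_tr n T : @genm k l X (hom_mod E E) actm n.+1 0 T ->
  (forall x, op x T = 0) -> T = 0.
Proof.
move=> GT opT.
have comT y u : op y (T u) = T (op y u).
  by apply: (hom_comm (T := T)); exact: (congr1 (fun h : hom_mod E E => h u) (opT y)).
apply: homE => u; rewrite hom0E; apply: (mod_ind (ker_submod T)) u => [u|x u Tu].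
  (* The degree 0 - (n + 2) reduces to a [Negz], where [gDz] is the zero submodule. *)
  by have := actm_deg (m := 0) GT (gD_gi E u).
by rewrite -comT Tu (linP0 (op_lin _)).
Qed.

Lemma action_ex : exists act : hom X (hom E E),
  [/\ forall a u, act (e0 a) u = o0 a u, forall x u, act (ep x) u = op x u &
      forall y u, act (em y) u = om y u] /\
  [/\ forall a z w, act (o0 a z) w = o0 a (act z w) - act z (o0 a w),
      forall x z w, act (op x z) w = op x (act z w) - act z (op x w),
      forall y z w, act (om y z) w = om y (act z w) - act z (om y w) &
      forall n m z w, lD n z -> gD m w -> gDz (n + m%:Z) (act z w)].
Proof.
have H0 (a b : lg l) : o0 a (act0 b) = act0 ⁅a, b⁆.
  by apply: homE => z /=; rewrite o0_br.
have L0 : linear act0.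
  by move=> c a b; apply: homE => z; rewrite homDE homZE /= (blPl (o0_bil E)).
have Hp1 (a : lg l) y : o0 a (actp y) = actp (lr a y).
  by apply: homE => z /=; rewrite o0_op addrK.
have Hm1 (a : lg l) y : o0 a (actm y) = actm (ls a y).
  by apply: homE => z /=; rewrite o0_om addrK.
have Hp2 y a : op y (act0 a) = - actp (lr a y).
  by apply: homE => z; rewrite homNE /= op_o0 addrC addKr.
have Hm2 y a : om y (act0 a) = - actm (ls a y).
  by apply: homE => z; rewrite homNE /= om_o0 addrC addKr.
have Hm3 x y : op x (actm y) = act0 (lF x y).
  by apply: homE => z /=; rewrite op_om addrC addKr.
have Hp3 y x : om y (actp x) = - act0 (lF x y).
  by apply: homE => z; rewrite homNE /= om_op addrC addKr.
have Lp : linear actp.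
  by move=> c a b; apply: homE => z; rewrite homDE homZE /= (blPl (op_bil E)).
have Lm : linear actm.
  by move=> c a b; apply: homE => z; rewrite homDE homZE /= (blPl (om_bil E)).
have [f [[f0 fp fm] [F0 Fp Fm FD]]] :=
  lie_rec L0 Lp Lm H0 Hp1 Hm1 Hp2 Hm2 Hm3 Hp3 actp_tr actm_tr.
exists f; split; first by split=> s z; rewrite ?f0 ?fp ?fm.
split; first by move=> *; rewrite F0.
- by move=> *; rewrite Fp.
- by move=> *; rewrite Fm.
move=> n m z w /FD; case: n => [[|n]|n].
- by case=> a [_ ->] Dw; rewrite add0r; apply: gD_o0.
- by move=> G Dw; rewrite addrC; apply: actp_deg G _.
- by move=> G Dw; rewrite NegzE addrC; apply: actm_deg G _.
Qed.

Lemma action_rep (br : X -> X -> X) (act : hom X (hom E E)) :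
  is_lie_bracket br ->
  (forall a z, br (e0 a) z = o0 a z) -> (forall x z, br (ep x) z = op x z) ->
  (forall y z, br (em y) z = om y z) ->
  (forall a z w, act (o0 a z) w = o0 a (act z w) - act z (o0 a w)) ->
  (forall x z w, act (op x z) w = op x (act z w) - act z (op x w)) ->
  (forall y z w, act (om y z) w = om y (act z w) - act z (om y w)) ->
  (forall a u, act (e0 a) u = o0 a u) -> (forall x u, act (ep x) u = op x u) ->
  (forall y u, act (em y) u = om y u) ->
  forall z w u, act (br z w) u = act z (act w u) - act w (act z u).
Proof.
move=> [bil _ jac] b0 bp bm A0 Ap Am a0 ap am.
apply: (loc_ind (X := X) (K := fun z => forall w u,
  act (br z w) u = act z (act w u) - act w (act z u))).
- split=> [w u|c z z' H H' w u].
    by rewrite (bl0l bil) (linP0 (hom_lin act)) hom0E (linP0 (hom_lin (act w))) subr0.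
  rewrite (blPl bil) !(hom_lin act) !(homDE, homZE) H H' (hom_lin (act w)).
  by rewrite scalerBr; zmod.
- by move=> a w u; rewrite b0 A0 !a0.
- by move=> a w u; rewrite bp Ap !ap.
- by move=> a w u; rewrite bm Am !am.
- move=> x z H w u; rewrite -(bp x z).
  have -> : br (br (ep x) z) w = br (ep x) (br z w) - br z (br (ep x) w).
    by rewrite jac addrK.
  rewrite !bp (linPB (hom_lin act)) homDE homNE !Ap !H !Ap.
  by rewrite !(linPB (op_lin _)) !(linPB (hom_lin (act _))); zmod.
- move=> x z H w u; rewrite -(bm x z).
  have -> : br (br (em x) z) w = br (em x) (br z w) - br z (br (em x) w).
    by rewrite jac addrK.
  rewrite !bm (linPB (hom_lin act)) homDE homNE !Am !H !Am.
  by rewrite !(linPB (om_lin _)) !(linPB (hom_lin (act _))); zmod.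
Qed.

End Action.

(** * The invariant form *)

Section Components.
Variables (k : fieldType) (X : lmodType k) (I : eqType) (D : I -> submod X) (gr : graded
  D).

Lemma component_ex (U : lmodType k) (e : U -> X) (n : I) : linear e ->
  (forall u, e u = 0 -> u = 0) -> (forall u, D n (e u)) ->
  (forall z, D n z -> exists u, z = e u) ->
  exists p : X -> U, [/\ linear p, forall u, p (e u) = u &
    forall m z, D m z -> m != n -> p z = 0].
Proof.
move=> le ie De eD; pose p z := xget 0 [set u | gr_proj gr n z = e u]%classic.
have inj u v : e u = e v -> u = v.
  move=> euv; apply/eqP; rewrite -subr_eq0; apply/eqP/ie.
  by rewrite (linPB le) euv subrr.
have pP z : gr_proj gr n z = e (p z).
  have [u eu] := eD _ (gr_in gr n z).
  exact: (xgetI (P := [set u | gr_proj gr n z = e u]%classic) 0 eu).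
exists p; split.
- by move=> c u v; apply: inj; rewrite le -!pP (gr_lin gr).
- by move=> u; apply: inj; rewrite -pP; apply: gr_id.
- by move=> m z Dz mn; apply: inj; rewrite -pP (gr_0 gr Dz mn) (linP0 le).
Qed.

Lemma graded_eq (H : lmodType k) (f h : X -> H) : linear f -> linear h ->
  (forall n z, D n z -> f z = h z) -> forall z, f z = h z.
Proof.
move=> lf lh fh; apply: (gr_ind gr (K := fun z => f z = h z)) => //.
split=> [|c u v eu ev]; first by rewrite !linP0.
by rewrite lf lh eu ev.
Qed.
End Components.

Section LocalComponents.
Variables (k : fieldType) (l : locLie k) (X : gradedLie l).

Lemma local_components_ex : exists p0 : X -> lg l, exists pp : X -> lV l, exists pm : X
  -> lW l,
  [/\ linear p0, linear pp & linear pm] /\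
  [/\ forall a, p0 (e0 a) = a, forall x, pp (ep x) = x, forall y, pm (em y) = y &
   [/\ forall n z, lD n z -> n != 0 -> p0 z = 0, forall n z, lD n z -> n != 1 -> pp z = 0
   & forall n z, lD n z -> n != -1 -> pm z = 0]].
Proof.
have [p0 [l0 H0 D0]] := component_ex (l_gr X) (e0_lin X) (@e0_inj _ _ X) (lD_e0 X) (@lD0
  _ _ X).
have [pp [lp Hp Dp]] := component_ex (l_gr X) (ep_lin X) (@ep_inj _ _ X) (lD_ep X) (@lD1
  _ _ X).
have [pm [lm Hm Dm]] := component_ex (l_gr X) (em_lin X) (@em_inj _ _ X) (lD_em X)
  (@lDm1 _ _ X).
by exists p0, pp, pm.
Qed.

Variables (p0 : X -> lg l) (pp : X -> lV l) (pm : X -> lW l).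
Hypotheses (l0 : linear p0) (lp : linear pp) (lm : linear pm).
Hypotheses (p0e : forall a, p0 (e0 a) = a) (ppe : forall x, pp (ep x) = x)
  (pme : forall y, pm (em y) = y).
Hypotheses (p0D : forall n z, lD n z -> n != 0 -> p0 z = 0)
 (ppD : forall n z, lD n z -> n != 1 -> pp z = 0)
 (pmD : forall n z, lD n z -> n != -1 -> pm z = 0).

Lemma comp_lin (U V W : lmodType k) (f : V -> W) (h : U -> V) :
  linear f -> linear h -> linear (fun u => f (h u)).
Proof. by move=> lf lh c u v; rewrite lh lf. Qed.

Lemma oppl_lin (U V : lmodType k) (f : U -> V) : linear f -> linear (fun u => - f u).
Proof. by move=> lf c u v; rewrite lf opprD scalerN. Qed.

(** This and the next formulas describe the degree -1, 0 and 1 components after a local operator.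
    They express the contragredient action on functionals that factor through one of these
    components. *)
Lemma p0_o0 a z : p0 (o0 a z) = ⁅a, p0 z⁆.
Proof.
apply: (graded_eq (l_gr X) (f := fun z => p0 (o0 a z)) (h := fun z => ⁅a, p0 z⁆)).
- exact: comp_lin (o0_lin a).
- by apply: comp_lin l0; apply: (br_bil (lg_lie l)).1.
move=> n {}z Dz; have [n0|n0] := eqVneq n 0.
  by move: Dz; rewrite n0 => /lD0[b ->]; rewrite o0_e0 !p0e.
by rewrite (p0D (lD_o0 a Dz) n0) (p0D Dz n0) (bl0r (br_bil (lg_lie l))).
Qed.

Lemma pp_o0 a z : pp (o0 a z) = lr a (pp z).
Proof.
apply: (graded_eq (l_gr X) (f := fun z => pp (o0 a z)) (h := fun z => lr a (pp z))).
- exact: comp_lin (o0_lin a).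
- by apply: comp_lin lp; apply: (lr_rep l).1.1.
move=> n {}z Dz; have [n0|n0] := eqVneq n 1.
  by move: Dz; rewrite n0 => /lD1[b ->]; rewrite o0_ep !ppe.
by rewrite (ppD (lD_o0 a Dz) n0) (ppD Dz n0) (bl0r (lr_rep l).1).
Qed.

Lemma pm_o0 a z : pm (o0 a z) = ls a (pm z).
Proof.
apply: (graded_eq (l_gr X) (f := fun z => pm (o0 a z)) (h := fun z => ls a (pm z))).
- exact: comp_lin (o0_lin a).
- by apply: comp_lin lm; apply: (ls_rep l).1.1.
move=> n {}z Dz; have [n0|n0] := eqVneq n (-1).
  by move: Dz; rewrite n0 => /lDm1[b ->]; rewrite o0_em !pme.
by rewrite (pmD (lD_o0 a Dz) n0) (pmD Dz n0) (bl0r (ls_rep l).1).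
Qed.

Lemma pp_op x z : pp (op x z) = - lr (p0 z) x.
Proof.
apply: (graded_eq (l_gr X) (f := fun z => pp (op x z)) (h := fun z => - lr (p0 z) x)).
- exact: comp_lin (op_lin x).
- by apply: oppl_lin; apply: (comp_lin (f := fun a => lr a x)) l0; apply: (lr_rep l).1.2.
move=> n {}z Dz; have [n0|n0] := eqVneq n 0.
  by move: Dz; rewrite n0 => /lD0[b ->]; rewrite op_e0 (linPN lp) ppe p0e.
rewrite (ppD (lD_op x Dz)) ?(p0D Dz n0) ?(bl0l (lr_rep l).1) ?oppr0 //.
by rewrite -subr_eq0 addrK.
Qed.

Lemma pm_om y z : pm (om y z) = - ls (p0 z) y.
Proof.
apply: (graded_eq (l_gr X) (f := fun z => pm (om y z)) (h := fun z => - ls (p0 z) y)).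
- exact: comp_lin (om_lin y).
- by apply: oppl_lin; apply: (comp_lin (f := fun a => ls a y)) l0; apply: (ls_rep l).1.2.
move=> n {}z Dz; have [n0|n0] := eqVneq n 0.
  by move: Dz; rewrite n0 => /lD0[b ->]; rewrite om_e0 (linPN lm) pme p0e.
rewrite (pmD (lD_om y Dz)) ?(p0D Dz n0) ?(bl0l (ls_rep l).1) ?oppr0 //.
by rewrite -subr_eq0 opprK subrK.
Qed.

Lemma p0_op x z : p0 (op x z) = lF x (pm z).
Proof.
apply: (graded_eq (l_gr X) (f := fun z => p0 (op x z)) (h := fun z => lF x (pm z))).
- exact: comp_lin (op_lin x).
- by apply: comp_lin lm; apply: (lF_bil l).1.
move=> n {}z Dz; have [n0|n0] := eqVneq n (-1).
  by move: Dz; rewrite n0 => /lDm1[b ->]; rewrite op_em pme p0e.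
rewrite (p0D (lD_op x Dz)) ?(pmD Dz n0) ?(bl0r (lF_bil l)) //.
by rewrite addr_eq0.
Qed.

Lemma p0_om y z : p0 (om y z) = - lF (pp z) y.
Proof.
apply: (graded_eq (l_gr X) (f := fun z => p0 (om y z)) (h := fun z => - lF (pp z) y)).
- exact: comp_lin (om_lin y).
- by apply: oppl_lin; apply: (comp_lin (f := fun a => lF a y)) lp; apply: (lF_bil l).2.
move=> n {}z Dz; have [n0|n0] := eqVneq n 1.
  by move: Dz; rewrite n0 => /lD1[b ->]; rewrite om_ep ppe (linPN l0) p0e.
rewrite (p0D (lD_om y Dz)) ?(ppD Dz n0) ?(bl0l (lF_bil l)) ?oppr0 //.
by rewrite subr_eq0.
Qed.
End LocalComponents.

Section FormPos.
Variables (k : fieldType) (l : locLie k) (X : gradedLie l).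
Let H := hom_mod X (triv_mod l).
Variable j : lV l -> H.
Hypothesis jD : forall x m w, lD m w -> m != -1 -> j x w = 0.

(** A functional [j x] lives on degree -1, and each operator of V_1 moves the support down by
    one. *)
Lemma form_deg n z (h : H) m w : @genp k l X H j n z h -> lD m w -> m != - n.+1%:Z -> h
  w = 0.
Proof.
move=> G; elim: G m w => {n z h}; first exact: jD.
- move=> n x z h _ IH m w Dw mn; rewrite /= sub0r (IH _ _ (lD_op x Dw)) ?oppr0 //.
  by rewrite -[1]opprK subr_eq -opprD -PoszD addn1.
- by move=> n c z h z' h' _ IH _ IH' m w Dw mn; rewrite homDE homZE (IH m) // (IH' m) //
    scaler0 addr0.
Qed.

(** Transitivity in the dual is generation in [X]: [h] vanishes on the image of V_-1, which spans
    the only degree supporting it. *)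
Lemma form_tr n (h : H) : @genp k l X H j n.+1 0 h -> (forall y, om y h = 0) -> h = 0.
Proof.
move=> G omh; apply: homE => w; rewrite hom0E.
have hom0 y u : h (om y u) = 0.
  have := congr1 (fun h : H => h u) (omh y); rewrite /= sub0r => /eqP.
  by rewrite oppr_eq0 => /eqP.
apply: (l_ind (g := X) (ker_submod h)) w => m w Dw.
have [mn|mn] := eqVneq m (- n.+2%:Z); last exact: form_deg G Dw mn.
by move: Dw; rewrite mn; apply: (l_genm (ker_submod h)) => y u _; apply: hom0.
Qed.
End FormPos.

Section Form.
Variables (k : fieldType) (l : locLie k) (X : gradedLie l).
Variables (b0 : lg l -> lg l -> k) (bp : lV l -> lW l -> k).
Hypotheses (b0_bil : is_bilinear_form b0) (b0_sym : forall a b, b0 a b = b0 b a)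
  (b0_nd : is_nondegenerate b0) (b0_inv : is_invariant_form b0).
Hypotheses (bp_bil : is_bilinear_form bp) (bp_nd : is_nondegenerate bp)
  (bp_inv : forall a v w, bp (lr a v) w = - bp v (ls a w))
  (bpF : forall a v w, b0 a (lF v w) = bp (lr a v) w).
Let H := hom_mod X (triv_mod l).
Let b0' : is_bilinear (b0 : _ -> _ -> k^o) := b0_bil.
Let bp' : is_bilinear (bp : _ -> _ -> k^o) := bp_bil.

Lemma form_ex : exists B : X -> X -> k,
  [/\ is_bilinear_form B, is_nondegenerate B, forall z w, B z w = B w z &
     [/\ forall a b, B (e0 a) (e0 b) = b0 a b, forall v w, B (ep v) (em w) = bp v w,
    forall n m z w, lD n z -> lD m w -> n + m != 0 -> B z w = 0 &
    [/\ forall a z w, B (o0 a z) w = - B z (o0 a w),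
     forall x z w, B (op x z) w = - B z (op x w) &
     forall y z w, B (om y z) w = - B z (om y w)]]].
Proof.
have [p0 [pp [pm [[l0 lp lm] [p0e ppe pme [p0D ppD pmD]]]]]] := local_components_ex X.
have P0 := p0_op l0 lm p0e pme p0D pmD; have P0' := p0_om l0 lp p0e ppe p0D ppD.
have Pp := pp_op l0 lp p0e ppe p0D ppD; have Pm := pm_om l0 lm p0e pme p0D pmD.
have lj0 a : linear (fun z => b0 a (p0 z) : k^o).
  by apply: comp_lin l0; apply: b0'.1.
have ljp x : linear (fun z => bp x (pm z) : k^o).
  by apply: comp_lin lm; apply: bp'.1.
have ljm y : linear (fun z => bp (pp z) y : k^o).
  by apply: (comp_lin (f := fun x => bp x y : k^o)) lp; apply: bp'.2.
pose j0 a : H := homL (lj0 a); pose jp x : H := homL (ljp x); pose jm y : H := homL (ljm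
  y).
have Lp : linear jp by move=> c x x'; apply: homE => z; apply: (blPl bp').
have Lm : linear jm by move=> c x x'; apply: homE => z; apply: (blPr bp').
have L0 : linear j0 by move=> c x x'; apply: homE => z; apply: (blPl b0').
have jpD x m w : lD m w -> m != -1 -> jp x w = 0.
  by move=> Dw m1; rewrite /= (pmD _ _ Dw m1) (bl0r bp').
have jmD y m w : lD m w -> m != 1 -> jm y w = 0.
  by move=> Dw m1; rewrite /= (ppD _ _ Dw m1) (bl0l bp').
have H0 (a b : lg l) : o0 a (j0 b) = j0 ⁅a, b⁆.
  apply: homE => z; rewrite /= sub0r p0_o0 //.
  by rewrite -b0_inv (brC (lg_lie l)) (blNl b0') opprK.
have Hp1 (a : lg l) y : o0 a (jp y) = jp (lr a y).
  by apply: homE => z; rewrite /= sub0r pm_o0 // bp_inv.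
have Hm1 (a : lg l) y : o0 a (jm y) = jm (ls a y).
  by apply: homE => z; rewrite /= sub0r pp_o0 // bp_inv opprK.
have Hp2 y a : op y (j0 a) = - jp (lr a y).
  by apply: homE => z; rewrite homNE /= sub0r P0 bpF.
have Hm2 y a : om y (j0 a) = - jm (ls a y).
  by apply: homE => z; rewrite homNE /= sub0r P0' (blNr b0') opprK bpF bp_inv.
(* Symmetry of [b0] is used here: [bpF] has [lF x y] on the right, the functional [j0 (lF x y)] has
   it on the left. *)
have Hm3 x y : op x (jm y) = j0 (lF x y).
  by apply: homE => z; rewrite /= sub0r Pp (blNl bp') opprK b0_sym bpF.
have Hp3 y x : om y (jp x) = - j0 (lF x y).
  apply: homE => z; rewrite homNE /= sub0r Pm (blNr bp') opprK b0_sym bpF.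
  by rewrite bp_inv opprK.
have Tm n h : @genm k l X H jm n.+1 0 h -> (forall x, op x h = 0) -> h = 0.
  move=> G oph; apply: (@form_tr k (flip l) (flip_Lie X) jm _ n h).
  - by move=> x m w Dw m1; apply: (jmD _ _ _ Dw); rewrite eqr_oppLR.
  - apply: (@gen_map k (flip l) (flip l) (flip_mod X) (flip_mod H) (flip_mod X)
      (hom_mod (flip_Lie X) (triv_mod (flip l))) _ _ _ _ _ id id id) G => //.
    by move=> x h'; apply: (@homE k X k^o).
  - by move=> x; apply: homE => u; have := congr1 (fun h : H => h u) (oph x).
have [f [[f0 fp fm] [F0 Fp Fm FD]]] :=
  lie_rec L0 Lp Lm H0 Hp1 Hm1 Hp2 Hm2 Hm3 Hp3 (form_tr jpD) Tm.
have Fo z : [/\ forall a w, f (o0 a z) w = - f z (o0 a w),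
    forall x w, f (op x z) w = - f z (op x w) & forall y w, f (om y z) w = - f z (om y
      w)].
  by split=> s w; rewrite ?F0 ?Fp ?Fm /= sub0r.
have Bbil : is_bilinear (fun z w => f z w).
  by split=> [z|w]; [apply: hom_lin|move=> c u v; rewrite (hom_lin f)].
have BD n m z w : lD n z -> lD m w -> n + m != 0 -> f z w = 0.
  move=> Dz Dw nm; have := FD _ _ Dz; case: n Dz nm => [[|n]|n] Dz nm.
  - by case=> a [_ ->]; rewrite /= (p0D _ _ Dw) ?(bl0r b0') //; rewrite add0r in nm.
  - by move=> G; apply: (form_deg jpD G Dw); rewrite -addr_eq0 addrC.
  - move=> G.
    have G' : @genp k (flip l) (flip_Lie X) (hom_mod (flip_Lie X) (triv_mod (flip l)))
      jm n z (f z).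
      apply: (@gen_map k (flip l) (flip l) (flip_mod X) (flip_mod H) (flip_mod X)
        (hom_mod (flip_Lie X) (triv_mod (flip l))) _ _ _ _ _ id id id) G => //.
      by move=> x h'; apply: (@homE k X k^o).
    apply: (@form_deg k (flip l) (flip_Lie X) jm _ n z (f z) (- m) w G').
    + by move=> x m' w' Dw' m1; apply: (jmD _ _ _ Dw'); rewrite eqr_oppLR.
    + by rewrite /= /flipD opprK.
    + by move: nm; rewrite NegzE eqr_opp addrC subr_eq0.
(* By [BD] only the opposite degree of [s] contributes; there both orders give [b0], up to symmetry,
   or the same value of [bp]. *)
have sym0 s : [/\ forall a, f s (e0 a) = f (e0 a) s, forall x, f s (ep x) = f (ep x) s &
    forall y, f s (em y) = f (em y) s].
  have lin (t : X) : linear (fun s => f t s : k^o) by apply: hom_lin.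
  have lin' (t : X) : linear (fun s => f s t : k^o) by apply: Bbil.2.
  split=> t.
  - apply: (graded_eq (l_gr X) (lin' _) (lin _)) => n {}s Ds; have [n0|n0] := eqVneq n
      0; last first.
      by rewrite (BD _ _ _ _ Ds (lD_e0 X t)) ?(BD _ _ _ _ (lD_e0 X t) Ds) ?addr0 ?add0r.
    by move: Ds; rewrite n0 => /lD0[b ->]; rewrite !f0 /= !p0e b0_sym.
  - apply: (graded_eq (l_gr X) (lin' _) (lin _)) => n {}s Ds; have [n0|n0] := eqVneq n
      (-1); last first.
      rewrite (BD _ _ _ _ Ds (lD_ep X t)) ?(BD _ _ _ _ (lD_ep X t) Ds) //.
        by rewrite addrC addr_eq0.
      by rewrite addr_eq0.
    by move: Ds; rewrite n0 => /lDm1[b ->]; rewrite fp fm /= ppe pme.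
  - apply: (graded_eq (l_gr X) (lin' _) (lin _)) => n {}s Ds; have [n0|n0] := eqVneq n
      1; last first.
      rewrite (BD _ _ _ _ Ds (lD_em X t)) ?(BD _ _ _ _ (lD_em X t) Ds) //.
        by rewrite addrC subr_eq0.
      by rewrite subr_eq0.
    by move: Ds; rewrite n0 => /lD1[b ->]; rewrite fp fm /= ppe pme.
have sym z : forall w, f z w = f w z.
  apply: (loc_ind (X := X) (K := fun z => forall w, f z w = f w z)) z.
  - split=> [w|c u v Hu Hv w]; first by rewrite (bl0l Bbil) (bl0r Bbil).
    by rewrite (blPl Bbil) (blPr Bbil) Hu Hv.
  - by move=> a w; have [-> _ _] := sym0 w.
  - by move=> a w; have [_ -> _] := sym0 w.
  - by move=> a w; have [_ _ ->] := sym0 w.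
  - move=> x z Hz w; have [_ -> _] := Fo z; have [_ /(_ x z) e _] := Fo w.
    by rewrite Hz e opprK.
  - move=> x z Hz w; have [_ _ ->] := Fo z; have [_ _ /(_ x z) e] := Fo w.
    by rewrite Hz e opprK.
(* Degrees n and m pair only if n + m = 0, so the radical contains the components of its elements.
   It is also stable under the local operators, and transitivity brings a homogeneous element down
   to degree -1, 0 or 1, where [b0] or [bp] is non-degenerate. *)
have nd z : (forall w, f z w = 0) -> z = 0.
  move=> fz; apply: (gr_ext (l_gr X)) => n.
  have fzn w : f (gr_proj (l_gr X) n z) w = 0.
    apply: (l_ind (g := X) (ker_submod (f _))) w => m w Dw.
    have Dn := gr_in (l_gr X) n z.
    have [nm|] := eqVneq (n + m) 0; last exact: BD Dn Dw.
    rewrite -(fz w); clear fz Dn; apply: (l_ind (g := X)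
      (K := fun z => f (gr_proj (l_gr X) n z) w = f z w) _ _ z).
      split=> [|c u v eu ev]; first by rewrite (linP0 (gr_lin _ _)).
      by rewrite (gr_lin (l_gr X) n) !(blPl Bbil) eu ev.
    move=> p {}z Dz; have [pn|pn] := eqVneq p n.
      by rewrite (gr_id _ (n := n)) // -pn.
    rewrite (gr_0 _ Dz pn) (bl0l Bbil) (BD _ _ _ _ Dz Dw) //.
    by move/eqP: nm; rewrite !addr_eq0 => /eqP <-.
  move: (gr_proj _ _ _) (gr_in (l_gr X) n z) fzn => {fz}z.
  have rp x u : (forall w, f u w = 0) -> forall w, f (op x u) w = 0.
    by move=> Hu w; have [_ -> _] := Fo u; rewrite Hu oppr0.
  have rm x u : (forall w, f u w = 0) -> forall w, f (om x u) w = 0.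
    by move=> Hu w; have [_ _ ->] := Fo u; rewrite Hu oppr0.
  case: n => [[|n]|n].
  - move=> /lD0[a ->] fz; rewrite (b0_nd.1 a) ?(linP0 (e0_lin X)) // => b.
    by have := fz (e0 b); rewrite f0 /= p0e.
  - elim: n z => [|n IH] z Dz fz; last first.
      apply: l_trp (Dz) _ => y; apply: IH; last exact: rm.
      by have := lD_om y Dz; rewrite -addn1 PoszD addrK.
    case/lD1: Dz fz => a -> fz; rewrite (bp_nd.1 a) ?(linP0 (ep_lin X)) // => b.
    by have := fz (em b); rewrite fp /= pme.
  - rewrite NegzE; elim: n z => [|n IH] z Dz fz; last first.
      apply: l_trm (Dz) _ => y; apply: IH; last exact: rp.
      by have := lD_op y Dz; rewrite -[n.+2]addn1 PoszD opprD subrK.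
    case/lDm1: Dz fz => a -> fz; rewrite (bp_nd.2 a) ?(linP0 (em_lin X)) // => b.
    by have := fz (ep b); rewrite fm /= ppe.
exists (fun z w => f z w); split=> //.
  by split=> // w fw; apply: nd => z; rewrite sym.
split=> //.
- by move=> a b; rewrite f0 /= p0e.
- by move=> a b; rewrite fp /= pme.
- by split=> s z; have [] := Fo z.
Qed.

(** Operators that are skew for a form are closed under commutators, so skewness of the local ones
    is enough. *)
Lemma form_invariant (br : X -> X -> X) (B : X -> X -> k) :
  is_lie_bracket br -> is_bilinear_form B ->
  (forall a z, br (e0 a) z = o0 a z) -> (forall x z, br (ep x) z = op x z) ->
  (forall y z, br (em y) z = om y z) ->
  (forall a z w, B (o0 a z) w = - B z (o0 a w)) ->
  (forall x z w, B (op x z) w = - B z (op x w)) ->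
  (forall y z w, B (om y z) w = - B z (om y w)) ->
  forall u z w, B (br u z) w = - B z (br u w).
Proof.
move=> [bil _ jac] Bbil b0e bpe bme B0 Bp Bm.
have B' : is_bilinear (B : _ -> _ -> k^o) := Bbil.
have jac' a b c : br (br a b) c = br a (br b c) - br b (br a c) by rewrite jac addrK.
apply: (loc_ind (X := X) (K := fun u => forall z w, B (br u z) w = - B z (br u w))).
- split=> [z w|c u v Hu Hv z w].
    by rewrite !(bl0l bil) (bl0l B') (bl0r B') oppr0.
  by rewrite !(blPl bil) (blPl B') (blPr B') Hu Hv opprD scalerN.
- by move=> a z w; rewrite !b0e.
- by move=> a z w; rewrite !bpe.
- by move=> a z w; rewrite !bme.
- move=> x u Hu z w; rewrite -(bpe x u) !jac' !bpe (blBl B') (blBr B').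
  by rewrite Bp !Hu Bp !opprK; zmod.
- move=> x u Hu z w; rewrite -(bme x u) !jac' !bme (blBl B') (blBr B').
  by rewrite Bm !Hu Bm !opprK; zmod.
Qed.
End Form.

(** * The pairing between two extensions *)

Section Pairing.
Variables (k : fieldType) (l : locLie k) (E : gradedMod l) (E' : gradedMod (flip l)).
Variable b : gU E -> gU E' -> k.
Hypotheses (b_bil : is_bilinear_form b) (b_nd : is_nondegenerate b)
  (b_inv : forall a u w, b (gpi a u) w = - b u (gpi (a : lg (flip l)) w)).
Let b' : is_bilinear (b : _ -> _ -> k^o) := b_bil.

Fact unflip_om_op (x : lV l) (y : lW l) (z : E') :
  @op k (flip l) E' y (@om k (flip l) E' x z) =
  @om k (flip l) E' x (@op k (flip l) E' y z) - o0 (lF x y : lg (flip l)) z.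
Proof. by rewrite (@op_om k (flip l)) /= (blNl (o0_bil E')). Qed.

(** [flip_mod E'] would live over [flip (flip l)], whose [lF] carries two signs and is not
    convertible to that of [l]. *)
Definition unflip_mod : locmod l :=
  @LocMod k l E' (@o0 k (flip l) E') (@om k (flip l) E') (@op k (flip l) E')
    (o0_bil E') (om_bil E') (op_bil E') (@o0_br _ _ E') (@o0_om _ _ E') (@o0_op _ _ E')
    unflip_om_op.

Let H := hom_mod unflip_mod (triv_mod l).

(** [mod_rec] with the dual of [E'] as target. Transitivity there is again generation: a functional
    at index n + 1 is supported in degree n + 1 of [E'], and if V_-1 kills it, it vanishes on all
    [op y w], which span that degree. *)
Lemma pairing_ex : exists B : E -> E' -> k,
  [/\ is_bilinear_form B, is_nondegenerate B,
     forall u w, B (gi u) (gi w) = b u w,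
     forall n m u w, gD n u -> gD m w -> n != m -> B u w = 0 &
     [/\ forall a u w, B (o0 a u) w = - B u (o0 (a : lg (flip l)) w),
       forall x u w, B (op x u) w = - B u (om (x : lW (flip l)) w) &
       forall y u w, B (om y u) w = - B u (op (y : lV (flip l)) w)]].
Proof.
have [p [lp pe pD]] := component_ex (g_gr E') (gi_lin E') (@gi_inj _ _ E') (gD_gi E')
  (@gD0 _ _ E').
have lj u : linear (fun w => b u (p w) : k^o) by apply: comp_lin lp; apply: b'.1.
pose j u : H := homL (lj u).
have Lj : linear j by move=> c x x'; apply: homE => z; apply: (blPl b').
have p_o0 a w : p (o0 (a : lg (flip l)) w) = gpi (a : lg (flip l)) (p w).
  have inj u v : gi u = gi v :> E' -> u = v.
    move=> euv; apply/eqP; rewrite -subr_eq0; apply/eqP/(@gi_inj _ _ E').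
    by rewrite (linPB (gi_lin E')) euv subrr.
  have pi_lin (a' : lg (flip l)) : linear (gpi (g := E') a').
    by move=> c u v; apply: inj; rewrite (gi_lin E') -!gi_eqv (gi_lin E') (o0_lin (M :=
      E')).
  apply: (graded_eq (g_gr E') (f := fun w => p (o0 (a : lg (flip l)) w))
     (h := fun w => gpi (a : lg (flip l)) (p w))).
  - exact: comp_lin (o0_lin (M := E') a).
  - exact: comp_lin lp.
  move=> n {}w Dw; have [n0|n0] := eqVneq n 0%N.
    by move: Dw; rewrite n0 => /gD0[v ->]; rewrite gi_eqv !pe.
  by rewrite (pD _ _ (gD_o0 _ Dw) n0) (pD _ _ Dw n0) (linP0 (pi_lin a)).
(* V_-1 raises the index in [E'], so its image has no lowest component; hence it kills the
   functionals [j u]. *)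
have p_op y w : p (op (y : lV (flip l)) w) = 0.
  apply: (graded_eq (g_gr E') (f := fun w => p (op (y : lV (flip l)) w)) (h := fun w =>
    0)).
  - exact: comp_lin (op_lin (M := E') y).
  - by move=> c u v; rewrite scaler0 addr0.
  by move=> n {}w Dw; rewrite (pD _ _ (gD_op _ Dw)).
have j_eqv a u : o0 a (j u) = j (gpi a u).
  by apply: homE => z; rewrite /= sub0r p_o0 b_inv.
have j_om y u : om y (j u) = 0.
  by apply: homE => z; rewrite /= sub0r p_op (bl0r b') oppr0.
have deg n z (h : H) m w : gen (@gi _ _ E) j n z h -> gD m w -> m != n -> h w = 0.
  move=> G; elim: G m w => {n z h}.
  - by move=> u m w Dw m0; rewrite /= (pD _ _ Dw m0) (bl0r b').
  - move=> n x z h _ IH m w Dw mn; rewrite /= sub0r.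
    case: m Dw mn => [|m] Dw mn.
      by have [v ->] := gD0 Dw; rewrite gi_om (linP0 (hom_lin h)) oppr0.
    by rewrite (IH m) ?oppr0 //; apply: gD_om.
  - by move=> n c z h z' h' _ IH _ IH' m w Dw mn; rewrite homDE homZE (IH m) // (IH' m)
      // scaler0 addr0.
have tr n (h : H) : gen (@gi _ _ E) j n.+1 0 h -> (forall y, om y h = 0) -> h = 0.
  move=> G omh; apply: homE => w; rewrite hom0E.
  have hop (y : lV (flip l)) u : h (op y u) = 0.
    have := congr1 (fun h : H => h u) (omh y); rewrite /= sub0r => /eqP.
    by rewrite oppr_eq0 => /eqP.
  apply: (g_ind (g := E') (ker_submod h)) w => m w Dw.
  have [mn|mn] := eqVneq m n.+1; last exact: deg G Dw mn.
  by move: Dw; rewrite mn; apply: (g_gen (ker_submod h)) => y u _; apply: hop.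
have [f [fi F0 Fp Fm FD]] := mod_rec Lj j_eqv j_om tr.
have Fo z : [/\ forall a w, f (o0 a z) w = - f z (o0 (a : lg (flip l)) w),
    forall x w, f (op x z) w = - f z (om (x : lW (flip l)) w) &
    forall y w, f (om y z) w = - f z (op (y : lV (flip l)) w)].
  by split=> s w; rewrite ?F0 ?Fp ?Fm /= sub0r.
have Bbil : is_bilinear (fun z w => f z w).
  by split=> [z|w]; [apply: hom_lin|move=> c u v; rewrite (hom_lin f)].
have BD n m u w : gD n u -> gD m w -> n != m -> f u w = 0.
  by move=> Du Dw nm; apply: deg (FD _ _ Du) Dw _; rewrite eq_sym.
have ndl z : (forall w, f z w = 0) -> z = 0.
  move=> fz; apply: (gr_ext (g_gr E)) => n.
  have fzn w : f (gr_proj (g_gr E) n z) w = 0.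
    apply: (g_ind (g := E') (ker_submod (f _))) w => m w Dw.
    have Dn := gr_in (g_gr E) n z.
    have [nm|] := eqVneq n m; last exact: BD Dn Dw.
    rewrite -(fz w); clear fz Dn; apply: (g_ind (g := E)
      (K := fun z => f (gr_proj (g_gr E) n z) w = f z w) _ _ z).
      split=> [|c u v eu ev]; first by rewrite (linP0 (gr_lin _ _)).
      by rewrite (gr_lin (g_gr E) n) !(blPl Bbil) eu ev.
    move=> q {}z Dz; have [pn|pn] := eqVneq q n.
      by rewrite (gr_id _ (n := n)) // -pn.
    by rewrite (gr_0 _ Dz pn) (bl0l Bbil) (BD _ _ _ _ Dz Dw) // -nm.
  move: (gr_proj _ _ _) (gr_in (g_gr E) n z) fzn => {fz}z.
  elim: n z => [|n IH] z Dz fz; last first.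
    apply: g_tr (Dz) _ => y; apply: IH => [|w]; first exact: gD_om.
    by have [_ _ ->] := Fo z; rewrite fz oppr0.
  have [u zu] := gD0 Dz; rewrite zu (b_nd.1 u) ?(linP0 (gi_lin E)) // => v.
  by have := fz (gi v); rewrite zu fi /= pe.
have ndr w : (forall z, f z w = 0) -> w = 0.
  move=> fz; apply: (gr_ext (g_gr E')) => n.
  have fzn z : f z (gr_proj (g_gr E') n w) = 0.
    apply: (g_ind (g := E) (K := fun z => f z (gr_proj (g_gr E') n w) = 0) _ _ z).
      split=> [|c u v eu ev]; first by rewrite (bl0l Bbil).
      by rewrite (blPl Bbil) eu ev scaler0 addr0.
    move=> m {}z Dz.
    have Dn := gr_in (g_gr E') n w.
    have [nm|] := eqVneq m n; last exact: BD Dz Dn.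
    rewrite -(fz z); clear fz Dn; apply: (g_ind (g := E')
      (K := fun w => f z (gr_proj (g_gr E') n w) = f z w) _ _ w).
      split=> [|c u v eu ev]; first by rewrite (linP0 (gr_lin _ _)).
      by rewrite (gr_lin (g_gr E') n) !(blPr Bbil) eu ev.
    move=> q {}w Dw; have [pn|pn] := eqVneq q n.
      by rewrite (gr_id _ (n := n)) // -pn.
    by rewrite (gr_0 _ Dw pn) (bl0r Bbil) (BD _ _ _ _ Dz Dw) // nm eq_sym.
  move: (gr_proj _ _ _) (gr_in (g_gr E') n w) fzn => {fz}w.
  elim: n w => [|n IH] w Dw fz; last first.
    apply: g_tr (Dw) _ => x; apply: IH => [|z]; first exact: gD_om.
    by have [_ /(_ x w) e _] := Fo z; rewrite -[LHS]opprK -e fz oppr0.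
  have [u wu] := gD0 Dw; rewrite wu (b_nd.2 u) ?(linP0 (gi_lin E')) // => v.
  by have := fz (gi v); rewrite wu fi /= pe.
exists (fun z w => f z w); split=> //.
- by move=> u w; rewrite fi /= pe.
- by split=> s z; have [] := Fo z.
Qed.

End Pairing.

(** * Prolongations inside the iterated function spaces *)

Section Span.
Variables (k : fieldType) (V A B : lmodType k) (f : V -> A -> B) (S : submod A).

Lemma tensor_im_gen v u : S u -> tensor_im f S (f v u).
Proof. by move=> Su K [_ KX]; apply: KX; exists v => //; exists u. Qed.

Lemma tensor_im_ind (K : B -> Prop) : is_submod K ->
  (forall v u, S u -> K (f v u)) -> forall b, tensor_im f S b -> K b.
Proof.
move=> Ks Kf b; apply; split=> // _ [v _ [u Su <-]]; exact: Kf.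
Qed.
End Span.

(* Covers both the pieces V_n, n >= 1, of the Lie algebra (with U = V) and the
   pieces of an extension; they differ by the sign of [F] and by [r] in degree 0. *)
Section Prolong.
Variables (k : fieldType) (g : lieData k) (V W U : lmodType k).
Variables (rV : g -> V -> V) (rW : g -> W -> W) (F : V -> W -> g) (pi : g -> U -> U).
Hypotheses (hW : is_rep rW) (hU : is_rep pi) (hF : is_bilinear F).
Hypothesis F_eqv : forall a v w, ⁅a, F v w⁆ = F (rV a v) w + F v (rW a w).
Variable r : forall n, V -> iterhom W U n -> iterhom W U n.+1.
Variable S : forall n, submod (iterhom W U n).
Hypotheses
  (r0_lin1 : forall u eta, linear (fun x => r (n := 0) x u eta))
  (r0_lin2 : forall x eta, linear (fun u => r (n := 0) x u eta))
  (r0_lin3 : forall x u, linear (r (n := 0) x u))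
  (r0_eqv : forall a x u eta, pi a (r (n := 0) x u eta) =
     r (n := 0) (rV a x) u eta + r (n := 0) x (pi a u) eta + r (n := 0) x u (rW a eta)).
Hypothesis rS : forall n x (u : iterhom W U n.+1) eta,
  r x u eta = iterrep rW pi (F x eta) u + r x (u eta).
Hypothesis S0 : forall u, S 0 u.
Hypothesis SS : forall n u, S n.+1 u <-> tensor_im (@r n) (S n) u.

Local Notation rep n := (@iterrep k g W rW U pi n).

Lemma iterrep_linr n a : linear (rep n a).
Proof.
elim: n a => [|n IH] a; first exact: (hU.1.1 a).
move=> c f h; apply: funext => eta; rewrite /=.
change (rep n a (c *: f eta + h eta) - (c *: f (rW a eta) + h (rW a eta)) =
  c *: (rep n a (f eta) - f (rW a eta)) + (rep n a (h eta) - h (rW a eta))).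
by rewrite IH scalerBr; zmod.
Qed.

Lemma r_linr n x : linear (@r n x).
Proof.
elim: n => [|n IH] c f h; apply: funext => eta; first exact: r0_lin2.
change (r x (c *: f + h) eta = c *: r x f eta + r x h eta).
rewrite !rS iterrep_linr.
change ((c *: f + h) eta) with (c *: f eta + h eta).
by rewrite IH !scalerDr; zmod.
Qed.

(** These facts form one induction: equivariance of [r] at n + 1 needs [good_br] there, which needs
    linearity of the elements of [S] in their argument. They are restricted to [S n] because the
    ambient space contains non-linear functions. *)
Record good (n : nat) : Prop := Good {
  good_rep : forall a u, S n u -> S n (rep n a u);
  good_linl : forall u, S n u -> linear (fun a => rep n a u);
  good_br : forall a b u, S n u -> rep n ⁅a, b⁆ u = rep n a (rep n b u) - rep n b (rep n
    a u);
  good_ev : forall u, S n.+1 u -> linear (u : W -> iterhom W U n) /\ forall eta, S n (u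
    eta);
  good_rl : forall u, S n u -> linear (fun x => @r n x u);
  good_eqv : forall a x u, S n u ->
    rep n.+1 a (@r n x u) = @r n (rV a x) u + @r n x (rep n a u)
}.

Lemma good_evS n : (forall x u, S n u -> linear (@r n x u : W -> iterhom W U n)) ->
  (forall x u eta, S n u -> S n (@r n x u eta)) ->
  forall u, S n.+1 u -> linear (u : W -> iterhom W U n) /\ forall eta, S n (u eta).
Proof.
move=> H1 H2 u /SS Tu; move: u Tu.
apply: (tensor_im_ind (K := fun u => linear (u : W -> iterhom W U n) /\
  forall eta, S n (u eta))) => [|v u Su]; last first.
  by split; [apply: H1|move=> eta; apply: H2].
split=> [|c f h [lf Sf] [lh Sh]].
  split=> [c a b|eta]; last exact: submod0.
  change (0 = c *: (0 : iterhom W U n) + 0); by rewrite scaler0 addr0.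
split=> [d a b|eta]; last exact: (submodP c (Sf eta) (Sh eta)).
change (c *: f (d *: a + b) + h (d *: a + b) =
  d *: (c *: f a + h a) + (c *: f b + h b)).
by rewrite lf lh !scalerDr !scalerA [d * c]mulrC; zmod.
Qed.

Lemma good_all n : good n.
Proof.
elim: n => [|n [rp ll br ev rl eqv]].
  split=> //.
  - by move=> u _; apply: hU.1.2.
  - by move=> a b u _; apply: hU.2.
  - exact: good_evS.
  - by move=> u _ c a b; apply: funext => eta; apply: r0_lin1.
  - move=> a x u _; apply: funext => eta.
    change (pi a (r (n := 0) x u eta) - r (n := 0) x u (rW a eta) =
      r (n := 0) (rV a x) u eta + r (n := 0) x (pi a u) eta).
    by rewrite r0_eqv; zmod.
have rp1 a u : S n.+1 u -> S n.+1 (rep n.+1 a u).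
  move=> /SS Su; apply/SS; move: u Su; apply: tensor_im_ind => [|v u Su].
    split=> [|c f h Hf Hh]; first by rewrite (linP0 (iterrep_linr _)); apply: submod0.
    by rewrite (iterrep_linr (n := n.+1)); apply: submodP.
  by rewrite eqv //; apply: submodD; apply: tensor_im_gen => //; apply: rp.
have ll1 u : S n.+1 u -> linear (fun a => rep n.+1 a u).
  move=> /ev[lu Su] c a b; apply: funext => eta.
  change (rep n (c *: a + b) (u eta) - u (rW (c *: a + b) eta) =
    c *: (rep n a (u eta) - u (rW a eta)) + (rep n b (u eta) - u (rW b eta))).
  by rewrite (ll _ (Su eta)) (blPl hW.1) lu scalerBr; zmod.
have br1 a b u : S n.+1 u ->
    rep n.+1 ⁅a, b⁆ u = rep n.+1 a (rep n.+1 b u) - rep n.+1 b (rep n.+1 a u).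
  move=> /ev[lu Su]; apply: funext => eta.
  change (rep n ⁅a, b⁆ (u eta) - u (rW ⁅a, b⁆ eta) =
    (rep n a (rep n b (u eta) - u (rW b eta)) - (rep n b (u (rW a eta)) - u (rW b (rW a
      eta)))) -
    (rep n b (rep n a (u eta) - u (rW a eta)) - (rep n a (u (rW b eta)) - u (rW a (rW b
      eta))))).
  by rewrite br // hW.2 (linPB lu) !(linPB (iterrep_linr _)); zmod.
have rl1 u : S n.+1 u -> linear (fun x => @r n.+1 x u).
  move=> Su; have [lu Su'] := ev _ Su; move=> c a b; apply: funext => eta.
  change (r (c *: a + b) u eta = c *: r a u eta + r b u eta).
  by rewrite !rS [in RHS]scalerDr (blPl hF) (ll1 _ Su) (rl _ (Su' eta)); zmod.
split=> //.
- apply: good_evS => x u => [|eta] Su; have [lu Su'] := ev _ Su.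
    move=> c a b; rewrite !rS [in RHS]scalerDr (blPr hF) (ll1 _ Su) lu r_linr; zmod.
  rewrite rS; apply: submodD; first exact: rp1.
  by apply/SS; apply: (tensor_im_gen (f := @r n)).
- move=> a x u Su; have [lu Su'] := ev _ Su; apply: funext => eta.
  change (rep n.+1 a (r x u eta) - r x u (rW a eta) =
    r (rV a x) u eta + r x (rep n.+1 a u) eta).
  rewrite !rS (linPD (iterrep_linr _)) eqv //.
  change (rep n.+1 a u eta) with (rep n a (u eta) - u (rW a eta)).
  rewrite (linPB (r_linr _)).
  (* Equivariance of [F] splits the action of [a, F x eta] into the terms where [a] acts on [x] and
     on [eta]. *)
  have := br1 a (F x eta) u Su; rewrite F_eqv (linPD (ll1 _ Su)) => /eqP.
  rewrite eq_sym subr_eq => /eqP ->; zmod.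
Qed.

End Prolong.

(** * Direct sums are graded *)

Section DsumGraded.
Variables (k : fieldType) (I : eqType) (A : I -> lmodType k) (S : forall i, submod (A i)).
Implicit Types z w : dsum S.

Lemma dsumNE z i : (- z) i = - z i.
Proof. by rewrite -scaleN1r dsumZE scaleN1r. Qed.
Lemma dsumPE c z w i : (c *: z + w) i = c *: z i + w i.
Proof. by rewrite dsumDE dsumZE. Qed.
Lemma dsum_sumE (J : Type) (s : seq J) (F : J -> dsum S) i :
  (\sum_(j <- s) F j) i = \sum_(j <- s) F j i.
Proof.
elim: s => [|j s IH]; first by rewrite !big_nil.
by rewrite !big_cons dsumDE IH.
Qed.

Definition homogS (n : I) : submod (dsum S).
Proof.
refine (@Submod _ (dsum S) (fun z => homog z n) _ _) => [m _ //|c u v hu hv m mn].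
by rewrite dsumPE hu // hv // scaler0 addr0.
Defined.

Lemma homog_eq n z w : homog z n -> homog w n -> z n = w n -> z = w.
Proof.
move=> hz hw e; apply: dsum_ext => i; have [->//|ni] := eqVneq i n.
by rewrite hz // hw.
Qed.

(** The summands have different types, so [u] is transported along a decided equality of indices;
    [eq_axiomK] removes the transport at [n] itself. *)
Lemma dsum_single n (u : A n) : S n u -> exists z, homog z n /\ z n = u.
Proof.
move=> Su; pose c m := match n =P m with
  | ReflectT e => eq_rect n (fun m => A m : Type) u m e | ReflectF _ => 0 end.
have cS m : S m (c m).
  by rewrite /c; case: eqP => [e|_]; [case: m / e|apply: submod0].
have cf : exists s : seq I, forall i, i \notin s -> c i = 0.
  exists [:: n] => i; rewrite inE /c; case: eqP => // e /negP[].
  by apply/eqP; rewrite e.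
exists (DSum cS cf); split=> [m mn|] /=; rewrite /c; case: eqP => //.
  by move=> e; case/negP: mn; apply/eqP; rewrite e.
by move=> e; rewrite eq_axiomK.
Qed.

Fact dproj_in n z i : S i (if i == n then z i else 0).
Proof. by case: ifP => _; [apply: dsum_in|apply: submod0]. Qed.
Fact dproj_fin n z : exists s : seq I, forall i, i \notin s -> (if i == n then z i else
  0) = 0.
Proof. by exists [:: n] => i; rewrite inE => /negbTE->. Qed.
Definition dproj n z : dsum S := DSum (dproj_in n z) (dproj_fin n z).

Lemma dprojE n z i : dproj n z i = if i == n then z i else 0. Proof. by []. Qed.

Lemma dproj_lin n : linear (dproj n).
Proof.
move=> c u v; apply: dsum_ext => i; rewrite dsumPE !dprojE.
by case: ifP => _; rewrite ?dsumPE // scaler0 addr0.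
Qed.

Lemma dproj_homog n z : homog (dproj n z) n.
Proof. by move=> m /negbTE mn; rewrite dprojE mn. Qed.

Lemma sum_support (V : zmodType) (F : I -> V) (s t : seq I) : uniq s -> uniq t ->
  (forall i, i \notin s -> F i = 0) -> (forall i, i \notin t -> F i = 0) ->
  \sum_(i <- s) F i = \sum_(i <- t) F i.
Proof.
move=> us ut Fs Ft.
rewrite (bigID (fun i => i \in t)) /= [X in _ + X]big1 ?addr0; last by move=> i /Ft.
rewrite [RHS](bigID (fun i => i \in s)) /= [X in _ + X]big1 ?addr0; last by move=> i /Fs.
rewrite -big_filter -[RHS]big_filter; apply: perm_big; apply: uniq_perm.
- exact: filter_uniq.
- exact: filter_uniq.
by move=> i; rewrite !mem_filter andbC.
Qed.

Lemma dsum_supp z : exists s : seq I, uniq s /\ forall i, i \notin s -> z i = 0.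
Proof.
have [s zs] := dsum_fin z; exists (undup s); rewrite undup_uniq; split=> // i.
by rewrite mem_undup; apply: zs.
Qed.

Lemma dsum_decomp z (s : seq I) : uniq s -> (forall i, i \notin s -> z i = 0) ->
  z = \sum_(i <- s) dproj i z.
Proof.
move=> us zs; apply: dsum_ext => i; rewrite dsum_sumE.
have [si|si] := boolP (i \in s); last first.
  rewrite (zs _ si) big_seq big1 // => j js; rewrite dprojE.
  by case: eqP => // ij; rewrite ij js in si.
rewrite (bigD1_seq i) //= eqxx big1 ?addr0 // => j ji.
by rewrite eq_sym (negbTE ji).
Qed.

Lemma dsum_glue : gluable homogS.
Proof.
move=> H phi phiP.
have phi0 n : phi n 0 = 0.
  have := phiP n (-1) 0 0 (submod0 _) (submod0 _).
  by rewrite scaler0 addr0 scaleN1r addNr.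
have psupp z i : z i = 0 -> phi i (dproj i z) = 0.
  move=> zi; suff -> : dproj i z = 0 by [].
  by apply: dsum_ext => j; rewrite dprojE; case: eqP => // ->.
pose s z := projT1 (cid (dsum_supp z)).
have sP z : uniq (s z) /\ forall i, i \notin s z -> z i = 0 by apply: (projT2 (cid
  (dsum_supp z))).
pose f z := \sum_(i <- s z) phi i (dproj i z).
(* The support [s z] is an arbitrary choice for each [z]; linearity compares three elements on a
   common support. *)
have fE z t : uniq t -> (forall i, i \notin t -> z i = 0) -> f z = \sum_(i <- t) phi i
  (dproj i z).
  move=> ut zt; have [us zs] := sP z.
  by apply: sum_support => // i ?; apply: psupp; auto.
exists f; split.
  move=> c u v; pose t := undup (s u ++ s v).
  have ut : uniq t by apply: undup_uniq.
  have [_ us] := sP u; have [_ vs] := sP v.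
  have tu i : i \notin t -> u i = 0 /\ v i = 0.
    by rewrite mem_undup mem_cat => /norP[/us-> /vs->].
  rewrite !(fE _ t) //; try by move=> i /tu[].
    rewrite scaler_sumr -big_split; apply: eq_bigr => i _.
    by rewrite dproj_lin phiP //; apply: dproj_homog.
  by move=> i /tu[ui vi]; rewrite dsumPE ui vi scaler0 addr0.
move=> n z hz; rewrite (fE _ [:: n]) //.
  by rewrite big_seq1; congr phi; apply: homog_eq (@dproj_homog n z) hz _; rewrite
    dprojE eqxx.
by move=> i; rewrite inE => /hz.
Qed.

Lemma dsum_spans : spans homogS.
Proof.
move=> K [K0 KP] Kh z; have [s [us zs]] := dsum_supp z.
rewrite (dsum_decomp us zs); elim/big_ind: _ => // [u v Ku Kv|i _].
  by rewrite -[u]scale1r; apply: KP.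
exact/Kh/dproj_homog.
Qed.

Definition dsum_graded : graded homogS.
Proof.
refine (@Graded _ _ _ homogS dsum_glue dsum_spans dproj dproj_lin dproj_homog _ _ _).
- move=> n z hz; apply: homog_eq (@dproj_homog n z) hz _.
  by rewrite dprojE eqxx.
- move=> n m z hz mn; apply: dsum_ext => i; rewrite dprojE.
  by case: eqP => // ->; rewrite hz // eq_sym.
- move=> z pz; apply: dsum_ext => i.
  by have := congr1 (fun z : dsum S => z i) (pz i); rewrite /= eqxx.
Defined.

End DsumGraded.

(** * Extensions as graded modules *)

Section ExtInstance.
Variables (k : fieldType) (l : locLie k) (U : lmodType k) (pi : lg l -> U -> U).
Hypothesis hpi : is_rep pi.

Local Notation rep n := (@iterrep k (lg l) (lW l) (@ls k l) U pi n).
Local Notation r n := (@ext_r k (lg l) (lV l) (lW l) (@ls k l) (@lF k l) U pi n).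
Local Notation S := (@ext_piece k (lg l) (lV l) (lW l) (@ls k l) (@lF k l) U pi).

(** The bracket [y, x], which is what the recursion for r on an extension contains. *)
Let F' (x : lV l) (y : lW l) : lg l := - lF x y.

Fact nF_bil : is_bilinear F'.
Proof.
split=> u c v w; rewrite /F'; first by rewrite (blPr (lF_bil l)) opprD scalerN.
by rewrite (blPl (lF_bil l)) opprD scalerN.
Qed.

Fact nF_eqv a v w : ⁅a, F' v w⁆ = F' (lr a v) w + F' v (ls a w).
Proof. by rewrite /F' (blNr (br_bil (lg_lie l))) lF_eqv opprD. Qed.

Fact ext_r0_lin1 u eta : linear (fun x => r 0%N x u eta).
Proof.
move=> c x x'.
change (pi (F' (c *: x + x') eta) u = c *: pi (F' x eta) u + pi (F' x' eta) u).
by rewrite (blPl nF_bil) (blPl hpi.1).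
Qed.
Fact ext_r0_lin2 x eta : linear (fun u => r 0%N x u eta).
Proof. by move=> c u u'; rewrite /= (blPr hpi.1). Qed.
Fact ext_r0_lin3 x u : linear (r 0%N x u).
Proof.
move=> c u1 u2.
change (pi (F' x (c *: u1 + u2)) u = c *: pi (F' x u1) u + pi (F' x u2) u).
by rewrite (blPr nF_bil) (blPl hpi.1).
Qed.
Fact ext_r0_eqv a x u eta : pi a (r 0%N x u eta) =
     r 0%N (lr a x) u eta + r 0%N x (pi a u) eta + r 0%N x u (ls a eta).
Proof.
rewrite /= -/(F' x eta) -/(F' (lr a x) eta) -/(F' x (ls a eta)).
have := hpi.2 a (F' x eta) u; rewrite nF_eqv (blDl hpi.1) => /eqP.
by rewrite eq_sym subr_eq => /eqP ->; zmod.
Qed.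
Fact ext_rS n x (u : iterhom (lW l) U n.+1) eta :
  r n.+1 x u eta = rep n.+1 (F' x eta) u + r n x (u eta).
Proof. by []. Qed.
Fact ext_S0 u : S 0%N u. Proof. by []. Qed.
Fact ext_SS n u : S n.+1 u <-> tensor_im (r n) (S n) u. Proof. by []. Qed.

Let good n := @good_all k (lg l) (lV l) (lW l) U (@lr k l) (@ls k l) F' pi
  (ls_rep l) hpi nF_bil nF_eqv (fun n => r n) S ext_r0_lin1 ext_r0_lin2 ext_r0_lin3
    ext_r0_eqv
  ext_rS ext_S0 ext_SS n.
Let r_lin n x := @r_linr k (lg l) (lV l) (lW l) U (@ls k l) F' pi hpi (fun n => r n)
  ext_r0_lin2 ext_rS n x.
Let rep_lin n a := @iterrep_linr k (lg l) (lW l) U (@ls k l) pi hpi n a.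

Local Notation Ex := (dsum S).
Implicit Types z : Ex.

Fact ext_o0_in a z n : S n (rep n a (z n)).
Proof. exact/(good_rep (good n))/dsum_in. Qed.
Fact ext_o0_fin a z : exists s : seq nat, forall n, n \notin s -> rep n a (z n) = 0.
Proof. by have [s zs] := dsum_fin z; exists s => n /zs ->; rewrite (linP0 (rep_lin a)).
  Qed.
Definition ext_o0 a z : Ex := DSum (ext_o0_in a z) (ext_o0_fin a z).

Definition ext_op_comp x z n : iterhom (lW l) U n :=
  match n with 0 => 0 | m.+1 => r m x (z m) end.
Fact ext_op_in x z n : S n (ext_op_comp x z n).
Proof. by case: n => [|n] //=; apply: (tensor_im_gen (f := r n)); apply: dsum_in. Qed.
Fact ext_op_fin x z : exists s : seq nat, forall n, n \notin s -> ext_op_comp x z n = 0.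
Proof.
have [s zs] := dsum_fin z; exists (map succn s) => -[|n] //=.
by rewrite mem_map => [/zs ->|? ? []] //; rewrite (linP0 (r_lin x)).
Qed.
Definition ext_op x z : Ex := DSum (ext_op_in x z) (ext_op_fin x z).

Fact ext_om_in y z n : S n ((z n.+1 : lW l -> _) y).
Proof. exact/(good_ev (good n) (dsum_in z n.+1)).2. Qed.
Fact ext_om_fin y z : exists s : seq nat, forall n, n \notin s -> (z n.+1 : lW l -> _) y
  = 0.
Proof.
have [s zs] := dsum_fin z; exists (map predn s) => n ns.
rewrite zs //; apply: contra ns => ns; apply/mapP; by exists n.+1.
Qed.
Definition ext_om y z : Ex := DSum (ext_om_in y z) (ext_om_fin y z).

Lemma ext_o0E a z n : ext_o0 a z n = rep n a (z n). Proof. by []. Qed.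
Lemma ext_op0 x z : ext_op x z 0%N = 0. Proof. by []. Qed.
Lemma ext_opS x z n : ext_op x z n.+1 = r n x (z n). Proof. by []. Qed.
Lemma ext_omE y z n : ext_om y z n = (z n.+1 : lW l -> _) y. Proof. by []. Qed.

Fact ext_o0_bil : is_bilinear ext_o0.
Proof.
split=> [a c z z'|z c a b]; apply: dsum_ext => n; rewrite dsumPE !ext_o0E.
  by rewrite dsumPE rep_lin.
by rewrite (good_linl (good n)) //; apply: dsum_in.
Qed.
Fact ext_op_bil : is_bilinear ext_op.
Proof.
split=> [a c z z'|z c a b]; apply: dsum_ext => -[|n]; rewrite dsumPE ?ext_op0 ?scaler0
  ?addr0 // !ext_opS.
  by rewrite dsumPE r_lin.
by rewrite (good_rl (good n)) //; apply: dsum_in.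
Qed.
Fact ext_om_bil : is_bilinear ext_om.
Proof.
split=> [a c z z'|z c a b]; apply: dsum_ext => n; rewrite dsumPE !ext_omE.
  by rewrite dsumPE.
exact: (good_ev (good n) (dsum_in z n.+1)).1.
Qed.
Fact ext_o0_br a b z : ext_o0 ⁅a, b⁆ z = ext_o0 a (ext_o0 b z) - ext_o0 b (ext_o0 a z).
Proof.
apply: dsum_ext => n; rewrite dsumDE dsumNE !ext_o0E.
by rewrite (good_br (good n)) //; apply: dsum_in.
Qed.
Fact ext_o0_op a x z : ext_o0 a (ext_op x z) = ext_op (lr a x) z + ext_op x (ext_o0 a z).
Proof.
apply: dsum_ext => -[|n]; rewrite dsumDE ext_o0E !(ext_op0, ext_opS).
  by rewrite (linP0 (rep_lin a)) addr0.
by rewrite (good_eqv (good n)) //; apply: dsum_in.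
Qed.
Fact ext_o0_om a x z : ext_o0 a (ext_om x z) = ext_om (ls a x) z + ext_om x (ext_o0 a z).
Proof.
apply: dsum_ext => n; rewrite dsumDE ext_o0E !ext_omE ext_o0E.
change (rep n a ((z n.+1 : lW l -> _) x) =
  (z n.+1 : lW l -> _) (ls a x) + (rep n a ((z n.+1 : lW l -> _) x) - (z n.+1 : lW l ->
    _) (ls a x))).
by zmod.
Qed.
(** Evaluation at [y] unfolds the recursive definition of r, which is this commutation rule; at
    index 0 the term [ext_om y z] is lost under [ext_op], and r_0 has no such term either. *)
Fact ext_om_op x y z : ext_om y (ext_op x z) = ext_op x (ext_om y z) - ext_o0 (lF x y) z.
Proof.
apply: dsum_ext => n; rewrite dsumDE dsumNE ext_o0E ext_omE ext_opS.
have repN u : S n u -> rep n (- lF x y) u = - rep n (lF x y) u.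
  by move=> Su; apply: (linPN (good_linl (good n) Su)).
case: n repN => [|n] repN.
  by rewrite ext_op0 add0r -repN //; apply: dsum_in.
rewrite ext_opS ext_omE ext_rS repN; last exact: dsum_in.
by rewrite addrC.
Qed.

Definition ext_mod : locmod l :=
  LocMod ext_o0_bil ext_op_bil ext_om_bil ext_o0_br ext_o0_op ext_o0_om ext_om_op.

Definition ext_emb_comp (u : U) n : iterhom (lW l) U n :=
  match n with 0 => u | m.+1 => 0 end.
Fact ext_emb_in u n : S n (ext_emb_comp u n).
Proof. by case: n => [|n] //; apply: submod0. Qed.
Fact ext_emb_fin u : exists s : seq nat, forall n, n \notin s -> ext_emb_comp u n = 0.
Proof. by exists [:: 0%N] => -[]. Qed.
Definition ext_emb u : ext_mod := DSum (ext_emb_in u) (ext_emb_fin u).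

Lemma ext_emb0 u : ext_emb u 0%N = u. Proof. by []. Qed.
Lemma ext_embS u n : ext_emb u n.+1 = 0. Proof. by []. Qed.

Fact ext_emb_homog u : homog (ext_emb u) 0%N.
Proof. by case. Qed.

Definition ext_graded : gradedMod l.
Proof.
refine (@GradedMod k l ext_mod U pi ext_emb (@homogS _ _ _ S) _ _ _ _ ext_emb_homog _ _
  _ _ _ _
  (dsum_graded S)).
- move=> c u v; apply: dsum_ext => -[|n]; rewrite dsumPE ?ext_emb0 // !ext_embS.
  by rewrite scaler0 addr0.
- by move=> u /(congr1 (fun z : Ex => z 0%N)).
- move=> a u; apply: dsum_ext => -[|n] //.
  exact: (linP0 (@rep_lin n.+1 a)).
- by move=> y u; apply: dsum_ext => n.
- move=> z hz; exists (z 0%N); apply: (homog_eq (n := 0%N) hz) => //.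
  exact: ext_emb_homog.
- move=> n a z hz m mn; change (rep m a (z m) = 0).
  by rewrite hz //; exact: (linP0 (rep_lin a)).
- move=> n x z hz [|m] mn //; change (r m x (z m) = 0).
  by rewrite hz //; exact: (linP0 (r_lin x)).
- move=> n y z hz m mn; change ((z m.+1 : lW l -> _) y = 0).
  by rewrite hz.
- move=> n z hz omz; apply: (homog_eq hz) => //; apply: funext => y.
  have e : ext_om y z = 0 := omz y.
  by change (ext_om y z n = (0 : Ex) n); rewrite e.
- move=> n K [K0 KP] Kop z hz.
  (* Generation is known in the single component n + 1, whereas [K] concerns the direct sum;
     homogeneous representatives carry it over. *)
  have Kz : exists z', [/\ homog z' n.+1, z' n.+1 = z n.+1 & K z'].
    apply: (tensor_im_ind (f := r n) (S := S n)
      (K := fun u => exists z', [/\ homog z' n.+1, z' n.+1 = u & K z'])); last exact: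
        (dsum_in z n.+1).
      split; first by exists 0.
      move=> c u v [z1 [h1 e1 K1]] [z2 [h2 e2 K2]]; exists (c *: z1 + z2); split.
      + exact: (@submodP _ _ (homogS S n.+1)).
      + by rewrite dsumPE e1 e2.
      + exact: KP.
    move=> x u Su; have [z' [h' e']] := dsum_single Su.
    exists (ext_op x z'); split; last exact: Kop.
    + by move=> [|m] mn //; rewrite ext_opS h' //; exact: (linP0 (r_lin x)).
    + by rewrite ext_opS e'.
  by have [z' [h' e' Kz']] := Kz; rewrite (homog_eq hz h').
Defined.
End ExtInstance.

(** * The graded Lie algebra of a standard pentad *)

Section LiePiece.
Variables (k : fieldType) (l : locLie k).

Local Notation rep n := (@lie_rep k (lg l) (lV l) (lW l) (@lr k l) (@ls k l) n).
Local Notation p n := (@lie_p k (lg l) (lV l) (lW l) (@lr k l) (@ls k l) (@lF k l) n).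
Local Notation ev n := (@lie_ev k (lg l) (lV l) (lW l) (@lF k l) n).
Local Notation S := (@lie_piece k (lg l) (lV l) (lW l) (@lr k l) (@ls k l) (@lF k l)).

(** V_{n+1} sits inside n-fold iterated functions with values in V, so index n of the prolongation
    is degree n + 1. *)
Let r n : lV l -> iterhom (lW l) (lV l) n -> iterhom (lW l) (lV l) n.+1 := p n.+1.
Let T n : submod (iterhom (lW l) (lV l) n) := S n.+1.

Fact lie_r0E x u eta : r (n := 0) x u eta = lr (lF x eta) u - lr (lF u eta) x.
Proof. by []. Qed.
Fact lie_r0_lin1 u eta : linear (fun x => r (n := 0) x u eta).
Proof.
move=> c x x'; rewrite !lie_r0E (blPl (lF_bil l)) (blPl (lr_rep l).1) (blPr (lr_rep l).1).
by rewrite scalerBr; zmod.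
Qed.
Fact lie_r0_lin2 x eta : linear (fun u => r (n := 0) x u eta).
Proof.
move=> c u u'; rewrite !lie_r0E (blPl (lF_bil l)) (blPl (lr_rep l).1) (blPr (lr_rep l).1).
by rewrite scalerBr; zmod.
Qed.
Fact lie_r0_lin3 x u : linear (r (n := 0) x u).
Proof.
move=> c e e'; rewrite !lie_r0E !(blPr (lF_bil l)) !(blPl (lr_rep l).1).
by rewrite scalerBr; zmod.
Qed.
Fact lie_r0_eqv a x u eta : lr a (r (n := 0) x u eta) =
     r (n := 0) (lr a x) u eta + r (n := 0) x (lr a u) eta + r (n := 0) x u (ls a eta).
Proof.
rewrite !lie_r0E (blBr (lr_rep l).1).
have e b y : lr a (lr b y) = lr ⁅a, b⁆ y + lr b (lr a y) by rewrite (lr_rep l).2 subrK.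
by rewrite !e !lF_eqv !(blDl (lr_rep l).1); zmod.
Qed.
Fact lie_rS n x (u : iterhom (lW l) (lV l) n.+1) eta :
  r x u eta = iterrep (@ls k l) (@lr k l) (lF x eta) u + r x (u eta).
Proof. by []. Qed.
Fact lie_T0 u : T 0 u. Proof. by []. Qed.
Fact lie_TS n u : T n.+1 u <-> tensor_im (@r n) (T n) u. Proof. by []. Qed.

Let good n := @good_all k (lg l) (lV l) (lW l) (lV l) (@lr k l) (@ls k l) (@lF k l) (@lr
  k l)
  (ls_rep l) (lr_rep l) (lF_bil l) (@lF_eqv k l) r T lie_r0_lin1 lie_r0_lin2 lie_r0_lin3
    lie_r0_eqv
  lie_rS lie_T0 lie_TS n.

Lemma lrep_linr n a : linear (rep n a).
Proof.
case: n => [|n]; first exact: (br_bil (lg_lie l)).1.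
exact: (@iterrep_linr k (lg l) (lW l) (lV l) (@ls k l) (@lr k l) (lr_rep l) n a).
Qed.
Lemma lrep_linl n u : S n u -> linear (fun a => rep n a u).
Proof.
case: n u => [|n] u Su; first exact: (br_bil (lg_lie l)).2.
exact: (good_linl (good n)).
Qed.
Lemma lrep_in n a u : S n u -> S n (rep n a u).
Proof. by case: n u => [|n] u Su //; apply: (good_rep (good n)). Qed.
Lemma lrep_br n a b u : S n u -> rep n ⁅a, b⁆ u = rep n a (rep n b u) - rep n b (rep n a
  u).
Proof.
case: n u => [|n] u Su; first exact: (br_adj (lg_lie l)).
exact: (good_br (good n)).
Qed.
Lemma lp_linr n x : linear (p n x).
Proof.
case: n => [|n].
  move=> c a b; change (- lr (c *: a + b) x = c *: - lr a x + - lr b x).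
  by rewrite (blPl (lr_rep l).1) opprD scalerN.
exact: (@r_linr k (lg l) (lV l) (lW l) (lV l) (@ls k l) (@lF k l) (@lr k l) (lr_rep l) r
  lie_r0_lin2 lie_rS n x).
Qed.
Lemma lp_linl n u : S n u -> linear (fun x => p n x u).
Proof.
case: n u => [|n] u Su; last exact: (good_rl (good n)).
move=> c a b; change (- lr u (c *: a + b) = c *: - lr u a + - lr u b).
by rewrite (blPr (lr_rep l).1) opprD scalerN.
Qed.
Lemma lp_in n x u : S n u -> S n.+1 (p n x u).
Proof. by case: n u => [|n] u Su //; apply: (tensor_im_gen (f := @r n)). Qed.
Lemma lp_eqv n a x u : S n u -> rep n.+1 a (p n x u) = p n (lr a x) u + p n x (rep n a u).
Proof.
case: n u => [|n] u Su; last exact: (good_eqv (good n)).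
change (lr a (- lr u x) = - lr u (lr a x) + - lr ⁅a, u⁆ x).
by rewrite (lr_rep l).2 (blNr (lr_rep l).1); zmod.
Qed.
Lemma lev_linr n u : S n.+1 u -> linear (ev n u).
Proof.
case: n u => [|n] u Su; first exact: (lF_bil l).1.
exact: (good_ev (good n) Su).1.
Qed.
Lemma lev_linl n y : linear (fun u => ev n u y).
Proof. by case: n => [|n] //; apply: (lF_bil l).2. Qed.
Lemma lev_in n u y : S n.+1 u -> S n (ev n u y).
Proof. by case: n u => [|n] u Su //; apply: (good_ev (good n) Su).2. Qed.
Lemma lev_rep n a u y : rep n a (ev n u y) = ev n (rep n.+1 a u) y + ev n u (ls a y).
Proof.
case: n u => [|n] u; first exact: lF_eqv.
change (iterrep (@ls k l) (@lr k l) a (u y) =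
  (iterrep (@ls k l) (@lr k l) a (u y) - u (ls a y)) + u (ls a y)).
by zmod.
Qed.

Lemma lpiece_ind n (K : lie_amb (lg l) (lV l) (lW l) n.+2 -> Prop) : is_submod K ->
  (forall x u, S n.+1 u -> K (p n.+1 x u)) -> forall u, S n.+2 u -> K u.
Proof. by move=> Ks Kp u; apply: (tensor_im_ind (f := p n.+1) (S := S n.+1)). Qed.
End LiePiece.

Lemma oppP (k : fieldType) (V : lmodType k) c (u v : V) :
  - (c *: u + v) = c *: - u + - v.
Proof. by rewrite opprD scalerN. Qed.

Section PentadLoc.
Variables (k : fieldType) (g : lieData k) (B0 : g -> g -> k) (P : pentad B0).
Hypothesis hP : standard P.

Lemma Phi_is : is_Phi (P := P) (Phi P).
Proof. exact: xgetPex (std_Phi hP). Qed.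
Definition Phi_bil : is_bilinear (Phi P) := Phi_is.1.
Definition PhiE a v phi : B0 a (Phi P v phi) = pairing P (rho P a v) phi := Phi_is.2 a v
  phi.

Lemma form_bil' : is_bilinear (B0 : g -> g -> k^o). Proof. exact: std_form hP. Qed.
Lemma pairing_bil' : is_bilinear (pairing P : _ -> _ -> k^o). Proof. exact: std_pairing
  hP. Qed.

Lemma form_inj a b : (forall c, B0 c a = B0 c b) -> a = b.
Proof.
move=> ab; apply/eqP; rewrite -subr_eq0; apply/eqP.
apply: (std_form_nondeg hP).2 => c.
by rewrite (blBr form_bil') ab subrr.
Qed.

Lemma Phi_unique a v phi : (forall c, B0 c a = pairing P (rho P c v) phi) -> Phi P v phi
  = a.
Proof. by move=> H; apply: form_inj => c; rewrite PhiE H. Qed.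

(** Tested against [B0], this is the representation law of [rho] together with invariance of form
    and pairing. *)
Lemma Phi_eqv a v w : ⁅a, Phi P v w⁆ = Phi P (rho P a v) w + Phi P v (crho P a w).
Proof.
apply: form_inj => c; rewrite -(std_form_inv hP) (blDr form_bil') !PhiE.
rewrite (std_rho hP).2 (blBl pairing_bil') [X in _ - X](std_pairing_inv hP).
by rewrite opprK.
Qed.

Definition locP : locLie k :=
  @LocLie k g (pV P) (pW P) (rho P) (crho P) (Phi P) (std_lie hP) (std_rho hP) (std_crho
    hP)
    Phi_bil Phi_eqv.

Local Notation V := (pV P).
Local Notation W := (pW P).
Local Notation S := (@L_piece k g B0 P).
Local Notation X := (dsum S).
Local Notation p n := (@lie_p k g V W (rho P) (crho P) (Phi P) n).
Local Notation q n := (@lie_p k g W V (crho P) (rho P) (Psi P) n).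
Local Notation evp n := (@lie_ev k g V W (Phi P) n).
Local Notation evm n := (@lie_ev k g W V (Psi P) n).
Local Notation rep n := (@L_rep k g B0 P n).
Implicit Types z : X.

Fact Lrep_linr n a : linear (rep n a).
Proof. by case: n => n; [apply: (@lrep_linr _ locP)|apply: (@lrep_linr _ (flip locP))].
  Qed.

Fact L_o0_in a z n : S n (rep n a (z n)).
Proof.
case: n => n; first exact: (@lrep_in _ locP _ _ _ (dsum_in z n)).
exact: (@lrep_in _ (flip locP) _ _ _ (dsum_in z (Negz n))).
Qed.
Fact L_o0_fin a z : exists s : seq int, forall n, n \notin s -> rep n a (z n) = 0.
Proof. by have [s zs] := dsum_fin z; exists s => n /zs ->; rewrite (linP0 (Lrep_linr
  _)). Qed.
Definition L_o0 a z : X := DSum (L_o0_in a z) (L_o0_fin a z).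

Let evm_linl n x : linear (fun u => evm n u x) := @lev_linl _ (flip locP) n x.
Let evp_linl n y : linear (fun u => evp n u y) := @lev_linl _ locP n y.
Let p_linr n x : linear (p n x) := @lp_linr _ locP n x.
Let q_linr n y : linear (q n y) := @lp_linr _ (flip locP) n y.
Let evm_linr z n : linear (evm n (z (Negz n))) := @lev_linr _ (flip locP) n _ (dsum_in z
  (Negz n)).
Let evp_linr z n : linear (evp n (z (Posz n.+1))) := @lev_linr _ locP n _ (dsum_in z
  (Posz n.+1)).

Definition L_op_comp x z (n : int) : L_amb P n :=
  match n with
  | Posz 0 => - evm 0%N (z (Negz 0)) x
  | Posz m.+1 => p m x (z (Posz m))
  | Negz m => - evm m.+1 (z (Negz m.+1)) x
  end.

Fact L_op_comp0 x z n : (forall m, m + 1 = n -> z m = 0) -> L_op_comp x z n = 0.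
Proof.
case: n => [[|n]|n] H; rewrite /L_op_comp.
- by rewrite H // (linP0 (@evm_linl 0%N x)) oppr0.
- rewrite H ?(linP0 (p_linr x)) //.
  by rewrite -PoszD addn1.
- rewrite H ?(linP0 (@evm_linl n.+1 x)) ?oppr0 //.
  by rewrite !NegzE -[n.+2]addn1 PoszD opprD subrK.
Qed.

Fact L_op_in x z n : S n (L_op_comp x z n).
Proof.
case: n => [[|n]|n] //.
- exact: (@lp_in _ locP _ _ _ (dsum_in z n)).
- apply: submodN.
  exact: (@lev_in _ (flip locP) _ _ _ (dsum_in z (Negz n.+1))).
Qed.
Fact L_op_fin x z : exists s : seq int, forall n, n \notin s -> L_op_comp x z n = 0.
Proof.
have [s zs] := dsum_fin z; exists (map (fun m : int => m + 1) s) => n ns.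
apply: L_op_comp0 => m mn; apply: zs; apply: contra ns => ms.
by apply/mapP; exists m.
Qed.
Definition L_op x z : X := DSum (L_op_in x z) (L_op_fin x z).

Definition L_om_comp y z (n : int) : L_amb P n :=
  match n with
  | Posz m => - evp m (z (Posz m.+1)) y
  | Negz 0 => q 0%N y (z (Posz 0))
  | Negz m.+1 => q m.+1 y (z (Negz m))
  end.

Fact L_om_comp0 y z n : (forall m, m - 1 = n -> z m = 0) -> L_om_comp y z n = 0.
Proof.
case: n => [n|[|n]] H; rewrite /L_om_comp.
- rewrite H ?(linP0 (@evp_linl n y)) ?oppr0 //.
  by rewrite -addn1 PoszD addrK.
- by rewrite H // (linP0 (q_linr y)).
- rewrite H ?(linP0 (q_linr y)) //.
  by rewrite !NegzE -opprD -PoszD addn1.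
Qed.

Fact L_om_in y z n : S n (L_om_comp y z n).
Proof.
case: n => [n|[|n]] //.
- apply: submodN; exact: (@lev_in _ locP _ _ _ (dsum_in z (Posz n.+1))).
- exact: (@lp_in _ (flip locP) _ _ _ (dsum_in z (Negz n))).
Qed.
Fact L_om_fin y z : exists s : seq int, forall n, n \notin s -> L_om_comp y z n = 0.
Proof.
have [s zs] := dsum_fin z; exists (map (fun m : int => m - 1) s) => n ns.
apply: L_om_comp0 => m mn; apply: zs; apply: contra ns => ms.
by apply/mapP; exists m.
Qed.
Definition L_om y z : X := DSum (L_om_in y z) (L_om_fin y z).

Lemma L_o0E a z n : L_o0 a z n = rep n a (z n). Proof. by []. Qed.
Lemma L_opE x z n : L_op x z n = L_op_comp x z n. Proof. by []. Qed.
Lemma L_omE x z n : L_om x z n = L_om_comp x z n. Proof. by []. Qed.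
Lemma L_op0E x z : L_op x z (Posz 0) = - evm 0%N (z (Negz 0)) x. Proof. by []. Qed.
Lemma L_opSE x z m : L_op x z (Posz m.+1) = p m x (z (Posz m)). Proof. by []. Qed.
Lemma L_opNE x z m : L_op x z (Negz m) = - evm m.+1 (z (Negz m.+1)) x. Proof. by []. Qed.
Lemma L_omPE y z m : L_om y z (Posz m) = - evp m (z (Posz m.+1)) y. Proof. by []. Qed.
Lemma L_omN0E y z : L_om y z (Negz 0) = q 0%N y (z (Posz 0)). Proof. by []. Qed.
Lemma L_omNSE y z m : L_om y z (Negz m.+1) = q m.+1 y (z (Negz m)). Proof. by []. Qed.

Fact L_o0_bil : is_bilinear L_o0.
Proof.
split=> [a c z z'|z c a b]; apply: dsum_ext => n; rewrite dsumPE !L_o0E.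
  by rewrite dsumPE Lrep_linr.
case: n => n; first exact: (@lrep_linl _ locP _ _ (dsum_in z n)).
exact: (@lrep_linl _ (flip locP) _ _ (dsum_in z (Negz n))).
Qed.
Fact L_op_bil : is_bilinear L_op.
Proof.
split=> [x c z z'|z c x x']; apply: dsum_ext => -[[|n]|n]; rewrite dsumPE ?(L_op0E,
  L_opSE, L_opNE).
- by rewrite dsumPE (@evm_linl 0%N); apply: oppP.
- by rewrite dsumPE p_linr.
- by rewrite dsumPE (@evm_linl n.+1); apply: oppP.
- by rewrite evm_linr; apply: oppP.
- exact: (@lp_linl _ locP n (z (Posz n)) (dsum_in z (Posz n)) c x x').
- by rewrite evm_linr; apply: oppP.
Qed.
Fact L_om_bil : is_bilinear L_om.
Proof.
split=> [x c z z'|z c x x']; apply: dsum_ext => -[n|[|n]]; rewrite dsumPE ?(L_omPE,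
  L_omN0E, L_omNSE).
- by rewrite dsumPE (@evp_linl n); apply: oppP.
- by rewrite dsumPE q_linr.
- by rewrite dsumPE q_linr.
- by rewrite evp_linr; apply: oppP.
- exact: (@lp_linl _ (flip locP) 0%N (z (Posz 0)) I c x x').
- exact: (@lp_linl _ (flip locP) n.+1 (z (Negz n)) (dsum_in z (Negz n)) c x x').
Qed.

Fact L_o0_br a b z : L_o0 ⁅a, b⁆ z = L_o0 a (L_o0 b z) - L_o0 b (L_o0 a z).
Proof.
apply: dsum_ext => n; rewrite dsumDE dsumNE !L_o0E.
case: n => n; first exact: (@lrep_br _ locP n _ _ _ (dsum_in z (Posz n))).
exact: (@lrep_br _ (flip locP) n.+1 _ _ _ (dsum_in z (Negz n))).
Qed.

Let repN n a u : rep n a (- u) = - rep n a u := linPN (Lrep_linr a) u.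
Let evm_rep n a u x : @lie_rep k g W V (crho P) (rho P) n a (evm n u x) =
    evm n (@lie_rep k g W V (crho P) (rho P) n.+1 a u) x + evm n u (rho P a x) :=
  @lev_rep _ (flip locP) n a u x.
Let evp_rep n a u y : @lie_rep k g V W (rho P) (crho P) n a (evp n u y) =
    evp n (@lie_rep k g V W (rho P) (crho P) n.+1 a u) y + evp n u (crho P a y) :=
  @lev_rep _ locP n a u y.

Fact L_o0_op a x z : L_o0 a (L_op x z) = L_op (rho P a x) z + L_op x (L_o0 a z).
Proof.
apply: dsum_ext => -[[|n]|n]; rewrite dsumDE L_o0E ?(L_op0E, L_opSE, L_opNE) L_o0E.
- rewrite repN -opprD; congr (- _); rewrite [RHS]addrC.
  exact: (@evm_rep 0%N a (z (Negz 0)) x).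
- exact: (@lp_eqv _ locP n _ _ _ (dsum_in z (Posz n))).
- rewrite repN -opprD; congr (- _); rewrite [RHS]addrC.
  exact: (@evm_rep n.+1 a (z (Negz n.+1)) x).
Qed.

Fact L_o0_om a y z : L_o0 a (L_om y z) = L_om (crho P a y) z + L_om y (L_o0 a z).
Proof.
apply: dsum_ext => -[n|[|n]]; rewrite dsumDE L_o0E ?(L_omPE, L_omN0E, L_omNSE) L_o0E.
- rewrite repN -opprD; congr (- _); rewrite [RHS]addrC.
  exact: (@evp_rep n a (z (Posz n.+1)) y).
- exact: (@lp_eqv _ (flip locP) 0%N _ _ (z (Posz 0)) I).
- exact: (@lp_eqv _ (flip locP) n.+1 _ _ _ (dsum_in z (Negz n))).
Qed.

(** In degree 0 this is equivariance of [Phi]. In positive degrees it is the recursion for p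
    evaluated at [y], in negative degrees the recursion for q evaluated at [x]. *)
Fact L_om_op x y z : L_om y (L_op x z) = L_op x (L_om y z) - L_o0 (Phi P x y) z.
Proof.
apply: dsum_ext => -[[|n]|[|n]]; rewrite dsumDE dsumNE L_o0E.
- rewrite L_omPE L_opSE L_op0E L_omN0E.
  change (- Phi P (- rho P (z (Posz 0)) x) y =
     - - Phi P x (- crho P (z (Posz 0)) y) - ⁅Phi P x y, z (Posz 0)⁆).
  rewrite (brC (std_lie hP)) Phi_eqv (blNl Phi_bil) (blNr Phi_bil); zmod.
- rewrite L_omPE !L_opSE L_omPE.
  change (- (rep n.+1 (Phi P x y) (z n.+1) + p n x (evp n (z n.+1) y)) =
    p n x (- evp n (z n.+1) y) - rep n.+1 (Phi P x y) (z n.+1)).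
  by rewrite (linPN (p_linr x)); zmod.
- rewrite L_omN0E L_op0E L_opNE L_omNSE.
  change (q 0%N y (- evm 0%N (z (Negz 0)) x) =
    - (rep (Negz 0) (- Phi P x y) (z (Negz 0)) + q 0%N y (evm 0%N (z (Negz 0)) x))
    - rep (Negz 0) (Phi P x y) (z (Negz 0))).
  rewrite (linPN (q_linr y)).
  have -> : rep (Negz 0) (- Phi P x y) (z (Negz 0)) = - rep (Negz 0) (Phi P x y) (z
    (Negz 0)).
    exact: (linPN (@lrep_linl _ (flip locP) _ _ (dsum_in z (Negz 0)))).
  by zmod.
- rewrite L_omNSE !L_opNE L_omNSE.
  change (q n.+1 y (- evm n.+1 (z (Negz n.+1)) x) =
    - (rep (Negz n.+1) (- Phi P x y) (z (Negz n.+1)) + q n.+1 y (evm n.+1 (z (Negz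
        n.+1)) x))
    - rep (Negz n.+1) (Phi P x y) (z (Negz n.+1))).
  rewrite (linPN (q_linr y)).
  have -> : rep (Negz n.+1) (- Phi P x y) (z (Negz n.+1)) = - rep (Negz n.+1) (Phi P x
    y) (z (Negz n.+1)).
    exact: (linPN (@lrep_linl _ (flip locP) _ _ (dsum_in z (Negz n.+1)))).
  by zmod.
Qed.

Definition L_mod : locmod locP :=
  @LocMod k locP X L_o0 L_op L_om L_o0_bil L_op_bil L_om_bil L_o0_br L_o0_op L_o0_om
    L_om_op.

Definition L_e0_comp (a : g) (n : int) : L_amb P n :=
  match n with Posz 0 => a | _ => 0 end.
Fact L_e0_in a n : S n (L_e0_comp a n).
Proof. by case: n => [[|n]|n] //; apply: submod0. Qed.
Fact L_e0_fin a : exists s : seq int, forall n, n \notin s -> L_e0_comp a n = 0.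
Proof. by exists [:: Posz 0] => -[[|n]|n]. Qed.
Definition L_e0 a : L_mod := DSum (L_e0_in a) (L_e0_fin a).

Definition L_ep_comp (x : V) (n : int) : L_amb P n :=
  match n with Posz 1 => x | _ => 0 end.
Fact L_ep_in a n : S n (L_ep_comp a n).
Proof. by case: n => [[|[|n]]|n] //; apply: submod0. Qed.
Fact L_ep_fin a : exists s : seq int, forall n, n \notin s -> L_ep_comp a n = 0.
Proof. by exists [:: Posz 1] => -[[|[|n]]|n]. Qed.
Definition L_ep a : L_mod := DSum (L_ep_in a) (L_ep_fin a).

Definition L_em_comp (y : W) (n : int) : L_amb P n :=
  match n with Negz 0 => y | _ => 0 end.
Fact L_em_in a n : S n (L_em_comp a n).
Proof. by case: n => [n|[|n]] //; apply: submod0. Qed.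
Fact L_em_fin a : exists s : seq int, forall n, n \notin s -> L_em_comp a n = 0.
Proof. by exists [:: Negz 0] => -[n|[|n]]. Qed.
Definition L_em a : L_mod := DSum (L_em_in a) (L_em_fin a).

Fact L_e0_homog a : homog (L_e0 a) 0. Proof. by case=> [[|n]|n]. Qed.
Fact L_ep_homog a : homog (L_ep a) 1. Proof. by case=> [[|[|n]]|n]. Qed.
Fact L_em_homog a : homog (L_em a) (-1). Proof. by case=> [n|[|n]]. Qed.

Fact L_e0_lin : linear L_e0.
Proof.
by move=> c u v; apply: dsum_ext => -[[|n]|n]; rewrite dsumPE //= scaler0 addr0.
Qed.
Fact L_ep_lin : linear L_ep.
Proof.
by move=> c u v; apply: dsum_ext => -[[|[|n]]|n]; rewrite dsumPE //= scaler0 addr0.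
Qed.
Fact L_em_lin : linear L_em.
Proof.
by move=> c u v; apply: dsum_ext => -[n|[|n]]; rewrite dsumPE //= scaler0 addr0.
Qed.

Fact L_o0_homog n a z : homog z n -> homog (L_o0 a z) n.
Proof. by move=> hz m mn; rewrite L_o0E hz // (linP0 (Lrep_linr _)). Qed.
Fact L_op_homog n a z : homog z n -> homog (L_op a z) (n + 1).
Proof.
move=> hz m mn; rewrite L_opE L_op_comp0 // => m' e; apply: hz.
by apply: contra_neq mn => <-.
Qed.
Fact L_om_homog n a z : homog z n -> homog (L_om a z) (n - 1).
Proof.
move=> hz m mn; rewrite L_omE L_om_comp0 // => m' e; apply: hz.
by apply: contra_neq mn => <-.
Qed.

Fact L_trp (n : nat) z : homog z n.+2 -> (forall y, L_om y z = 0) -> z = 0.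
Proof.
move=> hz omz; apply: (homog_eq hz) => //; apply: funext => y.
have e : - evp n.+1 (z (Posz n.+2)) y = 0 := congr1 (fun z : X => z (Posz n.+1)) (omz y).
by move/eqP: e; rewrite oppr_eq0 => /eqP.
Qed.

Fact L_trm (n : nat) z : homog z (- n.+2%:Z) -> (forall x, L_op x z = 0) -> z = 0.
Proof.
move=> hz opz; apply: (homog_eq hz) => //; apply: funext => x.
have e : - evm n.+1 (z (Negz n.+1)) x = 0 := congr1 (fun z : X => z (Negz n)) (opz x).
by move/eqP: e; rewrite oppr_eq0 => /eqP.
Qed.

Fact L_genp (n : nat) (K : X -> Prop) : is_submod K ->
  (forall x z, homog z n.+1 -> K (L_op x z)) -> forall z, homog z n.+2 -> K z.
Proof.
move=> [K0 KP] Kop z hz.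
have [z' [h' e' Kz']] : exists z', [/\ homog z' n.+2, z' n.+2 = z n.+2 & K z'].
  apply: (@lpiece_ind _ locP n (fun u => exists z' : X, [/\ homog z' n.+2, z' n.+2 = u &
    K z']));
    last exact: (dsum_in z n.+2).
    split; first by exists 0.
    move=> c u v [z1 [h1 e1 K1]] [z2 [h2 e2 K2]]; exists (c *: z1 + z2); split.
    + exact: (@submodP _ _ (homogS S n.+2)).
    + by rewrite dsumPE e1 e2.
    + exact: KP.
  move=> x u Su; have [z' [h' e']] := @dsum_single k int (@L_amb k g B0 P) S (Posz n.+1)
    u Su.
  exists (L_op x z'); split; last exact: Kop.
  + by have := L_op_homog x h'; rewrite -PoszD addn1.
  + by rewrite L_opSE e'.
by rewrite (homog_eq hz h').
Qed.

Fact L_genm (n : nat) (K : X -> Prop) : is_submod K ->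
  (forall x z, homog z (- n.+1%:Z) -> K (L_om x z)) -> forall z, homog z (- n.+2%:Z) ->
    K z.
Proof.
move=> [K0 KP] Kop z hz.
have [z' [h' e' Kz']] : exists z', [/\ homog z' (Negz n.+1), z' (Negz n.+1) = z (Negz
  n.+1) & K z'].
  apply: (@lpiece_ind _ (flip locP) n
     (fun u => exists z' : X, [/\ homog z' (Negz n.+1), z' (Negz n.+1) = u & K z']));
    last exact: (dsum_in z (Negz n.+1)).
    split; first by exists 0.
    move=> c u v [z1 [h1 e1 K1]] [z2 [h2 e2 K2]]; exists (c *: z1 + z2); split.
    + exact: (@submodP _ _ (homogS S (Negz n.+1))).
    + by rewrite dsumPE e1 e2.
    + exact: KP.
  move=> x u Su; have [z' [h' e']] := @dsum_single k int (@L_amb k g B0 P) S (Negz n) u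
    Su.
  exists (L_om x z'); split; last exact: Kop.
  + by have := L_om_homog x h'; rewrite NegzE -opprD -PoszD addn1.
  + by rewrite L_omNSE e'.
by rewrite (homog_eq hz h').
Qed.

Definition L_graded : gradedLie locP.
Proof.
refine (@GradedLie k locP L_mod L_e0 L_ep L_em (@homogS _ _ _ S) L_e0_lin L_ep_lin
  L_em_lin
  _ _ _ L_e0_homog L_ep_homog L_em_homog _ _ _ L_o0_homog L_op_homog L_om_homog
  _ _ _ _ _ _ _ L_trp L_trm L_genp L_genm (dsum_graded S)).
- by move=> a /(congr1 (fun z : X => z 0)).
- by move=> a /(congr1 (fun z : X => z 1)).
- by move=> a /(congr1 (fun z : X => z (-1))).
- by move=> z hz; exists (z 0); apply: (homog_eq hz) => //; apply: L_e0_homog.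
- by move=> z hz; exists (z 1); apply: (homog_eq hz) => //; apply: L_ep_homog.
- by move=> z hz; exists (z (-1)); apply: (homog_eq hz) => //; apply: L_em_homog.
- move=> a b; apply: (homog_eq (L_o0_homog a (L_e0_homog b)) (L_e0_homog _)) => //.
- move=> a b; apply: (homog_eq (L_o0_homog a (L_ep_homog b)) (L_ep_homog _)) => //.
- move=> a b; apply: (homog_eq (L_o0_homog a (L_em_homog b)) (L_em_homog _)) => //.
- move=> x a; apply: (homog_eq (L_op_homog x (L_e0_homog a)) (submodN (S := homogS S 1)
    (L_ep_homog _))).
  by rewrite dsumNE.
- move=> x a; apply: (homog_eq (L_om_homog x (L_e0_homog a)) (submodN (S := homogS S
    (-1)) (L_em_homog _))).
  by rewrite dsumNE.
- move=> x y; apply: (homog_eq (L_op_homog x (L_em_homog y)) (L_e0_homog _)).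
  by change (- - Phi P x y = Phi P x y); rewrite opprK.
- move=> y x; apply: (homog_eq (L_om_homog y (L_ep_homog x)) (submodN (S := homogS S 0)
    (L_e0_homog _))).
  by rewrite dsumNE.
Defined.

End PentadLoc.

(** * The chosen bracket and form of a standard pentad *)

Section BracketUnique.
Variables (k : fieldType) (l : locLie k) (X : gradedLie l).

(** The characterisation of [L_br] does not mention additivity of degrees; uniqueness lets the
    chosen bracket inherit it from the constructed one. *)
Lemma bracket_unique (br br' : X -> X -> X) : is_lie_bracket br -> is_lie_bracket br' ->
  (forall a z, br (e0 a) z = o0 a z) -> (forall x z, br (ep x) z = op x z) ->
  (forall y z, br (em y) z = om y z) ->
  (forall a z, br' (e0 a) z = o0 a z) -> (forall x z, br' (ep x) z = op x z) ->
  (forall y z, br' (em y) z = om y z) -> forall z w, br z w = br' z w.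
Proof.
move=> [bil _ jac] [bil' _ jac'] b0 bp bm b0' bp' bm'.
have j a b c : br (br a b) c = br a (br b c) - br b (br a c) by rewrite jac addrK.
have j' a b c : br' (br' a b) c = br' a (br' b c) - br' b (br' a c) by rewrite jac' addrK.
apply: (loc_ind (X := X) (K := fun z => forall w, br z w = br' z w)).
- split=> [w|c u v Hu Hv w]; first by rewrite (bl0l bil) (bl0l bil').
  by rewrite (blPl bil) (blPl bil') Hu Hv.
- by move=> a w; rewrite b0 b0'.
- by move=> a w; rewrite bp bp'.
- by move=> a w; rewrite bm bm'.
- by move=> x z H w; rewrite -{1}bp -bp' j j' !bp !bp' !H.
- by move=> x z H w; rewrite -{1}bm -bm' j j' !bm !bm' !H.
Qed.
End BracketUnique.

Section StandardLie.
Variables (k : fieldType) (g : lieData k) (B0 : g -> g -> k) (P : pentad B0).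
Hypothesis hP : standard P.

Lemma homog0E (a : dsum (@L_piece k g B0 P)) : homog a 0 -> a = L_e0 hP (a 0).
Proof. by move=> ha; apply: homog_eq ha (L_e0_homog _ _) _. Qed.
Lemma homog1E (a : dsum (@L_piece k g B0 P)) : homog a 1 -> a = L_ep hP (a 1).
Proof. by move=> ha; apply: homog_eq ha (L_ep_homog _ _) _. Qed.
Lemma homogm1E (a : dsum (@L_piece k g B0 P)) : homog a (-1) -> a = L_em hP (a (-1)).
Proof. by move=> ha; apply: homog_eq ha (L_em_homog _ _) _. Qed.

Lemma L_br_is : is_L_bracket (P := P) (@L_br k g B0 P).
Proof.
apply: xgetPex.
have [br [lbr b0 bp bm bD]] := bracket_ex (L_graded hP); exists br; split=> //.
- by move=> a z ha n; rewrite [a]homog0E // b0.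
- by move=> a z ha n; rewrite [a]homog1E // bp.
- by move=> a z ha; rewrite [a]homog1E // bp.
- by move=> a z ha n; rewrite [a]homog1E // bp.
- by move=> a z ha n; rewrite [a]homogm1E // bm.
- by move=> a z ha; rewrite [a]homogm1E // bm.
- by move=> a z ha n; rewrite [a]homogm1E // bm.
Qed.

Lemma L_lie : is_lie (L P). Proof. exact: Lbr_lie L_br_is. Qed.

Lemma L_br0 a (z : L P) : ⁅L_e0 hP a : L P, z⁆ = L_o0 hP a z.
Proof. by apply: dsum_ext => n; rewrite (Lbr_0 L_br_is _ (L_e0_homog hP a)). Qed.
Lemma L_brp x (z : L P) : ⁅L_ep hP x : L P, z⁆ = L_op hP x z.
Proof.
have hx := L_ep_homog hP x; apply: dsum_ext => -[[|n]|n].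
- exact: (Lbr_1_0 L_br_is _ hx).
- exact: (Lbr_1_pos L_br_is _ hx).
- exact: (Lbr_1_neg L_br_is _ hx).
Qed.
Lemma L_brm y (z : L P) : ⁅L_em hP y : L P, z⁆ = L_om hP y z.
Proof.
have hx := L_em_homog hP y; apply: dsum_ext => -[n|[|n]].
- exact: (Lbr_m1_pos L_br_is _ hx).
- exact: (Lbr_m1_0 L_br_is _ hx).
- exact: (Lbr_m1_neg L_br_is _ hx).
Qed.

Lemma br_e0e0 a b : ⁅L_e0 hP a : L P, L_e0 hP b : L P⁆ = L_e0 hP ⁅a, b⁆.
Proof. by rewrite L_br0; apply: (o0_e0 (L_graded hP)). Qed.
Lemma br_e0ep a x : ⁅L_e0 hP a : L P, L_ep hP x : L P⁆ = L_ep hP (rho P a x).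
Proof. by rewrite L_br0; apply: (o0_ep (L_graded hP)). Qed.
Lemma br_e0em a y : ⁅L_e0 hP a : L P, L_em hP y : L P⁆ = L_em hP (crho P a y).
Proof. by rewrite L_br0; apply: (o0_em (L_graded hP)). Qed.
Lemma br_eme0 y a : ⁅L_em hP y : L P, L_e0 hP a : L P⁆ = - L_em hP (crho P a y).
Proof. by rewrite L_brm; apply: (om_e0 (L_graded hP)). Qed.
Lemma br_emep y x : ⁅L_em hP y : L P, L_ep hP x : L P⁆ = - L_e0 hP (Phi P x y).
Proof. by rewrite L_brm; apply: (om_ep (L_graded hP)). Qed.

Lemma L_brD n m (z w : L P) : homog z n -> homog w m -> homog (⁅z, w⁆ : L P) (n + m).
Proof.
have [br [lbr b0 bp bm bD]] := bracket_ex (L_graded hP).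
have e := bracket_unique (X := L_graded hP) L_lie lbr L_br0 L_brp L_brm b0 bp bm.
by rewrite e; apply: bD.
Qed.

Hypothesis B0_sym : forall a b : g, B0 a b = B0 b a.

Lemma BL_is : is_BL (@BL k g B0 P).
Proof.
apply: xgetPex.
have [B [Bbil Bnd Bsym [B00 B1 BD [Bo0 Bop Bom]]]] := form_ex (L_graded hP) (std_form
  hP) B0_sym
  (std_form_nondeg hP) (std_form_inv hP) (std_pairing hP) (std_pairing_nondeg hP)
  (std_pairing_inv hP) (PhiE hP).
have inv := form_invariant (X := L_graded hP) L_lie Bbil L_br0 L_brp L_brm Bo0 Bop Bom.
have B' : is_bilinear (B : _ -> _ -> k^o) := Bbil.
have Binv (a b c : L P) : B ⁅a, b⁆ c = B a ⁅b, c⁆.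
  by rewrite (brC L_lie) (blNl B') inv opprK.
exists B; split=> //.
- by move=> a b ha hb; rewrite [a]homog0E // [b]homog0E // B00.
- by move=> a b ha hb; rewrite [a]homog1E // [b]homogm1E // B1.
(* The recursive rule is an instance of invariance and antisymmetry. *)
- move=> i v u phi psi _ _ _ _ _.
  by rewrite inv (brC L_lie v) (blNr B') opprK.
Qed.

Lemma BL_e0 a (z : L P) : @BL k g B0 P (L_e0 hP a) z = B0 a (z 0).
Proof.
have bl : is_bilinear (@BL k g B0 P : _ -> _ -> k^o) := BL_bilin BL_is.
apply: (graded_eq (l_gr (L_graded hP)) (H := k^o) (f := fun z => @BL k g B0 P (L_e0 hP
  a) z)
  (h := fun z : L P => B0 a (z 0)) (bl.1 (L_e0 hP a))) => [|n {}z hz].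
  by move=> c u v; rewrite dsumPE (blPr (form_bil' hP)).
have [n0|n0] := eqVneq n 0.
  by apply: (BL_0 BL_is (L_e0_homog hP a)); rewrite -n0.
rewrite (BL_orth BL_is (L_e0_homog hP a) hz) ?add0r //.
by rewrite (hz 0) 1?eq_sym // (bl0r (form_bil' hP)).
Qed.

Lemma BL_ep x (z : L P) : @BL k g B0 P (L_ep hP x) z = pairing P x (z (-1)).
Proof.
have bl : is_bilinear (@BL k g B0 P : _ -> _ -> k^o) := BL_bilin BL_is.
apply: (graded_eq (l_gr (L_graded hP)) (H := k^o) (f := fun z => @BL k g B0 P (L_ep hP
  x) z)
  (h := fun z : L P => pairing P x (z (-1))) (bl.1 (L_ep hP x))) => [|n {}z hz].
  by move=> c u v; rewrite dsumPE (blPr (pairing_bil' hP)).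
have [n0|n0] := eqVneq n (-1).
  by apply: (BL_1 BL_is (L_ep_homog hP x)); rewrite -n0.
rewrite (BL_orth BL_is (L_ep_homog hP x) hz); last by rewrite addrC addr_eq0.
by rewrite (hz (-1)) 1?eq_sym // (bl0r (pairing_bil' hP)).
Qed.

Lemma BL_em y (z : L P) : @BL k g B0 P (L_em hP y) z = pairing P (z 1) y.
Proof.
have bl : is_bilinear (@BL k g B0 P : _ -> _ -> k^o) := BL_bilin BL_is.
apply: (graded_eq (l_gr (L_graded hP)) (H := k^o) (f := fun z => @BL k g B0 P (L_em hP
  y) z)
  (h := fun z : L P => pairing P (z 1) y) (bl.1 (L_em hP y))) => [|n {}z hz].
  by move=> c u v; rewrite dsumPE (blPl (pairing_bil' hP)).
have [n0|n0] := eqVneq n 1.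
  rewrite (BL_sym BL_is); apply: (BL_1 BL_is _ (L_em_homog hP y)); by rewrite -n0.
rewrite (BL_orth BL_is (L_em_homog hP y) hz); last by rewrite addrC subr_eq0.
by rewrite (hz 1) 1?eq_sym // (bl0l (pairing_bil' hP)).
Qed.
End StandardLie.

(** * The extended pentad is standard *)

Section ExtStandard.
Variables (k : fieldType) (g : lieData k) (B0 : g -> g -> k) (P Q : pentad B0).
Hypotheses (hP : standard P) (hQ : standard Q).

Definition ext_pos : gradedMod (locP hP) := ext_graded (l := locP hP) (pi := rho Q)
  (std_rho hQ).
(** Over the exchanged local part: here [op] is the action of V_-1 and [om] that of V_1. *)
Definition ext_neg : gradedMod (flip (locP hP)) :=
  ext_graded (l := flip (locP hP)) (pi := crho Q) (std_crho hQ).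

Lemma gDz_homog (l : locLie k) (U : lmodType k) (pi : lg l -> U -> U) (hpi : is_rep pi) n
    (u : ext_graded hpi) : @gDz k l (ext_graded hpi) n u ->
  forall j : nat, Posz j != n -> (u : dsum (ext_piece (@ls k l) (@lF k l) pi)) j = 0.
Proof. by case: n => n; [move=> hu j jn; apply: hu|move=> -> j _]. Qed.

Lemma pos_act_is : is_pos_ext (pos_act (P := P) (Q := Q)).
Proof.
apply: xgetPex.
have [act [[a0 ap am] [A0 Ap Am AD]]] := action_ex (L_graded hP) ext_pos.
have rep := action_rep (X := L_graded hP) (L_lie hP) (L_br0 hP) (L_brp hP) (L_brm hP) A0
  Ap Am a0 ap am.
exists (fun z u => act z u); split.
- split; last exact: rep.
  by split=> [z|u]; [apply: hom_lin|move=> c z z'; rewrite (hom_lin act)].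
- move=> n m z u hz hu j jn; exact: (gDz_homog (AD n m z u hz hu) jn).
- by move=> a u ha m; rewrite [a](homog0E hP) // a0.
- by move=> x u ha; rewrite [x](homog1E hP) // ap.
- by move=> x u ha m; rewrite [x](homog1E hP) // ap.
- by move=> x u ha m; rewrite [x](homogm1E hP) // am.
Qed.

Lemma neg_act_is : is_neg_ext (neg_act (P := P) (Q := Q)).
Proof.
apply: xgetPex.
have [act [[a0 ap am] [A0 Ap Am AD]]] := action_ex (flip_Lie (L_graded hP)) ext_neg.
have rep := action_rep (X := flip_Lie (L_graded hP)) (L_lie hP) (L_br0 hP) (L_brm hP)
  (L_brp hP)
  A0 Ap Am a0 ap am.
exists (fun z u => act z u); split.
- split; last exact: rep.
  by split=> [z|u]; [apply: hom_lin|move=> c z z'; rewrite (hom_lin act)].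
- move=> n m z u hz hu j jn; apply: (gDz_homog (AD (- n) m z u _ hu)).
    by rewrite /= /flipD opprK.
  by rewrite -eqr_opp opprD opprK.
- by move=> a u ha m; rewrite [a](homog0E hP) // a0.
- by move=> x u ha; rewrite [x](homogm1E hP) // ap.
- by move=> x u ha m; rewrite [x](homogm1E hP) // ap.
- by move=> x u ha m; rewrite [x](homog1E hP) // am.
Qed.

Lemma pos_act0 a (u : ext_pos) : pos_act (L_e0 hP a : L P) u = o0 (a : lg (locP hP)) u.
Proof. by apply: dsum_ext => n; rewrite (pext_0 pos_act_is _ (L_e0_homog hP a)). Qed.
Lemma pos_actp x (u : ext_pos) : pos_act (L_ep hP x : L P) u = op (x : lV (locP hP)) u.
Proof.
apply: dsum_ext => -[|n]; first by rewrite (pext_1_0 pos_act_is _ (L_ep_homog hP x)).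
by rewrite (pext_1 pos_act_is _ (L_ep_homog hP x)).
Qed.
Lemma pos_actm y (u : ext_pos) : pos_act (L_em hP y : L P) u = om (y : lW (locP hP)) u.
Proof. by apply: dsum_ext => n; rewrite (pext_m1 pos_act_is _ (L_em_homog hP y)). Qed.

Lemma neg_act0 a (u : ext_neg) : neg_act (L_e0 hP a : L P) u = o0 (a : lg (flip (locP
  hP))) u.
Proof. by apply: dsum_ext => n; rewrite (next_0 neg_act_is _ (L_e0_homog hP a)). Qed.
Lemma neg_actm y (u : ext_neg) : neg_act (L_em hP y : L P) u = op (y : lV (flip (locP
  hP))) u.
Proof.
apply: dsum_ext => -[|n]; first by rewrite (next_m1_0 neg_act_is _ (L_em_homog hP y)).
by rewrite (next_m1 neg_act_is _ (L_em_homog hP y)).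
Qed.
Lemma neg_actp x (u : ext_neg) : neg_act (L_ep hP x : L P) u = om (x : lW (flip (locP
  hP))) u.
Proof. by apply: dsum_ext => n; rewrite (next_1 neg_act_is _ (L_ep_homog hP x)). Qed.

Lemma pos_act_bil : is_bilinear (pos_act (P := P) (Q := Q)). Proof. exact: (pext_rep
  pos_act_is).1. Qed.
Lemma neg_act_bil : is_bilinear (neg_act (P := P) (Q := Q)). Proof. exact: (next_rep
  neg_act_is).1. Qed.
Lemma pos_act_br (z w : L P) u : pos_act ⁅z, w⁆ u = pos_act z (pos_act w u) - pos_act w
  (pos_act (Q := Q) z u).
Proof. exact: (pext_rep pos_act_is).2. Qed.
Lemma neg_act_br (z w : L P) u : neg_act ⁅z, w⁆ u = neg_act z (neg_act w u) - neg_act w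
  (neg_act (Q := Q) z u).
Proof. exact: (next_rep neg_act_is).2. Qed.

Definition ext_form : ext_pos -> ext_neg -> k := @ext_pairing k g B0 P Q.

(** In degree n + 1 both arguments are combinations of some x·u and y·w, and the recursive rule
    leads back to degree n. This transfers invariance and non-degeneracy from the constructed
    pairing to the chosen one. *)
Lemma is_ext_pairing_unique f f' : is_ext_pairing (P := P) (Q := Q) f ->
  is_ext_pairing (P := P) (Q := Q) f' -> forall u w, f u w = f' u w.
Proof.
move=> Hf Hf'.
have bf : is_bilinear (f : _ -> _ -> k^o) := epair_bilin Hf.
have bf' : is_bilinear (f' : _ -> _ -> k^o) := epair_bilin Hf'.
have key n : forall (u : ext_pos) (w : ext_neg), gD n u -> gD n w -> f u w = f' u w.
  elim: n => [|n IH] u w hu hw; first by rewrite (epair_0 Hf) // (epair_0 Hf').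
  apply: (g_gen (g := ext_pos) (n := n) (K := fun u => f u w = f' u w)) hu.
    split=> [|c v v' e e']; first by rewrite (bl0l bf) (bl0l bf').
    by rewrite (blPl bf) (blPl bf') e e'.
  move=> x {}u hu.
  apply: (g_gen (g := ext_neg) (n := n) (K := fun w => f (op x u) w = f' (op x u) w)) hw.
    split=> [|c v v' e e']; first by rewrite (bl0r bf) (bl0r bf').
    by rewrite (blPr bf) (blPr bf') e e'.
  move=> y {}w hw; rewrite -pos_actp -neg_actm.
  rewrite (epair_rec Hf (L_ep_homog hP x) (L_em_homog hP y) hu hw).
  rewrite (epair_rec Hf' (L_ep_homog hP x) (L_em_homog hP y) hu hw).
  congr (- _); rewrite pos_actm pos_actp; apply: IH hw.
  by apply: gD_om; apply: gD_op.
move=> u w; apply: (g_ind (g := ext_pos) (K := fun u => f u w = f' u w) _ _ u).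
  split=> [|c v v' e e']; first by rewrite (bl0l bf) (bl0l bf').
  by rewrite (blPl bf) (blPl bf') e e'.
move=> n {}u hu; apply: (g_ind (g := ext_neg) (K := fun w => f u w = f' u w) _ _ w).
  split=> [|c v v' e e']; first by rewrite (bl0r bf) (bl0r bf').
  by rewrite (blPr bf) (blPr bf') e e'.
move=> m {}w hw; have [nm|nm] := eqVneq n m; first by apply: (key n) => //; rewrite nm.
by rewrite (epair_orth Hf hu hw nm) (epair_orth Hf' hu hw nm).
Qed.

Lemma ext_form_props :
  [/\ is_ext_pairing ext_form, is_nondegenerate ext_form &
   [/\ forall a u w, ext_form (o0 a u) w = - ext_form u (o0 (a : lg (flip (locP hP))) w),
       forall x u w, ext_form (op x u) w = - ext_form u (om (x : lW (flip (locP hP))) w) &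
       forall y u w, ext_form (om y u) w = - ext_form u (op (y : lV (flip (locP hP)))
         w)]].
Proof.
have [B [Bbil Bnd B0' BD [Bo0 Bop Bom]]] := pairing_ex (E := ext_pos) (E' := ext_neg)
  (std_pairing hQ)
  (std_pairing_nondeg hQ) (std_pairing_inv hQ).
have HB : is_ext_pairing (P := P) (Q := Q) B.
  split=> //.
  - move=> u w /(gD0 (g := ext_pos))[u' ->] /(gD0 (g := ext_neg))[w' ->].
    exact: B0'.
  - move=> i x y u w hx hy _ _.
    rewrite [x](homog1E hP) // [y](homogm1E hP) // pos_actp neg_actm pos_actm.
    by rewrite Bom opprK.
have HE : is_ext_pairing (P := P) (Q := Q) ext_form by apply: xgetPex; exists B.
have -> : ext_form = B.
  by apply: funext => u; apply: funext => w; apply: is_ext_pairing_unique.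
by split.
Qed.

Lemma ext_form_inv (z : L P) (u : ext_pos) (w : ext_neg) :
  ext_form (pos_act z u) w = - ext_form u (neg_act z w).
Proof.
have [HE _ [Eo0 Eop Eom]] := ext_form_props.
have bf : is_bilinear (ext_form : _ -> _ -> k^o) := epair_bilin HE.
move: u w; apply: (loc_ind (X := L_graded hP) (K := fun z =>
  forall u w, ext_form (pos_act (z : L P) u) w = - ext_form u (neg_act (z : L P) w))) z.
- split=> [u w|c z z' H H' u w].
    by rewrite (bl0l pos_act_bil) (bl0l neg_act_bil) (bl0l bf) (bl0r bf) oppr0.
  by rewrite (blPl pos_act_bil) (blPl neg_act_bil) (blPl bf) (blPr bf) H H' opprD scalerN.
- by move=> a u w; rewrite pos_act0 neg_act0 Eo0.
- by move=> a u w; rewrite pos_actp neg_actp Eop.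
- by move=> a u w; rewrite pos_actm neg_actm Eom.
- move=> x z H u w; rewrite (_ : op x z = ⁅L_ep hP x : L P, z⁆); last by rewrite L_brp.
  rewrite pos_act_br neg_act_br !pos_actp !neg_actp.
  by rewrite (blBl bf) (blBr bf) Eop !H Eop !opprK; zmod.
- move=> x z H u w; rewrite (_ : om x z = ⁅L_em hP x : L P, z⁆); last by rewrite L_brm.
  rewrite pos_act_br neg_act_br !pos_actm !neg_actm.
  by rewrite (blBl bf) (blBr bf) Eom !H Eom !opprK; zmod.
Qed.

Hypothesis B0_sym : forall a b : g, B0 a b = B0 b a.

Let BP := BL_is hP B0_sym.

Lemma BL_bil' : is_bilinear (@BL k g B0 P : _ -> _ -> k^o).
Proof. exact: BL_bilin BP. Qed.

Lemma BL_inj (a b : L P) : (forall c, BL c a = BL c b) -> a = b.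
Proof.
move=> ab; apply/eqP; rewrite -subr_eq0; apply/eqP.
apply: (BL_nondeg BP).2 => c.
by rewrite (blBr BL_bil') ab subrr.
Qed.

Lemma BL00 a b : @BL k g B0 P (L_e0 hP a) (L_e0 hP b) = B0 a b.
Proof. exact: (BL_0 BP (L_e0_homog hP a) (L_e0_homog hP b)). Qed.

(** Only the degree 0 part of [a] contributes to either side, and for it this is the defining
    property of [Phi Q]. *)
Lemma ext_Phi_base u w (a : L P) : @BL k g B0 P a (L_e0 hP (Phi Q u w)) =
  ext_form (pos_act a (gi (g := ext_pos) u)) (gi (g := ext_neg) w).
Proof.
have [HE _ _] := ext_form_props.
have bf : is_bilinear (ext_form : _ -> _ -> k^o) := epair_bilin HE.
apply: (l_ind (g := L_graded hP) (K := fun a => @BL k g B0 P a (L_e0 hP (Phi Q u w)) =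
  ext_form (pos_act (a : L P) (gi (g := ext_pos) u)) (gi (g := ext_neg) w))).
  split=> [|c a1 a2 e1 e2].
    by rewrite (bl0l BL_bil') (bl0l pos_act_bil) (bl0l bf).
  by rewrite (blPl BL_bil') (blPl pos_act_bil) (blPl bf) e1 e2.
move=> n {}a ha; have [n0|n0] := eqVneq n 0.
  move: ha; rewrite n0 => /(lD0 (g := L_graded hP))[b ->].
  rewrite BL00 pos_act0 gi_eqv (PhiE hQ).
  exact/esym/(epair_0 HE (gD_gi ext_pos _) (gD_gi ext_neg _)).
rewrite (BL_orth BP ha (L_e0_homog hP _)) ?addr0 //.
case: n n0 ha => [[|n]|n] // _ ha.
  apply/esym/(epair_orth HE (n := n.+1) _ (gD_gi ext_neg _)) => // j jn.
  apply: (pext_graded pos_act_is ha (gD_gi ext_pos u)).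
  by rewrite addr0.
suff -> : pos_act (a : L P) (gi (g := ext_pos) u) = 0 by rewrite (bl0l bf).
apply: dsum_ext => j; apply: (pext_graded pos_act_is ha (gD_gi ext_pos u)).
by rewrite addr0.
Qed.

Lemma ext_Phi_pt (u : ext_pos) (w : ext_neg) : exists c : L P,
  forall a, @BL k g B0 P a c = ext_form (pos_act a u) w.
Proof.
have [HE _ _] := ext_form_props.
have bf : is_bilinear (ext_form : _ -> _ -> k^o) := epair_bilin HE.
move: w; apply: (mod_ind (E := ext_pos) (K := fun u => forall w : ext_neg, exists c : L P,
  forall a, @BL k g B0 P a c = ext_form (pos_act a u) w)) u.
- split=> [w|c u v Hu Hv w].
    by exists 0 => a; rewrite (bl0r BL_bil') (bl0r pos_act_bil) (bl0l bf).
  have [cu cuE] := Hu w; have [cv cvE] := Hv w; exists (c *: cu + cv) => a.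
  by rewrite (blPr BL_bil') (blPr pos_act_bil) (blPl bf) cuE cvE.
- move=> u w; apply: (mod_ind (E := ext_neg) (K := fun w => exists c : L P,
    forall a, @BL k g B0 P a c = ext_form (pos_act a (gi (g := ext_pos) u)) w)) w.
  + split=> [|c w w' [cu cuE] [cv cvE]].
      by exists 0 => a; rewrite (bl0r BL_bil') (bl0r bf).
    by exists (c *: cu + cv) => a; rewrite (blPr BL_bil') (blPr bf) cuE cvE.
  + by move=> w; exists (L_e0 hP (Phi Q u w)) => a; apply: ext_Phi_base.
  (* Since y kills the lowest u, <a u, y w> = - <y a u, w> = <[a, y] u, w>, which invariance of the
     form turns into a pairing of a with [y, c]. *)
  + move=> y w [c cE]; exists (⁅L_em hP y : L P, c⁆) => a.
    rewrite -(BL_inv BP) cE -neg_actm -[RHS]opprK -ext_form_inv -(blNl bf).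
    congr (ext_form _ w); rewrite pos_act_br (pos_actm _ (gi (g := ext_pos) u)) gi_om.
    by rewrite (bl0r pos_act_bil) sub0r.
- move=> x u Hu w; have [c1 c1E] := Hu w.
  have [c2 c2E] := Hu (neg_act (L_ep hP x : L P) w).
  (* From a x u = [a, x] u + x a u: the first term gives [x, c1], and moving x over to w in the
     second gives - c2. *)
  exists (⁅L_ep hP x : L P, c1⁆ - c2) => a.
  rewrite (blBr BL_bil') -(BL_inv BP) c1E c2E -pos_actp.
  rewrite pos_act_br (blBl bf) (ext_form_inv (L_ep hP x)).
  by rewrite opprK addrK.
Qed.

Lemma standard_ext : standard (pentad_ext P Q).
Proof.
have [HE Hnd _] := ext_form_props.
have bf : is_bilinear (ext_form : _ -> _ -> k^o) := epair_bilin HE.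
have [a0 a0n] := std_neq0 hP.
split.
- by exists (L_e0 hP a0) => /(congr1 (fun z : L P => z 0)).
- exact: L_lie.
- exact: BL_bilin BP.
- exact: BL_nondeg BP.
- exact: BL_inv BP.
- exact: pext_rep pos_act_is.
- exact: next_rep neg_act_is.
- exact: bf.
- exact: ext_form_inv.
- exact: Hnd.
(* Representing elements are chosen pointwise; non-degeneracy of the form makes them unique, hence
   bilinear in [u] and [w]. *)
pose F u w := projT1 (cid (ext_Phi_pt u w)).
have FE u w a : BL a (F u w) = ext_form (pos_act a u) w := projT2 (cid (ext_Phi_pt u w))
  a.
exists F; split=> //; split=> [u c w w'|w c u u']; apply: BL_inj => a.
  by rewrite (blPr BL_bil') !FE (blPr bf).
by rewrite (blPr BL_bil') !FE (blPr pos_act_bil) (blPl bf).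
Qed.
End ExtStandard.

(** * The direct sum of two standard pentads *)

Section SumStandard.
Variables (k : fieldType) (g : lieData k) (B0 : g -> g -> k) (P Q : pentad B0).
Hypotheses (hP : standard P) (hQ : standard Q).

Lemma pair_eq (U V : lmodType k) (u u' : U) (v v' : V) : u = u' -> v = v' -> (u, v) =
  (u', v').
Proof. by move=> -> ->. Qed.

Lemma sum_Phi_is : is_Phi (P := pentad_sum P Q)
  (fun v phi => Phi P v.1 phi.1 + Phi Q v.2 phi.2).
Proof.
split.
  split=> [v c w w'|w c v v'] /=.
    by rewrite (blPr (Phi_bil hP)) (blPr (Phi_bil hQ)) scalerDr; zmod.
  by rewrite (blPl (Phi_bil hP)) (blPl (Phi_bil hQ)) scalerDr; zmod.
by move=> a v w; rewrite (blDr (form_bil' hP)) (PhiE hP) (PhiE hQ).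
Qed.

Lemma standard_sum : standard (pentad_sum P Q).
Proof.
have pP := pairing_bil' hP; have pQ := pairing_bil' hQ.
split.
- exact: std_neq0 hP.
- exact: std_lie hP.
- exact: std_form hP.
- exact: std_form_nondeg hP.
- exact: std_form_inv hP.
- split; first split=> [a c v v'|v c a b] /=.
  + by rewrite (blPr (std_rho hP).1) (blPr (std_rho hQ).1).
  + by rewrite (blPl (std_rho hP).1) (blPl (std_rho hQ).1).
  + by move=> a b v /=; rewrite (std_rho hP).2 (std_rho hQ).2.
- split; first split=> [a c v v'|v c a b] /=.
  + by rewrite (blPr (std_crho hP).1) (blPr (std_crho hQ).1).
  + by rewrite (blPl (std_crho hP).1) (blPl (std_crho hQ).1).
  + by move=> a b v /=; rewrite (std_crho hP).2 (std_crho hQ).2.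
- split=> [v c w w'|w c v v'] /=.
  + by rewrite (blPr pP) (blPr pQ) mulrDr; zmod.
  + by rewrite (blPl pP) (blPl pQ) mulrDr; zmod.
- by move=> a v w /=; rewrite (std_pairing_inv hP) (std_pairing_inv hQ) opprD.
- split=> [[v1 v2] H|[w1 w2] H]; apply: pair_eq.
  + apply: (std_pairing_nondeg hP).1 => w; have /= := H (w, 0).
    by rewrite (bl0r pQ) addr0.
  + apply: (std_pairing_nondeg hQ).1 => w; have /= := H (0, w).
    by rewrite (bl0r pP) add0r.
  + apply: (std_pairing_nondeg hP).2 => v; have /= := H (v, 0).
    by rewrite (bl0l pQ) addr0.
  + apply: (std_pairing_nondeg hQ).2 => v; have /= := H (0, v).
    by rewrite (bl0l pP) add0r.
- by exists (fun v phi => Phi P v.1 phi.1 + Phi Q v.2 phi.2); apply: sum_Phi_is.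
Qed.

Lemma Phi_sumE v w : Phi (pentad_sum P Q) v w = Phi P v.1 w.1 + Phi Q v.2 w.2.
Proof.
apply: (Phi_unique standard_sum) => c; exact: sum_Phi_is.2.
Qed.
End SumStandard.

(** * The isomorphism *)

Section LieLocmod.
Variables (k : fieldType) (l : locLie k) (N : lieData k) (hN : is_lie N).
Variables (j0 : lg l -> N) (jp : lV l -> N) (jm : lW l -> N).
Hypotheses (j0_lin : linear j0) (jp_lin : linear jp) (jm_lin : linear jm).
Hypotheses
  (h00 : forall a b, ⁅j0 a, j0 b⁆ = j0 ⁅a, b⁆)
  (h0p : forall a x, ⁅j0 a, jp x⁆ = jp (lr a x))
  (h0m : forall a y, ⁅j0 a, jm y⁆ = jm (ls a y))
  (hmp : forall y x, ⁅jm y, jp x⁆ = - j0 (lF x y)).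

Fact br_precomp_bil (U : lmodType k) (j : U -> N) : linear j ->
  is_bilinear (fun u z => ⁅j u, z⁆).
Proof.
move=> lj; split=> [u|z c u v]; first exact: (br_bil hN).1.
by rewrite lj (blPl (br_bil hN)).
Qed.

(** A map of local parts into a Lie algebra makes it a local module through the adjoint action, so
    that homomorphisms become a case of [lie_rec]. *)
Definition lie_locmod : locmod l.
Proof.
refine (@LocMod k l N (fun a z => ⁅j0 a, z⁆) (fun x z => ⁅jp x, z⁆) (fun y z => ⁅jm y, z⁆)
  (br_precomp_bil j0_lin) (br_precomp_bil jp_lin) (br_precomp_bil jm_lin) _ _ _ _).
- by move=> a b z; rewrite -h00 (br_adj hN).
- by move=> a x z; rewrite -h0p (br_jac hN).
- by move=> a x z; rewrite -h0m (br_jac hN).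
- by move=> x y z; rewrite (br_jac hN) hmp (blNl (br_bil hN)) addrC.
Defined.
End LieLocmod.

Section Iso.
Variables (k : fieldType) (g : lieData k) (B0 : g -> g -> k) (P Q : pentad B0).
Hypotheses (hP : standard P) (hQ : standard Q).
Hypothesis B0_sym : forall a b : g, B0 a b = B0 b a.

Let hE := standard_ext hP hQ B0_sym.
Let hR := standard_sum hP hQ.
Local Notation N := (L (pentad_ext P Q)).
Local Notation R := (pentad_sum P Q).
Local Notation EP := (ext_pos hP hQ).
Local Notation EN := (ext_neg hP hQ).
Local Notation LP := (L_graded hP).
Local Notation LE := (L_graded hE).
Local Notation LR := (L_graded hR).

Definition theta0 (a : g) : N := L_e0 hE (L_e0 hP a : L P).
(** V has outer degree 0 and inner degree 1, while U has outer degree 1 and inner degree 0. *)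
Definition thetap (v : pV R) : N := L_e0 hE (L_ep hP v.1 : L P) + L_ep hE (gi (g := EP)
  v.2).
Definition thetam (w : pW R) : N := L_e0 hE (L_em hP w.1 : L P) + L_em hE (gi (g := EN)
  w.2).

Lemma theta0_lin : linear theta0.
Proof. by move=> c a b; rewrite /theta0 (L_e0_lin hP) (L_e0_lin hE). Qed.
Lemma thetap_lin : linear thetap.
Proof.
move=> c a b; rewrite /thetap (L_ep_lin hP) (L_e0_lin hE) (gi_lin EP) (L_ep_lin hE).
by rewrite scalerDr; zmod.
Qed.
Lemma thetam_lin : linear thetam.
Proof.
move=> c a b; rewrite /thetam (L_em_lin hP) (L_e0_lin hE) (gi_lin EN) (L_em_lin hE).
by rewrite scalerDr; zmod.
Qed.

Lemma thetap_l x : thetap (x, 0) = L_e0 hE (L_ep hP x : L P).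
Proof.
rewrite /thetap; change (_ + _) with (L_e0 hE (L_ep hP x : L P) + L_ep hE (gi (g := EP)
  0)).
by rewrite (linP0 (gi_lin EP)) (linP0 (L_ep_lin hE)) addr0.
Qed.
Lemma thetap_r u : thetap (0, u) = L_ep hE (gi (g := EP) u).
Proof.
rewrite /thetap; change (_ + _) with (L_e0 hE (L_ep hP 0 : L P) + L_ep hE (gi (g := EP)
  u)).
by rewrite (linP0 (L_ep_lin hP)) (linP0 (L_e0_lin hE)) add0r.
Qed.
Lemma thetam_l x : thetam (x, 0) = L_e0 hE (L_em hP x : L P).
Proof.
rewrite /thetam; change (_ + _) with (L_e0 hE (L_em hP x : L P) + L_em hE (gi (g := EN)
  0)).
by rewrite (linP0 (gi_lin EN)) (linP0 (L_em_lin hE)) addr0.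
Qed.
Lemma thetam_r u : thetam (0, u) = L_em hE (gi (g := EN) u).
Proof.
rewrite /thetam; change (_ + _) with (L_e0 hE (L_em hP 0 : L P) + L_em hE (gi (g := EN)
  u)).
by rewrite (linP0 (L_em_lin hP)) (linP0 (L_e0_lin hE)) add0r.
Qed.

Lemma theta00 a b : ⁅theta0 a, theta0 b⁆ = theta0 ⁅a, b⁆.
Proof. by rewrite /theta0 br_e0e0 br_e0e0. Qed.

Let Nb := br_bil (L_lie hE).

Lemma theta0p a v : ⁅theta0 a, thetap v⁆ = thetap (rho R a v).
Proof.
rewrite (blDr Nb) br_e0e0 br_e0ep br_e0ep /=; congr (_ + L_ep hE _).
by rewrite pos_act0; apply: (gi_eqv (g := EP)).
Qed.
Lemma theta0m a v : ⁅theta0 a, thetam v⁆ = thetam (crho R a v).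
Proof.
rewrite (blDr Nb) br_e0e0 br_e0em br_e0em /=; congr (_ + L_em hE _).
by rewrite neg_act0; apply: (gi_eqv (g := EN)).
Qed.

Lemma Phi_ext_base u w : Phi (pentad_ext P Q) (gi (g := EP) u) (gi (g := EN) w) = L_e0
  hP (Phi Q u w).
Proof. by apply: (Phi_unique hE) => c; apply: ext_Phi_base. Qed.

Lemma thetamp w v : ⁅thetam w, thetap v⁆ = - theta0 (Phi R v w).
Proof.
rewrite (blDl Nb) !(blDr Nb) br_e0e0 br_e0ep br_emep br_eme0 br_emep /=.
(* The cross terms vanish: V_-1 kills the lowest piece of the positive extension, V_1 that of the
   negative one. *)
have -> : pos_act (L_em hP w.1 : L P) (gi (g := EP) v.2) = 0.
  by rewrite pos_actm; apply: (gi_om (g := EP)).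
have -> : neg_act (L_ep hP v.1 : L P) (gi (g := EN) w.2) = 0.
  by rewrite neg_actp; apply: (gi_om (g := EN)).
rewrite (linP0 (L_ep_lin hE)) (linP0 (L_em_lin hE)) oppr0 add0r addr0 Phi_ext_base.
rewrite Phi_sumE // /theta0 (linPD (L_e0_lin hP)) (linPD (L_e0_lin hE)).
by rewrite (linPN (L_e0_lin hE)) opprD.
Qed.

Definition ext_sum_mod : locmod (locP hR) :=
  @lie_locmod k (locP hR) N (L_lie hE) theta0 thetap thetam theta0_lin thetap_lin
    thetam_lin theta00 theta0p theta0m thetamp.

Local Notation n0 h := ((h : N) (Posz 0) : L P).
Local Notation n1 h := ((h : N) (Posz 1) : Upos P Q).
Local Notation nm1 h := ((h : N) (Negz 0) : Uneg P Q).

(* Elements of total degree [n + 1] have no component of negative degree, and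
   their components in L(P) and in the positive extension have the complementary
   degrees [n + 1] and [n]; higher components need not be controlled. *)
Definition pos_deg (n : nat) (h : N) : Prop :=
  [/\ forall j, h (Negz j) = 0, homog (n0 h) n.+1 & homog (n1 h) n].
Definition neg_deg (n : nat) (h : N) : Prop :=
  [/\ forall j, h (Posz j.+1) = 0, homog (n0 h) (- n.+1%:Z) & homog (nm1 h) n].

Lemma thetap_deg v : pos_deg 0 (thetap v).
Proof.
rewrite /thetap; split.
- by move=> j; rewrite dsumDE addr0.
- by rewrite dsumDE addr0; apply: L_ep_homog.
- by rewrite dsumDE add0r; apply: (gD_gi EP).
Qed.

Lemma thetam_deg v : neg_deg 0 (thetam v).
Proof.
rewrite /thetam; split.
- by move=> j; rewrite dsumDE addr0.
- by rewrite dsumDE addr0; apply: L_em_homog.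
- by rewrite dsumDE add0r; apply: (gD_gi EN).
Qed.

Lemma brp0 v h : n0 (⁅thetap v, h⁆) = ⁅L_ep hP v.1 : L P, n0 h⁆ - Psi (pentad_ext P Q)
  (nm1 h) (gi (g := EP) v.2).
Proof. by rewrite (blDl Nb) dsumDE L_br0 L_brp. Qed.
Lemma brp1 v h : n1 (⁅thetap v, h⁆) = pos_act (L_ep hP v.1 : L P) (n1 h) - pos_act (n0
  h) (gi (g := EP) v.2).
Proof. by rewrite (blDl Nb) dsumDE L_br0 L_brp. Qed.
Lemma brm0 v h : n0 (⁅thetam v, h⁆) = ⁅L_em hP v.1 : L P, n0 h⁆ - Phi (pentad_ext P Q)
  (n1 h) (gi (g := EN) v.2).
Proof. by rewrite (blDl Nb) dsumDE L_br0 L_brm. Qed.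
Lemma brmm1 v h : nm1 (⁅thetam v, h⁆) = neg_act (L_em hP v.1 : L P) (nm1 h) - neg_act
  (n0 h) (gi (g := EN) v.2).
Proof. by rewrite (blDl Nb) dsumDE L_br0 L_brm. Qed.

Lemma pos_degP n z h : @genp k (locP hR) LR ext_sum_mod thetap n z h -> pos_deg n h.
Proof.
elim=> {n z h}; first exact: thetap_deg.
- move=> n x z h _ [Hm H0 H1]; split.
  + move=> j; change ((⁅thetap x, h⁆ : N) (Negz j) = 0).
    rewrite (blDl Nb) dsumDE L_br0 L_brp L_o0E L_opNE !Hm.
    rewrite (linP0 (Lrep_linr hE _)) add0r.
    by rewrite (linP0 (@lev_linl _ (flip (locP hE)) j.+1 _)) oppr0.
  (* The [Psi] term comes from outer degree -1, where [h] has no component. *)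
  + change (homog (n0 ⁅thetap x, h⁆) n.+2); rewrite brp0 Hm /Psi (bl0r (Phi_bil hE))
      !oppr0 addr0.
    have := L_brD hP (L_ep_homog hP x.1) H0.
    by rewrite -PoszD add1n.
  + change (homog (n1 ⁅thetap x, h⁆) n.+1); rewrite brp1; apply: (submodB (S := homogS _
      n.+1)).
      by rewrite pos_actp; apply: (gD_op (g := EP)).
    move=> j jn; apply: (pext_graded (pos_act_is hP hQ) H0 (gD_gi EP _)).
    by rewrite addr0.
- move=> n c z h z' h' _ [Hm H0 H1] _ [Hm' H0' H1']; split.
  + by move=> j; rewrite dsumPE Hm Hm' scaler0 addr0.
  + by rewrite dsumPE; apply: (submodP (s := homogS _ (Posz n.+1))).
  + by rewrite dsumPE; apply: (submodP (s := homogS _ n)).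
Qed.

Lemma neg_degP n z h : @genm k (locP hR) LR ext_sum_mod thetam n z h -> neg_deg n h.
Proof.
elim=> {n z h}; first exact: thetam_deg.
- move=> n x z h _ [Hm H0 H1]; split.
  + move=> j; change ((⁅thetam x, h⁆ : N) (Posz j.+1) = 0).
    rewrite (blDl Nb) dsumDE L_br0 L_brm L_o0E L_omPE !Hm.
    rewrite (linP0 (Lrep_linr hE _)) add0r.
    by rewrite (linP0 (@lev_linl _ (locP hE) j.+1 _)) oppr0.
  + change (homog (n0 ⁅thetam x, h⁆) (- n.+2%:Z)); rewrite brm0 Hm (bl0l (Phi_bil hE))
      oppr0 addr0.
    have := L_brD hP (L_em_homog hP x.1) H0.
    by rewrite -opprD -PoszD add1n.
  + change (homog (nm1 ⁅thetam x, h⁆) n.+1); rewrite brmm1; apply: (submodB (S := homogS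
      _ n.+1)).
      by rewrite neg_actm; apply: (gD_op (g := EN)).
    move=> j jn; apply: (next_graded (neg_act_is hP hQ) H0 (gD_gi EN _)).
    by rewrite subr0 eqr_opp.
- move=> n c z h z' h' _ [Hm H0 H1] _ [Hm' H0' H1']; split.
  + by move=> j; rewrite dsumPE Hm Hm' scaler0 addr0.
  + by rewrite dsumPE; apply: (submodP (s := homogS _ (- n.+1%:Z))).
  + by rewrite dsumPE; apply: (submodP (s := homogS _ n)).
Qed.

(** The elements of the negative extension that kill [h] include its lowest piece and are stable
    under V_-1, so they are all of it. Transitivity then removes the components of outer degree at
    least 2. At index n + 1 the other two have inner degrees n + 2 and n + 1, just high enough for
    transitivity of L(P) and of the positive extension. *)
Lemma thetap_tr n (h : ext_sum_mod) : @genp k (locP hR) LR ext_sum_mod thetap n.+1 0 h ->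
  (forall y, om y h = 0) -> h = 0.
Proof.
move=> /pos_degP[Hm H0 H1] omh.
have omP y : ⁅L_em hP y : L P, n0 h⁆ = 0 /\ pos_act (L_em hP y : L P) (n1 h) = 0.
  have e : ⁅thetam (y, 0), h⁆ = 0 := omh (y, 0).
  move: e; rewrite thetam_l L_br0 => e; split; first exact: (congr1 (fun h : N => n0 h)
    e).
  exact: (congr1 (fun h : N => n1 h) e).
have omE (w : EN) : L_om hE w h = 0.
  apply: (mod_ind (E := EN) (K := fun w => L_om hE w h = 0)) w => [|w|y w Hw].
  - split=> [|c u v Hu Hv]; first exact: (bl0l (L_om_bil hE)).
    by rewrite (blPl (L_om_bil hE)) Hu Hv scaler0 addr0.
  - have e : ⁅thetam (0, w), h⁆ = 0 := omh (0, w).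
    by move: e; rewrite thetam_r L_brm.
  - have E0 : L_o0 hE (L_em hP y : L P) h = 0.
      have e : ⁅thetam (y, 0), h⁆ = 0 := omh (y, 0).
      by move: e; rewrite thetam_l L_br0.
    have := L_o0_om hE (L_em hP y : L P) w h.
    rewrite E0 Hw (linP0 ((L_o0_bil hE).1 _)) (bl0r (L_om_bil hE)) addr0 => /esym.
    by move=> e; rewrite -[RHS]e; congr (L_om hE _ h); rewrite -neg_actm.
apply: dsum_ext => -[[|[|j]]|j].
- by apply: (L_trp (hP := hP) H0) => y; rewrite -L_brm; have [] := omP y.
- apply: (g_tr (g := EP) H1) => y; rewrite -pos_actm; by have [] := omP y.
- apply: funext => w.
  have e : - (h (Posz j.+2) : Uneg P Q -> _) w = 0 := congr1 (fun h : N => h (Posz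
    j.+1)) (omE w).
  by move/eqP: e; rewrite oppr_eq0 => /eqP.
- exact: Hm.
Qed.

Lemma thetam_tr n (h : ext_sum_mod) : @genm k (locP hR) LR ext_sum_mod thetam n.+1 0 h ->
  (forall y, op y h = 0) -> h = 0.
Proof.
move=> G omh; have [Hm H0 H1] := neg_degP G.
have omP y : ⁅L_ep hP y : L P, n0 h⁆ = 0 /\ neg_act (L_ep hP y : L P) (nm1 h) = 0.
  have e : ⁅thetap (y, 0), h⁆ = 0 := omh (y, 0).
  move: e; rewrite thetap_l L_br0 => e; split; first exact: (congr1 (fun h : N => n0 h)
    e).
  exact: (congr1 (fun h : N => nm1 h) e).
have omE (w : EP) : L_op hE w h = 0.
  apply: (mod_ind (E := EP) (K := fun w => L_op hE w h = 0)) w => [|w|y w Hw].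
  - split=> [|c u v Hu Hv]; first exact: (bl0l (L_op_bil hE)).
    by rewrite (blPl (L_op_bil hE)) Hu Hv scaler0 addr0.
  - have e : ⁅thetap (0, w), h⁆ = 0 := omh (0, w).
    by move: e; rewrite thetap_r L_brp.
  - have E0 : L_o0 hE (L_ep hP y : L P) h = 0.
      have e : ⁅thetap (y, 0), h⁆ = 0 := omh (y, 0).
      by move: e; rewrite thetap_l L_br0.
    have := L_o0_op hE (L_ep hP y : L P) w h.
    rewrite E0 Hw (linP0 ((L_o0_bil hE).1 _)) (bl0r (L_op_bil hE)) addr0 => /esym.
    by move=> e; rewrite -[RHS]e; congr (L_op hE _ h); rewrite -pos_actp.
apply: dsum_ext => -[[|j]|[|j]].
- by apply: (L_trm (hP := hP) H0) => y; rewrite -L_brp; have [] := omP y.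
- exact: Hm.
- apply: (g_tr (g := EN) H1) => y; rewrite -neg_actp; by have [] := omP y.
- apply: funext => w.
  have e : - (h (Negz j.+1) : Upos P Q -> _) w = 0 := congr1 (fun h : N => h (Negz j))
    (omE w).
  by move/eqP: e; rewrite oppr_eq0 => /eqP.
Qed.

Lemma theta_ex : exists th : hom (L R) N,
  [/\ forall a, th (L_e0 hR a) = theta0 a, forall v, th (L_ep hR v) = thetap v,
      forall w, th (L_em hR w) = thetam w &
   [/\ forall z w, th ⁅z, w⁆ = ⁅th z, th w⁆,
      forall n z, homog z (Posz n.+1) -> pos_deg n (th z) &
      forall n z, homog z (Negz n) -> neg_deg n (th z)]].
Proof.
have skew (a b c : N) : ⁅a, b⁆ = c -> ⁅b, a⁆ = - c.
  by move=> <-; rewrite (brC (L_lie hE)).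
have hp0 v a : ⁅thetap v, theta0 a⁆ = - thetap (rho R a v) by apply/skew/theta0p.
have hm0 v a : ⁅thetam v, theta0 a⁆ = - thetam (crho R a v) by apply/skew/theta0m.
have hpm v w : ⁅thetap v, thetam w⁆ = theta0 (Phi R v w).
  by rewrite -[RHS]opprK; apply/skew/thetamp.
have [th [[t0 tp tm] [T0 Tp Tm TD]]] := @lie_rec k (locP hR) LR ext_sum_mod theta0
  thetap thetam
  theta0_lin thetap_lin thetam_lin theta00 theta0p theta0m hp0 hm0 hpm thetamp thetap_tr
    thetam_tr.
exists th; split=> //; split.
- have Rb := br_bil (L_lie hR).
  apply: (loc_ind (X := LR) (K := fun z => forall w, th (⁅z : L R, w⁆) = ⁅th z : N, th w
    : N⁆)).
  + split=> [w|c u v Hu Hv w].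
      by rewrite (bl0l Rb) (linP0 (hom_lin th)) (bl0l Nb).
    by rewrite (blPl Rb) !(hom_lin th) (blPl Nb) Hu Hv.
  + by move=> a w; rewrite L_br0 t0; apply: T0.
  + by move=> a w; rewrite L_brp tp; apply: Tp.
  + by move=> a w; rewrite L_brm tm; apply: Tm.
  + move=> x z Hz w; rewrite (_ : op x z = ⁅L_ep hR x : L R, z⁆); last by rewrite L_brp.
    have E u : th (⁅L_ep hR x : L R, u⁆) = ⁅thetap x, th u : N⁆ by rewrite L_brp; apply:
      Tp.
    by rewrite (br_adj (L_lie hR)) (linPB (hom_lin th)) !E !Hz !E (br_adj (L_lie hE)).
  + move=> x z Hz w; rewrite (_ : om x z = ⁅L_em hR x : L R, z⁆); last by rewrite L_brm.
    have E u : th (⁅L_em hR x : L R, u⁆) = ⁅thetam x, th u : N⁆ by rewrite L_brm; apply: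
      Tm.
    by rewrite (br_adj (L_lie hR)) (linPB (hom_lin th)) !E !Hz !E (br_adj (L_lie hE)).
- by move=> n z hz; apply: pos_degP (TD (Posz n.+1) z hz).
- by move=> n z hz; apply: neg_degP (TD (Negz n) z hz).
Qed.

Let BP := BL_is hP B0_sym.
Let BE := BL_is hE (BL_sym BP).
Let BR := BL_is hR B0_sym.

Section Theta.
Variable th : hom (L R) N.
Hypotheses (t0 : forall a, th (L_e0 hR a) = theta0 a) (tp : forall v, th (L_ep hR v) =
  thetap v)
  (tm : forall w, th (L_em hR w) = thetam w) (tbr : forall z w, th ⁅z, w⁆ = ⁅th z, th w⁆)
  (tpos : forall n z, homog z (Posz n.+1) -> pos_deg n (th z))
  (tneg : forall n z, homog z (Negz n) -> neg_deg n (th z)).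

(** A local element pairs only with degrees -1, 0 and 1, so these components are all that the
    comparison of forms sees. *)
Lemma theta_local (w : L R) :
  [/\ n0 (th w) (Posz 0) = w (Posz 0),
      n0 (th w) (Posz 1) = (w (Posz 1)).1 /\ n1 (th w) 0%N = (w (Posz 1)).2 &
      n0 (th w) (Negz 0) = (w (Negz 0)).1 /\ nm1 (th w) 0%N = (w (Negz 0)).2].
Proof.
apply: (l_ind (g := LR) (K := fun w : L R =>
  [/\ n0 (th w) (Posz 0) = w (Posz 0),
      n0 (th w) (Posz 1) = (w (Posz 1)).1 /\ n1 (th w) 0%N = (w (Posz 1)).2 &
      n0 (th w) (Negz 0) = (w (Negz 0)).1 /\ nm1 (th w) 0%N = (w (Negz 0)).2])).
  split=> [|c u v [u0 [u1 u1'] [u2 u2']] [v0 [v1 v1'] [v2 v2']]].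
    by rewrite (linP0 (hom_lin th)).
  have e i : (c *: th u + th v : N) i = c *: (th u : N) i + (th v : N) i := dsumPE _ _ _
    _.
  rewrite (hom_lin th) !e; split; [|split|split].
  - by apply: etrans (dsumPE c (n0 (th u)) (n0 (th v)) 0) _; rewrite u0 v0 dsumPE.
  - by apply: etrans (dsumPE c (n0 (th u)) (n0 (th v)) 1) _; rewrite u1 v1 dsumPE.
  - by apply: etrans (dsumPE c (n1 (th u)) (n1 (th v)) 0%N) _; rewrite u1' v1' dsumPE.
  - by apply: etrans (dsumPE c (n0 (th u)) (n0 (th v)) (-1)) _; rewrite u2 v2 dsumPE.
  - by apply: etrans (dsumPE c (nm1 (th u)) (nm1 (th v)) 0%N) _; rewrite u2' v2' dsumPE.
case=> [[|n]|n] {}w hw.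
- by rewrite (homog0E hR hw) t0; split.
- have [n00|nn0] := eqVneq n 0%N.
    have [v ->] : exists v, w = L_ep hR v.
      by exists (w 1); apply: (homog1E hR); rewrite n00 in hw.
    have e i : (thetap v : N) i = (L_e0 hE (L_ep hP v.1 : L P) : N) i + (L_ep hE (gi (g
      := EP) v.2) : N) i :=
      dsumDE _ _ _.
    by rewrite tp !e !(addr0, add0r).
  have [Hm H0 H1] := tpos hw; have w0 : w (Negz 0) = 0 := hw (Negz 0) isT.
  have nn : 1%Z != Posz n.+1 by apply: contra_neq nn0 => -[].
  have w1 : w (Posz 1) = 0 := hw (Posz 1) nn.
  rewrite Hm w0 w1; split; [|split|split] => //.
  - exact: etrans (H0 (Posz 0) isT) (esym (hw (Posz 0) isT)).
  - exact: H0 nn.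
  - by apply: H1; rewrite eq_sym.
  - exact: H0 (Negz 0) isT.
- have [n00|nn0] := eqVneq n 0%N.
    have [v ->] : exists v, w = L_em hR v.
      by exists (w (-1)); apply: (homogm1E hR); rewrite n00 in hw.
    have e i : (thetam v : N) i = (L_e0 hE (L_em hP v.1 : L P) : N) i + (L_em hE (gi (g
      := EN) v.2) : N) i :=
      dsumDE _ _ _.
    by rewrite tm !e !(addr0, add0r).
  have [Hm H0 H1] := tneg hw; have w1 : w (Posz 1) = 0 := hw (Posz 1) isT.
  have nn : Negz 0 != Negz n by apply: contra_neq nn0 => -[].
  have w0 : w (Negz 0) = 0 := hw (Negz 0) nn.
  rewrite (Hm 0%N) w0 w1; split; [|split|split] => //.
  - exact: etrans (H0 (Posz 0) isT) (esym (hw (Posz 0) isT)).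
  - exact: H0 (Posz 1) isT.
  - exact: H0 nn.
  - by apply: H1; rewrite eq_sym.
Qed.

(** Invariance of both forms reduces [z] to the local part. There both sides are [B0], or the sum of
    the pairings of [P] and [Q]. *)
Lemma theta_form z w : @BL _ _ _ (pentad_ext P Q) (th z) (th w) = @BL k g B0 R z w.
Proof.
have [HE _ _] := ext_form_props hP hQ.
have bE : is_bilinear (@BL _ _ _ (pentad_ext P Q) : _ -> _ -> k^o) := BL_bilin BE.
have bR : is_bilinear (@BL _ _ _ R : _ -> _ -> k^o) := BL_bilin BR.
have Einv (a b c : N) : BL ⁅a, b⁆ c = - BL b ⁅a, c⁆.
  by rewrite (brC (L_lie hE)) (blNl bE) (BL_inv BE).
have Rinv (a b c : L R) : BL ⁅a, b⁆ c = - BL b ⁅a, c⁆.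
  by rewrite (brC (L_lie hR)) (blNl bR) (BL_inv BR).
have step (a z' : L R) : (forall w, BL (th z' : N) (th w : N) = BL z' w) ->
    forall w, BL (th ⁅a, z'⁆ : N) (th w : N) = BL ⁅a, z'⁆ w.
  by move=> H w'; rewrite tbr Einv -tbr H Rinv.
have pair0 u (w' : EN) : ext_form (hP := hP) (hQ := hQ) (gi (g := EP) u) w' = pairing Q
  u (w' 0%N).
  have bf : is_bilinear (ext_form (hP := hP) (hQ := hQ) : _ -> _ -> k^o) := epair_bilin
    HE.
  apply: (graded_eq (g_gr EN) (H := k^o) (f := fun w' => ext_form (hP := hP) (hQ := hQ)
    (gi (g := EP) u) w')
    (h := fun w' : EN => pairing Q u (w' 0%N))).
  - exact: bf.1.
  - by move=> c a b; rewrite dsumPE (blPr (pairing_bil' hQ)).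
  case=> [|n] {}w' hw'; first exact: (epair_0 HE (gD_gi EP u) hw').
  by rewrite (hw' 0%N) // (bl0r (pairing_bil' hQ)); apply: (epair_orth HE (gD_gi EP u)
    hw').
have pair1 (w' : EP) u : ext_form (hP := hP) (hQ := hQ) w' (gi (g := EN) u) = pairing Q
  (w' 0%N) u.
  have bf : is_bilinear (ext_form (hP := hP) (hQ := hQ) : _ -> _ -> k^o) := epair_bilin
    HE.
  apply: (graded_eq (g_gr EP) (H := k^o) (f := fun w' => ext_form (hP := hP) (hQ := hQ)
    w' (gi (g := EN) u))
    (h := fun w' : EP => pairing Q (w' 0%N) u)).
  - exact: bf.2.
  - by move=> c a b; rewrite dsumPE (blPl (pairing_bil' hQ)).
  case=> [|n] {}w' hw'; first exact: (epair_0 HE hw' (gD_gi EN u)).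
  by rewrite (hw' 0%N) // (bl0l (pairing_bil' hQ)); apply: (epair_orth HE hw' (gD_gi EN
    u)).
move: w; apply: (loc_ind (X := LR) (K := fun z : L R => forall w : L R,
  BL (th z : N) (th w : N) = BL z w)) z.
- split=> [w|c u v Hu Hv w].
    by rewrite (linP0 (hom_lin th)) (bl0l bE) (bl0l bR).
  by rewrite (hom_lin th) (blPl bE) (blPl bR) Hu Hv.
- move=> a w; have [w0 _ _] := theta_local w.
  rewrite t0 (BL_e0 hR B0_sym) (BL_e0 hE (BL_sym BP)).
  by rewrite (BL_e0 hP B0_sym) w0.
- move=> v w; have [_ _ [w1 w2]] := theta_local w.
  rewrite tp (blDl bE) (BL_ep hR B0_sym) (BL_e0 hE (BL_sym BP)) (BL_ep hP B0_sym) w1.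
  rewrite (BL_ep hE (BL_sym BP)); congr (_ + _).
  by apply: etrans (pair0 _ _) _; rewrite -w2.
- move=> v w; have [_ [w1 w2] _] := theta_local w.
  rewrite tm (blDl bE) (BL_em hR B0_sym) (BL_e0 hE (BL_sym BP)) (BL_em hP B0_sym) w1.
  rewrite (BL_em hE (BL_sym BP)); congr (_ + _).
  by apply: etrans (pair1 _ _) _; rewrite -w2.
- move=> x z Hz; rewrite (_ : op x z = ⁅L_ep hR x : L R, z⁆); last by rewrite L_brp.
  exact: step.
- move=> x z Hz; rewrite (_ : om x z = ⁅L_em hR x : L R, z⁆); last by rewrite L_brm.
  exact: step.
Qed.

Lemma theta_inj z : th z = 0 -> z = 0.
Proof.
move=> thz; apply: (BL_nondeg BR).1 => w; rewrite -theta_form thz.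
exact: (bl0l (BL_bilin BE : is_bilinear (@BL _ _ _ (pentad_ext P Q) : _ -> _ -> k^o))).
Qed.

(** The image is a subalgebra. It contains L(P) in outer degree 0, then both extensions, which L(P)
    generates from their lowest pieces, then everything. *)
Lemma theta_surj (h : N) : exists z, th z = h.
Proof.
have sub (U : lmodType k) (j : U -> N) : linear j -> is_submod (fun u => exists z, th z
  = j u).
  move=> lj; split=> [|c u v [zu Hu] [zv Hv]].
    by exists 0; rewrite (linP0 (hom_lin th)) (linP0 lj).
  by exists (c *: zu + zv); rewrite (hom_lin th) Hu Hv lj.
have br (a b : N) : (exists z, th z = a) -> (exists z, th z = b) -> exists z, th z = ⁅a,
  b⁆.
  by move=> [za <-] [zb <-]; exists ⁅za, zb⁆; rewrite tbr.
have s0 (s : L P) : exists z, th z = L_e0 hE s.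
  apply: (loc_ind (X := LP) (sub _ _ (L_e0_lin hE))) s => [a|x|y|x s Hs|y s Hs].
  - by exists (L_e0 hR a); rewrite t0.
  - by exists (L_ep hR (x, 0)); rewrite tp thetap_l.
  - by exists (L_em hR (y, 0)); rewrite tm thetam_l.
  - rewrite (_ : op x s = ⁅L_ep hP x : L P, s⁆); last by rewrite L_brp.
    rewrite -br_e0e0; apply: br => //.
    by exists (L_ep hR (x, 0)); rewrite tp thetap_l.
  - rewrite (_ : om y s = ⁅L_em hP y : L P, s⁆); last by rewrite L_brm.
    rewrite -br_e0e0; apply: br => //.
    by exists (L_em hR (y, 0)); rewrite tm thetam_l.
have sp (u : EP) : exists z, th z = L_ep hE u.
  apply: (mod_ind (E := EP) (sub _ _ (L_ep_lin hE))) u => [u|x u Hu].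
    by exists (L_ep hR (0, u)); rewrite tp thetap_r.
  by rewrite -pos_actp -br_e0ep; apply: br.
have sm (u : EN) : exists z, th z = L_em hE u.
  apply: (mod_ind (E := EN) (sub _ _ (L_em_lin hE))) u => [u|x u Hu].
    by exists (L_em hR (0, u)); rewrite tm thetam_r.
  by rewrite -neg_actm -br_e0em; apply: br.
apply: (loc_ind (X := LE) (sub _ (fun u => u) (fun _ _ _ => erefl))) h => //.
- move=> x h Hh; rewrite (_ : op x h = ⁅L_ep hE x : N, h⁆); last by rewrite L_brp.
  exact: br.
- move=> x h Hh; rewrite (_ : om x h = ⁅L_em hE x : N, h⁆); last by rewrite L_brm.
  exact: br.
Qed.
End Theta.

Lemma lie_iso_ext_sum : lie_isomorphic N (L R).
Proof.
have [th [t0 tp tm [tbr tpos tneg]]] := theta_ex.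
have inj := theta_inj t0 tp tm tbr tpos tneg; have surj := theta_surj t0 tp tm tbr.
split; [exact: L_lie|split; first exact: L_lie].
(* The required map goes from the extended algebra to that of the sum, so it is the inverse of
   [th]. *)
have [f fK] := choice surj.
have thI z w : th z = th w -> z = w.
  move=> e; apply/eqP; rewrite -subr_eq0; apply/eqP/inj.
  by rewrite (linPB (hom_lin th)) e subrr.
have thK : cancel th f by move=> z; apply: thI; rewrite fK.
have lf : linear f.
  by move=> c u v; apply: thI; rewrite (hom_lin th) !fK.
pose F : {linear N -> L R} := HB.pack f (GRing.isLinear.Build k N (L R) *:%R f lf).
exists F; split; first by exists th.
by move=> a b; apply: thI; rewrite tbr !fK.
Qed.
End Iso.

Theorem theorem3p26 (k : fieldType) (g : lieData k) (B0 : g -> g -> k)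
    (P Q : pentad B0) :
  standard P -> standard Q -> (forall a b : g, B0 a b = B0 b a) ->
  standard (pentad_ext P Q) /\
  lie_isomorphic (L (pentad_ext P Q)) (L (pentad_sum P Q)).
Proof.
move=> hP hQ B0_sym; split; first exact: standard_ext hP hQ B0_sym.
exact: lie_iso_ext_sum hP hQ B0_sym.
Qed.
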